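(* Let $R=k[x,y,z]$ with the standard grading, where $k$ is any field. Given any integer $s\geq 3$ and any integer $r$ with $s\leq r\leq 2s-1$, there exists a homogeneous ideal $I\subset R$ with $\operatorname{Soc}(R/I)\cong k(-s)\oplus k(-2s+1)$ such that $R/I$ is an Artinian compressed ring of Tor algebra class $G(r)$.
   Context: The socle isomorphism is as graded vector spaces: one basis element in degree $s$ and one in degree $2s-1$. $R/I$ compressed means: with $c_\ell=\dim_k \operatorname{Soc}(R/I)_\ell$, $\dim_k (R/I)_i=\min\{\binom{2+i}{i},\ \sum_{\ell=0}^{2s-1} c_\ell\binom{2+\ell-i}{\ell-i}\}$ for $0\le i\le 2s-1$, where binomials with $\ell<i$ are $0$. Tor algebra class: for a homogeneous ideal $I\subseteq R_+^2$ with $\operatorname{pd}_R(R/I)=3$, let $T_\bullet=\operatorname{Tor}_\bullet^R(R/I,k)$ with its graded-commutative algebra structure, $m=\mu(I)$ the minimal number of generators, and $t$ the type of $R/I$. $R/I$ has Tor algebra class $G(r)$ ($r\geq 2$) if there exist bases $e_1,\dots,e_m$ of $T_1$, $f_1,\dots,f_{m+t-1}$ of $T_2$, $g_1,\dots,g_t$ of $T_3$ such that the only nonzero products of basis elements of positive degree are $e_if_i=g_1=f_ie_i$ for $1\leq i\leq r$ (so $T_1\cdot T_1=0$, $\operatorname{rank}_k(T_1\cdot T_2)=1$, and the map $T_2\to\operatorname{Hom}_k(T_1,T_3)$ has rank $r$). *)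

(* Defs.v *)
From HB Require Import structures.
From mathcomp Require Import all_boot all_order all_algebra.
From mathcomp Require Export ring_quotient.
From mathcomp.multinomials Require Export mpoly.

Set Implicit Arguments.
Unset Strict Implicit.
Unset Printing Implicit Defensive.

Import GRing.Theory.
Local Open Scope ring_scope.
Local Open Scope quotient_scope.

Section Subquotient.
Variables (k : fieldType) (V : lmodType k).

(* The classes of the [v i] form a basis of the k-space Z / B. *)
Definition is_basis_mod (Z B : V -> Prop) (d : nat) (v : 'I_d -> V) : Prop :=
  [/\ forall i, Z (v i),
      forall c : 'I_d -> k, B (\sum_i c i *: v i) -> forall i, c i = 0
    & forall z, Z z -> exists c : 'I_d -> k, B (z - \sum_i c i *: v i)].

Definition is_basis (Z : V -> Prop) (d : nat) (v : 'I_d -> V) : Prop :=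
  is_basis_mod Z (fun z => z = 0) v.

Definition has_dim (Z : V -> Prop) (d : nat) : Prop :=
  exists v : 'I_d -> V, is_basis Z v.

End Subquotient.

Definition is_ideal (A : comNzRingType) (J : A -> Prop) : Prop :=
  [/\ J 0, forall a b, J a -> J b -> J (a + b) & forall a b, J b -> J (a * b)].

Definition artinian (A : comNzRingType) : Prop :=
  forall J : nat -> A -> Prop,
    (forall i, is_ideal (J i)) -> (forall i a, J i.+1 a -> J i a) ->
    exists N : nat, forall i, (N <= i)%N -> forall a, J N a -> J i a.

(* K(x; A) = A (x) /\ A^n: the function [u] stands for the sum of the
   u(S) e_S, where e_S = e_(s_1) /\ ... /\ e_(s_p) for
   S = {s_1 < ... < s_p}. *)
Section Koszul.
Variables (A : comNzRingType) (n : nat) (x : 'I_n -> A).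

Definition koszul := {ffun {set 'I_n} -> A}.

Definition koszul_deg (p : nat) (u : koszul) : Prop :=
  forall S : {set 'I_n}, #|S| != p -> u S = 0.

(* d(e_(s_1) /\ ... /\ e_(s_p)) is the sum over a of
   (-1)^(a-1) x_(s_a) e_(s_1) /\ ... (e_(s_a) omitted) ... /\ e_(s_p). *)
Definition koszul_d (u : koszul) : koszul :=
  [ffun S : {set 'I_n} =>
    \sum_(j | j \notin S)
       (-1) ^+ #|[set i in S | (i < j)%N]| * x j * u (j |: S)].

(* e_S /\ e_T = (-1)^(inversions S T) e_(S U T) for disjoint S and T. *)
Definition inversions (S T : {set 'I_n}) : nat :=
  #|[set ij in setX S T | (ij.2 < ij.1)%N]|.

Definition koszul_mul (u v : koszul) : koszul :=
  [ffun U : {set 'I_n} =>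
    \sum_(S : {set 'I_n} | S \subset U)
       (-1) ^+ inversions S (U :\: S) * u S * v (U :\: S)].

Definition koszul_cycle (p : nat) (u : koszul) : Prop :=
  koszul_deg p u /\ koszul_d u = 0.

Definition koszul_boundary (p : nat) (u : koszul) : Prop :=
  exists2 w, koszul_deg p.+1 w & u = koszul_d w.

End Koszul.

Section QuotientAlgebra.
Variables (k : fieldType) (n : nat) (I : idealr {mpoly k[n]}).
Local Notation A := {ideal_quot I}.

Definition quot_scale (c : k) (a : A) : A := \pi_A c%:MP * a.

Fact quot_scaleA c d a : quot_scale c (quot_scale d a) = quot_scale (c * d) a.
Proof. by rewrite /quot_scale mulrA mpolyCM rmorphM. Qed.

Fact quot_scale1 : left_id 1 quot_scale.
Proof. by move=> a; rewrite /quot_scale mpolyC1 rmorph1 mul1r. Qed.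

Fact quot_scaleDr : right_distributive quot_scale +%R.
Proof. by move=> c a b; rewrite /quot_scale mulrDr. Qed.

Fact quot_scaleDl a : {morph quot_scale^~ a : c d / c + d}.
Proof. by move=> c d; rewrite /quot_scale mpolyCD rmorphD mulrDl. Qed.

HB.instance Definition _ := GRing.Zmodule_isLmodule.Build k A
  quot_scaleA quot_scale1 quot_scaleDr quot_scaleDl.

Fact quot_scaleAl (c : k) (a b : A) : c *: (a * b) = c *: a * b.
Proof. exact: mulrA. Qed.

HB.instance Definition _ := GRing.Lmodule_isLalgebra.Build k A quot_scaleAl.

End QuotientAlgebra.

Section GradedQuotient.
Variables (k : fieldType) (I : idealr {mpoly k[3]}).
Local Notation R := {mpoly k[3]}.
Local Notation A := {ideal_quot I}.

Definition homogeneous_ideal : Prop :=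
  forall p : R, p \in I -> forall d, pihomog mdeg d p \in I.

Definition quot_deg (d : nat) (a : A) : Prop :=
  exists2 p : R, p \is d.-homog & a = \pi_A p.

Definition quot_var (i : 'I_3) : A := \pi_A 'X_i.

Definition socle (a : A) : Prop := forall i, quot_var i * a = 0.

Definition socle_deg (d : nat) (a : A) : Prop := socle a /\ quot_deg d a.

(* Soc(R/I) is isomorphic, as a graded k-space, to the direct sum of the
   k(-d) for d in [ds]. *)
Definition socle_iso (ds : seq nat) : Prop :=
  exists v : 'I_(size ds) -> A,
    is_basis socle v /\ forall i : 'I_(size ds), quot_deg (nth 0%N ds i) (v i).

(* [e] is the top socle degree. *)
Definition compressed (e : nat) : Prop :=
  exists2 c : nat -> nat, forall l, has_dim (socle_deg l) (c l) &
    forall i, (i <= e)%N ->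
      has_dim (quot_deg i)
        (minn 'C(2 + i, i)%N
              (\sum_(l < e.+1 | (i <= l)%N) c l * 'C(2 + (l - i), l - i))).

Definition generated_by (m : nat) (g : 'I_m -> R) : Prop :=
  forall p : R, p \in I <-> exists c : 'I_m -> R, p = \sum_i c i * g i.

Definition min_gens (m : nat) : Prop :=
  (exists g : 'I_m -> R, generated_by g) /\
  forall (m' : nat) (g : 'I_m' -> R), generated_by g -> (m <= m')%N.

(* Tor^R(R/I, k) is computed with the Koszul resolution of k over R, a
   graded-commutative DG algebra: it is the homology algebra of
   R/I (x)_R K(x, y, z; R) = K(x, y, z; R/I). *)
Definition tor_basis (p d : nat) (v : 'I_d -> koszul A 3) : Prop :=
  is_basis_mod (koszul_cycle quot_var p) (koszul_boundary quot_var p) v.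

Definition tor_eq (p : nat) (u v : koszul A 3) : Prop :=
  koszul_boundary quot_var p (u - v).

(* The index t below is the type minus one: the type is t.+1, so that T_2 has
   m + t basis elements, and the indices start at 0. For degree reasons the
   only products of positive-degree elements that can be nonzero are those in
   T_1 T_1, T_1 T_2 and T_2 T_1. The requirement pd(R/I) = 3, i.e. T_3 <> 0,
   is carried by the basis element [g ord0] of T_3. *)
Definition tor_class_G (r : nat) : Prop :=
  [/\ (2 <= r)%N,
      forall p : R, p \in I -> {in msupp p, forall mon, (2 <= mdeg mon)%N}
    & exists m t : nat,
      exists (e : 'I_m -> koszul A 3) (f : 'I_(m + t) -> koszul A 3)
             (g : 'I_t.+1 -> koszul A 3),
      [/\ min_gens m /\ has_dim socle t.+1,
          (r <= m)%N,
          [/\ tor_basis 1 e, tor_basis 2 f & tor_basis 3 g],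
          forall i j, tor_eq 2 (koszul_mul (e i) (e j)) 0
        & forall (i : 'I_m) (j : 'I_(m + t)),
            let ij := if (i == j :> nat) && (i < r)%N then g ord0 else 0 in
            tor_eq 3 (koszul_mul (e i) (f j)) ij /\
            tor_eq 3 (koszul_mul (f j) (e i)) ij]].

End GradedQuotient.

(* Main.v *)
(* Macaulay inverse systems. Write [i,j] = U_i(x,y) W_j(x,z), where U_i and W_j
   are homogenized Chebyshev polynomials; they are orthonormal for a functional
   F_0 defined over any field. Perturb F_0 in degree 2s-1 by the coefficient of
   y^b z^(2s-1-b), b = r - s, to get F. The Gorenstein ideal G = Ann(F) is zero
   in degrees < s, and G_s has the basis Q_i = [i,s-i] - x [b-i,s-1-b+i]
   (i <= b), Q_i = [i,s-i] (i > b), i = 0, ..., s. Let I be the subideal of G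
   obtained by replacing G_s by its hyperplane V of forms vanishing at a point
   (0,1,beta). Then Soc(R/I) has one generator in degree s (the lost element of
   G_s) and one in degree 2s-1, and R/I is compressed.

   T_1 lives in degrees s, s+1 and T_2 in degrees s+1, s+2, so for s >= 3 the
   product T_1 T_1 vanishes and T_1 T_2 lies in the line of T_3 of degree 2s+2.
   Hence R/I has class G(r) where r is the rank of the pairing
   T_1 x T_2 -> k, (u, w) |-> F(u . w). By duality this rank is s (from V) plus
   the number of linear syzygies of V. From the relations
   y Q_i - z Q_(i+1) = x (Q_(b-i-1) - Q_(b-i+1)) for i < b one finds exactly b
   linear syzygies, with beta = 0 if b <= s-2 and beta = 1 if b = s-1. *)

From HB Require Import structures.
Require Import Defs.
From mathcomp Require Import all_boot all_order all_algebra.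
From mathcomp Require Import ring zify.
From mathcomp.multinomials Require Import ssrcomplements.
From Stdlib Require Import Classical ClassicalEpsilon.

Set Implicit Arguments.
Unset Strict Implicit.
Unset Printing Implicit Defensive.

Import GRing.Theory.
Local Open Scope ring_scope.
Local Open Scope quotient_scope.

(** * Dimensions of subquotients *)
Section Dimension.
Variable k : fieldType.

(** The use of two kinds of Chebyshev polynomials is a device for b = s-1. Both satisfy the same
    recurrence, but W_1 = z + x gives the boundary rule z W_0 = W_1 - x W_0. For b = s-1 the
    relation with i = 0 involves Q_s, which lies outside the hyperplane spanned by Q_0, ..., Q_(s-1)
    that beta = 0 defines. The boundary rule supplies one more relation, x (Q_1 - Q_s) + y Q_(s-1) -
    z Q_s = 0. At beta = 1 the evaluation is 1 on every Q_i, so in each of these s relations the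
    coefficients of x, y, z take the values 0, 1, -1, and differences of relations are linear
    syzygies of V; this leaves b of them. That there are no more comes from duality. A 2-cycle is
    lifted to w = (w_0, w_1, w_2) over R, and the element x^2 U_l W_(s-1-l) of I pairs with w to the
    coefficient of y^l z^(s-1-l) in w_0. If these coefficients vanish for l < b, further relations
    force them to vanish for all l < s. *)

Definition subspace (V : lmodType k) (Z : V -> Prop) : Prop :=
  Z 0 /\ forall c u v, Z u -> Z v -> Z (c *: u + v).

Definition dim_mod (V : lmodType k) (Z B : V -> Prop) (d : nat) : Prop :=
  exists v : 'I_d -> V, is_basis_mod Z B v.

Definition in_span (V : lmodType k) (N : nat) (w : 'I_N -> V) (v : V) : Prop :=
  exists c : 'I_N -> k, v = \sum_i c i *: w i.

Section OneSpace.
Variable V : lmodType k.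
Implicit Types (Z B Y : V -> Prop).

Lemma subspaceD Z u v : subspace Z -> Z u -> Z v -> Z (u + v).
Proof. by case=> _ h Zu Zv; rewrite -[u]scale1r; apply: h. Qed.

Lemma subspaceZ Z c u : subspace Z -> Z u -> Z (c *: u).
Proof. by case=> h0 h Zu; rewrite -[_ *: _]addr0; apply: h. Qed.

Lemma subspaceN Z u : subspace Z -> Z u -> Z (- u).
Proof. by move=> h Zu; rewrite -scaleN1r; apply: subspaceZ. Qed.

Lemma subspaceB Z u v : subspace Z -> Z u -> Z v -> Z (u - v).
Proof. by move=> h Zu Zv; apply: subspaceD => //; apply: subspaceN. Qed.

Lemma subspace_sum Z (I : Type) (r : seq I) (P : pred I) (f : I -> V) :
  subspace Z -> (forall i, P i -> Z (f i)) -> Z (\sum_(i <- r | P i) f i).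
Proof.
move=> h hf; elim/big_ind: _ => //; first by case: h.
by move=> u v; apply: subspaceD.
Qed.

Lemma subspace0 : subspace (fun v : V => v = 0).
Proof. by split=> // c u v -> ->; rewrite scaler0 addr0. Qed.

Lemma subspaceT : subspace (fun _ : V => True).
Proof. by []. Qed.

(** If d > N, the d by N matrix of coordinates has a nonzero vector in its left kernel, which is a
    relation between the v i modulo B. *)
Lemma indep_leq B d N (v : 'I_d -> V) (w : 'I_N -> V) :
  subspace B ->
  (forall c : 'I_d -> k, B (\sum_i c i *: v i) -> forall i, c i = 0) ->
  (forall i, exists c : 'I_N -> k, B (v i - \sum_j c j *: w j)) ->
  (d <= N)%N.
Proof.
move=> sB ind /= span.
have [a ha] : exists a : 'I_d -> 'I_N -> k,
    forall i, B (v i - \sum_j a i j *: w j).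
  exists (fun i => proj1_sig (constructive_indefinite_description _ (span i))).
  by move=> i; case: (constructive_indefinite_description _ (span i)).
rewrite leqNgt; apply/negP => ltNd.
pose M := \matrix_(i < d, j < N) a i j.
have : kermx M != 0.
  rewrite kermx_eq0 -row_leq_rank -ltnNge.
  by apply: leq_ltn_trans (rank_leq_col M) ltNd.
case/rowV0Pn=> c /sub_kermxP cM /rV0Pn[i0 ci0]; case/eqP: ci0.
apply: (ind (fun i => c 0 i)) => //.
have -> : \sum_i c 0 i *: v i =
    \sum_i c 0 i *: (v i - \sum_j a i j *: w j).
  under [RHS]eq_bigr do rewrite scalerBr.
  rewrite sumrB [X in _ - X](_ : _ = 0) ?subr0 //.
  under eq_bigr do rewrite scaler_sumr.
  rewrite exchange_big /= big1 // => j _.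
  under eq_bigr do rewrite scalerA.
  rewrite -scaler_suml; have /matrixP/(_ 0 j) := cM.
  rewrite !mxE; under eq_bigr do rewrite !mxE.
  by move=> ->; rewrite scale0r.
by apply: subspace_sum => // i _; apply: subspaceZ.
Qed.

Lemma dim_mod_uniq Z B d d' :
  subspace B -> dim_mod Z B d -> dim_mod Z B d' -> d = d'.
Proof.
move=> sB [v [Zv iv sv]] [v' [Zv' iv' sv']].
by apply/eqP; rewrite eqn_leq; apply/andP; split;
  apply: (indep_leq sB); eauto.
Qed.

(** A family independent modulo B is enlarged until it spans; [indep_leq] bounds its length by N, so
    this stops. *)
Lemma dim_mod_exists Z B N (w : 'I_N -> V) :
  subspace Z -> subspace B -> (forall v, B v -> Z v) ->
  (forall v, Z v -> in_span w v) -> exists d, dim_mod Z B d.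
Proof.
move=> sZ sB BZ span.
have bound d (v : 'I_d -> V) : (forall i, Z (v i)) ->
    (forall c : 'I_d -> k, B (\sum_i c i *: v i) -> forall i, c i = 0) ->
    (d <= N)%N.
  move=> Zv iv; apply: (indep_leq sB iv (w := w)) => i.
  by case: (span _ (Zv i)) => c ->; exists c; rewrite subrr; case: sB.
suff H n d (v : 'I_d -> V) : (N - d < n)%N -> (forall i, Z (v i)) ->
    (forall c : 'I_d -> k, B (\sum_i c i *: v i) -> forall i, c i = 0) ->
    exists d, dim_mod Z B d.
  by apply: (H N.+1 0%N (fun => 0)) => [||? ? []] //; [rewrite subn0|case].
elim: n d v => // n IHn d v hn Zv iv.
case: (classic (forall z, Z z -> exists c : 'I_d -> k,
                   B (z - \sum_i c i *: v i))) => [sp|].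
  by exists d, v; split.
move/not_all_ex_not => [z hz]; have [Zz nz] := imply_to_and _ _ hz.
pose v' (i : 'I_d.+1) := if unlift ord0 i is Some j then v j else z.
have Zv' i : Z (v' i) by rewrite /v'; case: unliftP.
have iv' (c : 'I_d.+1 -> k) : B (\sum_i c i *: v' i) -> forall i, c i = 0.
  have h0 : v' ord0 = z by rewrite /v' unlift_none.
  have hl j : v' (lift ord0 j) = v j by rewrite /v' liftK.
  rewrite big_ord_recl h0; under eq_bigr do rewrite hl.
  move=> Bc; have c0 : c ord0 = 0.
    apply/eqP/negP => /negP c0; apply: nz.
    exists (fun i => - (c ord0)^-1 * c (lift ord0 i)).
    have -> : z - \sum_i (- (c ord0)^-1 * c (lift ord0 i)) *: v i =
        (c ord0)^-1 *: (c ord0 *: z + \sum_i c (lift ord0 i) *: v i).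
      rewrite scalerDr scalerA mulVf // scale1r; congr (_ + _).
      rewrite scaler_sumr -sumrN; apply: eq_bigr => i _.
      by rewrite mulNr scaleNr opprK scalerA.
    exact: subspaceZ.
  move: Bc; rewrite c0 scale0r add0r => /iv ci i.
  by case: (unliftP ord0 i) => [j ->|->].
apply: (IHn _ v') => //.
by have := bound _ _ Zv' iv'; lia.
Qed.

Definition fam_cat (T : Type) a b (v : 'I_a -> T) (w : 'I_b -> T) (i : 'I_(a + b)) : T :=
  match split i with inl j => v j | inr j => w j end.

Lemma fam_catl T a b (v : 'I_a -> T) (w : 'I_b -> T) i : fam_cat v w (lshift b i) = v i.
Proof. by rewrite /fam_cat (unsplitK (inl i) : split (lshift b i) = _). Qed.

Lemma fam_catr T a b (v : 'I_a -> T) (w : 'I_b -> T) i : fam_cat v w (rshift a i) = w i.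
Proof. by rewrite /fam_cat (unsplitK (inr i) : split (rshift a i) = _). Qed.

Lemma sum_fam_cat a b (c : 'I_(a + b) -> k) (v : 'I_a -> V) (w : 'I_b -> V) :
  \sum_i c i *: fam_cat v w i =
  \sum_i c (lshift b i) *: v i + \sum_i c (rshift a i) *: w i.
Proof.
rewrite big_split_ord /=; congr (_ + _); apply: eq_bigr => i _.
  by rewrite fam_catl.
by rewrite fam_catr.
Qed.

Lemma fam_cat_all (T : Type) (P : T -> Prop) a b (v : 'I_a -> T) (w : 'I_b -> T) :
  (forall i, P (v i)) -> (forall i, P (w i)) -> forall i, P (fam_cat v w i).
Proof. by move=> hv hw i; rewrite /fam_cat; case: split. Qed.

Lemma is_basis_mod_cat Z Y B a b (v : 'I_a -> V) (w : 'I_b -> V) :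
  subspace Z -> subspace Y ->
  (forall u, Y u -> Z u) -> (forall u, B u -> Y u) ->
  is_basis_mod Z Y v -> is_basis_mod Y B w -> is_basis_mod Z B (fam_cat v w).
Proof.
move=> sZ sY YZ BY [Zv iv sv] [Yw iw sw]; split.
- by apply: fam_cat_all => // i; apply: YZ.
- move=> c; rewrite sum_fam_cat => Bc.
  have c0 : forall i, c (lshift b i) = 0.
    apply: (iv (fun i => c (lshift b i))).
    rewrite -[X in Y X](addrK (\sum_i c (rshift a i) *: w i)).
    apply: subspaceB => //; first exact: BY.
    by apply: subspace_sum => // i _; apply: subspaceZ.
  move: Bc; rewrite big1 ?add0r => [/(iw (fun i => c (rshift a i))) c1 i|i _];
    last by rewrite c0 scale0r.
  by rewrite -(splitK i); case: (split i).
- move=> z /sv[c /sw[c' h]]; exists (fam_cat c c').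
  rewrite sum_fam_cat; under eq_bigr do rewrite fam_catl.
  by under [X in _ - (_ + X)]eq_bigr do rewrite fam_catr; rewrite opprD addrA.
Qed.

Lemma dim_mod_cat Z Y B a b :
  subspace Z -> subspace Y ->
  (forall u, Y u -> Z u) -> (forall u, B u -> Y u) ->
  dim_mod Z Y a -> dim_mod Y B b -> dim_mod Z B (a + b).
Proof.
move=> sZ sY YZ BY [v hv] [w hw]; exists (fam_cat v w).
exact: is_basis_mod_cat hv hw.
Qed.

Lemma dim_mod0 Z B : dim_mod Z B 0 -> forall v, Z v -> B v.
Proof. by move=> [w [_ _ h]] v /h[c]; rewrite big_ord0 subr0. Qed.

Lemma is_basis_mod_congr Z B d (v w : 'I_d -> V) :
  subspace B -> (forall i, Z (w i)) -> (forall i, B (v i - w i)) ->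
  is_basis_mod Z B v -> is_basis_mod Z B w.
Proof.
move=> sB Zw vw [Zv iv sv].
have D c : B (\sum_i c i *: v i - \sum_i c i *: w i).
  rewrite -sumrB; apply: subspace_sum => // i _.
  by rewrite -scalerBr; apply: subspaceZ.
split=> //.
  move=> c Bc; apply: iv; rewrite -[X in B X](subrK (\sum_i c i *: w i)).
  exact: subspaceD.
move=> z /sv[c Bc]; exists c.
rewrite -[z](subrK (\sum_i c i *: v i)) -addrA.
exact: subspaceD.
Qed.

End OneSpace.

(** The hypotheses say that f induces an isomorphism from Z / B to Z' / B'. *)
Lemma is_basis_mod_map (V V' : lmodType k) (Z B : V -> Prop) (Z' B' : V' -> Prop)
    (f : V -> V') d (v : 'I_d -> V) :
  linear f -> subspace Z -> subspace B' ->
  (forall u, Z u -> Z' (f u)) -> (forall u, Z u -> B' (f u) -> B u) ->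
  (forall u, B u -> B' (f u)) ->
  (forall z, Z' z -> exists2 u, Z u & B' (z - f u)) ->
  is_basis_mod Z B v -> is_basis_mod Z' B' (f \o v).
Proof.
move=> lf sZ sB' fZ fB Bf sur [Zv iv sv].
have f0 : f 0 = 0.
  by have := lf (-1) 0 0; rewrite scaler0 addr0 scaleN1r addNr.
have fD x y : f (x + y) = f x + f y by have := lf 1 x y; rewrite !scale1r.
have fs (c : 'I_d -> k) : f (\sum_i c i *: v i) = \sum_i c i *: f (v i).
  rewrite (big_morph f fD f0); apply: eq_bigr => i _.
  by have := lf (c i) (v i) 0; rewrite f0 !addr0.
split.
- by move=> i; apply: fZ.
- move=> c Bc; apply: iv; apply: fB; last by rewrite fs.
  by apply: subspace_sum => // i _; apply: subspaceZ.
- move=> z /sur[u Zu Bu]; case: (sv u Zu) => c /Bf Bc; exists c.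
  have -> : z - \sum_i c i *: f (v i) = (z - f u) + f (u - \sum_i c i *: v i).
    rewrite -fs; set t := \sum_i _.
    have -> : f (u - t) = f u - f t by apply: (addIr (f t)); rewrite -fD !subrK.
    by rewrite addrA subrK.
  exact: subspaceD.
Qed.

Lemma dim_mod_map (V V' : lmodType k) (Z B : V -> Prop) (Z' B' : V' -> Prop)
    (f : V -> V') d :
  linear f -> subspace Z -> subspace B' ->
  (forall u, Z u -> Z' (f u)) -> (forall u, Z u -> B' (f u) -> B u) ->
  (forall u, B u -> B' (f u)) ->
  (forall z, Z' z -> exists2 u, Z u & B' (z - f u)) ->
  dim_mod Z B d -> dim_mod Z' B' d.
Proof.
move=> lf sZ sB' h1 h2 h3 h4 [v hv]; exists (f \o v).
exact: is_basis_mod_map hv.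
Qed.

Lemma has_dim_fin (V : lmodType k) (T : finType) (Z : V -> Prop) (v : T -> V) :
  (forall i, Z (v i)) ->
  (forall c : T -> k, \sum_i c i *: v i = 0 -> forall i, c i = 0) ->
  (forall z, Z z -> exists c : T -> k, z = \sum_i c i *: v i) ->
  has_dim Z #|T|.
Proof.
move=> Zv iv sv; exists (fun i => v (enum_val i)); split=> //.
- move=> c hc i; rewrite -[i]enum_valK.
  apply: (iv (fun t => c (enum_rank t))).
  rewrite -[RHS]hc (reindex (@enum_val T T)) /=; last exact/onW_bij/enum_val_bij.
  by apply: eq_bigr => j _; rewrite enum_valK.
- move=> z /sv[c ->]; exists (fun i => c (enum_val i)).
  rewrite (reindex (@enum_val T T)) /=; last exact/onW_bij/enum_val_bij.
  exact: subrr.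
Qed.

End Dimension.

(** * Linear functionals on polynomials *)
Section Functional.
Variables (k : fieldType) (n : nat).
Local Notation R := {mpoly k[n]}.
Implicit Types (f : 'X_{1..n} -> k) (p q : R).

Definition mlin f p : k := \sum_(m <- msupp p) p@_m * f m.

Lemma mlinwE f p d : (msize p <= d)%N ->
  mlin f p = \sum_(m : 'X_{1..n < d}) p@_m * f m.
Proof.
move=> le_pd; pose I : subFinType _ := 'X_{1..n < d}.
rewrite /mlin (big_mksub I) //=; first last.
+ by move=> m /msize_mdeg_lt /leq_trans; apply.
+ by rewrite msupp_uniq.
by rewrite big_rmcond //= => m /memN_msupp_eq0 ->; rewrite mul0r.
Qed.

Fact mlin_linear f : linear_for *%R (mlin f).
Proof.
move=> c p q /=; pose d := maxn (msize (c *: p + q)) (maxn (msize p) (msize q)).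
rewrite !(@mlinwE _ _ d) ?leq_max ?leqnn ?orbT //.
rewrite mulr_sumr -big_split /=; apply: eq_bigr => m _.
by rewrite mcoeffD mcoeffZ mulrDl mulrA.
Qed.

HB.instance Definition _ f := GRing.isLinear.Build k R k _ (mlin f) (mlin_linear f).

Lemma mlinX f m : mlin f 'X_[m] = f m.
Proof. by rewrite /mlin msuppX big_seq1 mcoeffX eqxx mul1r. Qed.

Lemma mlin_ext (phi : {scalar R}) : phi =1 mlin (fun m => phi 'X_[m]).
Proof.
move=> p; rewrite {1}[p]mpolyE linear_sum; apply: eq_bigr => m _.
by rewrite linearZ.
Qed.

Lemma eq_mlin f g p : (forall m, p@_m != 0 -> f m = g m) -> mlin f p = mlin g p.
Proof.
move=> fg; rewrite /mlin big_seq [RHS]big_seq; apply: eq_bigr => m.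
by rewrite mcoeff_msupp => /fg ->.
Qed.

Lemma mlinD f g p : mlin (fun m => f m + g m) p = mlin f p + mlin g p.
Proof. by rewrite /mlin -big_split; apply: eq_bigr => m _; rewrite mulrDr. Qed.

Lemma mlinN f p : mlin (fun m => - f m) p = - mlin f p.
Proof. by rewrite /mlin -sumrN; apply: eq_bigr => m _; rewrite mulrN. Qed.

Lemma mlin0 p : mlin (fun=> 0) p = 0.
Proof. by rewrite /mlin big1 // => m _; rewrite mulr0. Qed.

Lemma scalarM (phi : {scalar R}) p q :
  phi (p * q) = mlin (fun m => phi (p * 'X_[m])) q.
Proof.
rewrite {1}[q]mpolyE mulr_sumr linear_sum; apply: eq_bigr => m _.
by rewrite -scalerAr linearZ.
Qed.

(** The contraction action of monomials on functionals, on which inverse systems rest. *)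
Lemma mlinMX f m p : mlin f ('X_[m] * p) = mlin (fun m' => f (m + m')%MM) p.
Proof. by rewrite scalarM; apply: eq_mlin => m' _; rewrite -mpolyXD /= mlinX. Qed.

Lemma mlin_coef m p : p@_m = mlin (fun m' => (m' == m)%:R) p.
Proof.
by rewrite -[p@_m]/(mcoeff m p) mlin_ext; apply: eq_mlin => m' _; rewrite /= mcoeffX.
Qed.

End Functional.

(** * Chebyshev bases and moment functionals *)
Section ThreeVariables.
Variable k : fieldType.
Local Notation R := {mpoly k[3]}.
Implicit Types (p q : R) (m : 'X_{1..3}).

Definition i0 : 'I_3 := @Ordinal 3 0 isT.
Definition i1 : 'I_3 := @Ordinal 3 1 isT.
Definition i2 : 'I_3 := @Ordinal 3 2 isT.

Lemma forall_I3 (P : 'I_3 -> Prop) : P i0 -> P i1 -> P i2 -> forall i, P i.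
Proof.
move=> h0 h1 h2 [[|[|[|//]]] lt_i].
- by rewrite (_ : Ordinal lt_i = i0) //; apply: val_inj.
- by rewrite (_ : Ordinal lt_i = i1) //; apply: val_inj.
- by rewrite (_ : Ordinal lt_i = i2) //; apply: val_inj.
Qed.

Lemma sum_I3 (V : nmodType) (F : 'I_3 -> V) : \sum_i F i = F i0 + F i1 + F i2.
Proof.
rewrite !big_ord_recl big_ord0 addr0 addrA.
by congr (F _ + F _ + F _); apply: val_inj.
Qed.

Lemma mdeg3 m : mdeg m = (m i0 + m i1 + m i2)%N.
Proof.
rewrite mdegE !big_ord_recl big_ord0 addn0 addnA.
by congr (m _ + m _ + m _)%N; apply: val_inj.
Qed.

Lemma mnm3P m m' : m i0 = m' i0 -> m i1 = m' i1 -> m i2 = m' i2 -> m = m'.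
Proof. by move=> h0 h1 h2; apply/mnmP; apply: forall_I3. Qed.

Lemma mnmUD i m j : (U_(i) + m)%MM j = ((i == j) + m j)%N.
Proof. by rewrite mnmDE mnm1E. Qed.

Lemma mdegUDn i m N : (mdeg (U_(i) + m)%MM + N = mdeg m + N.+1)%N.
Proof. by rewrite mdegD mdeg1 add1n addSnnS. Qed.

Lemma mlinMx (f g : 'X_{1..3} -> k) i p :
  (forall m, f (U_(i) + m)%MM = g m) -> mlin f ('X_i * p) = mlin g p.
Proof. by move=> fg; rewrite mlinMX; apply: eq_mlin => m _. Qed.

(* [psi e b i] is the coefficient of [cheb i] in the expansion of the b-th
   power of the variable at x = 1. *)
Fixpoint psi (e : bool) (b i : nat) : k :=
  match b with
  | 0 => (i == 0%N)%:R
  | b'.+1 => psi e b' i.+1 +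
      match i with 0 => if e then - psi e b' 0 else 0 | i'.+1 => psi e b' i' end
  end.

Lemma psi_gt e b i : (b < i)%N -> psi e b i = 0.
Proof.
elim: b i => [|b IHb] [|i] //= lt_bi; rewrite !IHb ?addr0 //; lia.
Qed.

Lemma psi_diag e b : psi e b b = 1.
Proof. by elim: b => //= b ->; rewrite psi_gt ?add0r. Qed.

Lemma psi_neq0 e b i : psi e b i != 0 -> (i <= b)%N.
Proof. by apply: contraNT; rewrite -ltnNge => /psi_gt ->. Qed.

(* Chebyshev polynomials of the second kind (for e = false), resp. of the
   third kind up to signs, homogenized by x; they are orthonormal. *)
Fixpoint cheb (e : bool) (v : R) (n : nat) : R :=
  match n with
  | 0 => 1
  | n1.+1 => match n1 with
             | 0 => if e then v + 'X_i0 else v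
             | n2.+1 => v * cheb e v n1 - 'X_i0 ^+ 2 * cheb e v n2
             end
  end.

Lemma chebSS e v n : cheb e v n.+2 = v * cheb e v n.+1 - 'X_i0 ^+ 2 * cheb e v n.
Proof. by []. Qed.

Definition chY := cheb false 'X_i1.
Definition chZ := cheb true 'X_i2.

Lemma chY_SS n : chY n.+2 = 'X_i1 * chY n.+1 - 'X_i0 ^+ 2 * chY n.
Proof. by []. Qed.
Lemma chZ_SS n : chZ n.+2 = 'X_i2 * chZ n.+1 - 'X_i0 ^+ 2 * chZ n.
Proof. by []. Qed.
Lemma chY0 : chY 0 = 1. Proof. by []. Qed.
Lemma chY1 : chY 1 = 'X_i1. Proof. by []. Qed.
Lemma chZ0 : chZ 0 = 1. Proof. by []. Qed.
Lemma chZ1 : chZ 1 = 'X_i2 + 'X_i0. Proof. by []. Qed.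

Lemma two_step (P : nat -> Prop) :
  P 0%N -> P 1%N -> (forall n, P n -> P n.+1 -> P n.+2) -> forall n, P n.
Proof.
move=> P0 P1 PS n; suff [] : P n /\ P n.+1 by [].
by elim: n => // n [Pn Pn1]; split=> //; apply: PS.
Qed.

Lemma X_homog i : ('X_i : R) \is (1%N).-homog.
Proof. by rewrite dhomogX; apply/eqP; apply: mdeg1. Qed.

Lemma Xn_homog i n : ('X_i ^+ n : R) \is n.-homog.
Proof. by rewrite -[n in n.-homog]mul1n; apply: dhomogMn; apply: X_homog. Qed.

Lemma cheb_homog e i n : cheb e 'X_i n \is n.-homog.
Proof.
elim/two_step: n => [||n h0 h1]; first exact: dhomog1.
  by case: e => /=; [apply: dhomogD|]; apply: X_homog.
rewrite chebSS; apply: dhomogD.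
  by apply: (@dhomogM _ _ _ 1) => //; apply: X_homog.
by rewrite dhomogN; apply: (@dhomogM _ _ _ 2) => //; apply: Xn_homog.
Qed.

(* The elements x^a U_i W_j form a k-basis of R. *)
Definition chb a i j : R := 'X_i0 ^+ a * (chY i * chZ j).

Lemma bk_homog a i j d : (a + i + j)%N = d -> chb a i j \is d.-homog.
Proof.
move=> <-; rewrite -addnA; apply: dhomogM; first exact: Xn_homog.
by apply: dhomogM; apply: cheb_homog.
Qed.

Lemma X0_bk a i j : 'X_i0 * chb a i j = chb a.+1 i j.
Proof. by rewrite /chb mulrA -exprS. Qed.

Lemma X0n_bk b a i j : 'X_i0 ^+ b * chb a i j = chb (b + a) i j.
Proof. by rewrite /chb mulrA -exprD. Qed.

Lemma X1_bkS a i j : 'X_i1 * chb a i.+1 j = chb a i.+2 j + chb a.+2 i j.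
Proof. by rewrite /chb chY_SS !exprS; ring. Qed.

Lemma X1_bk0 a j : 'X_i1 * chb a 0 j = chb a 1 j.
Proof. by rewrite /chb chY0 chY1; ring. Qed.

Lemma X2_bkS a i j : 'X_i2 * chb a i j.+1 = chb a i j.+2 + chb a.+2 i j.
Proof. by rewrite /chb chZ_SS !exprS; ring. Qed.

Lemma X2_bk0 a i : 'X_i2 * chb a i 0 = chb a i 1 - chb a.+1 i 0.
Proof. by rewrite /chb chZ0 chZ1 !exprS; ring. Qed.

Variable T : nat.

(** The coefficient of U_i W_j in the expansion, at x = 1, of the component of p of degree T - N. By
    [phi_bk] it is also the value of F_0 = [phi 0 0 0] on x^a U_i W_j p for a + i + j = N; these two
    readings together are the orthonormality. *)
Definition phi i j N : R -> k :=
  mlin (fun m => (mdeg m + N == T)%N%:R * (psi false (m i1) i * psi true (m i2) j)).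

Lemma phi_X0 i j N p : phi i j N ('X_i0 * p) = phi i j N.+1 p.
Proof. by apply: mlinMx => m; rewrite !mnmUD mdegUDn. Qed.

Lemma phi_X0n i j N a p : phi i j N ('X_i0 ^+ a * p) = phi i j (a + N)%N p.
Proof.
elim: a N => [|a IHa] N; first by rewrite mul1r.
by rewrite exprS -mulrA phi_X0 IHa addnS.
Qed.

Lemma phi_X1 i j N p : phi i j N ('X_i1 * p) = phi i.+1 j N.+1 p +
  (if i is i'.+1 then phi i' j N.+1 p else 0).
Proof.
rewrite /phi mlinMX; case: i => [|i].
  rewrite addr0; apply: eq_mlin => m _.
  by rewrite !mnmUD mdegD mdeg1 /= addr0 add1n addSnnS.
rewrite -mlinD; apply: eq_mlin => m _.
by rewrite !mnmUD mdegUDn /= ?add0n ?add1n /=; ring.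
Qed.

Lemma phi_X2 i j N p : phi i j N ('X_i2 * p) = phi i j.+1 N.+1 p +
  (if j is j'.+1 then phi i j' N.+1 p else - phi i 0 N.+1 p).
Proof.
rewrite /phi mlinMX; case: j => [|j]; rewrite -?mlinN -mlinD; apply: eq_mlin => m _.
  by rewrite !mnmUD mdegUDn /= ?add0n ?add1n /=; ring.
by rewrite !mnmUD mdegUDn /= ?add0n ?add1n /=; ring.
Qed.

HB.instance Definition _ i j N := GRing.Linear.on (phi i j N).

(** By [phi_X1], y acts on the index i by the sum of the shifts to i + 1 and i - 1. This is the
    recurrence of [chY], so U_i moves index 0 to i. *)
Lemma phi_chY i j N p : phi 0 j N (chY i * p) = phi i j (i + N)%N p.
Proof.
elim/two_step: i N p => [||i IH0 IH1] N p.
- by rewrite mul1r.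
- by rewrite phi_X1 addr0.
have -> : chY i.+2 * p = chY i.+1 * ('X_i1 * p) - chY i * ('X_i0 ^+ 2 * p).
  by rewrite chY_SS; ring.
by rewrite linearB /= IH1 phi_X1 IH0 phi_X0n ?addSn ?addnS addrK.
Qed.

(** As for [phi_chY]; the boundary term of [phi_X2] at j = 0 is cancelled by the summand x of W_1 =
    z + x. *)
Lemma phi_chZ i j N p : phi i 0 N (chZ j * p) = phi i j (j + N)%N p.
Proof.
elim/two_step: j N p => [||j IH0 IH1] N p.
- by rewrite mul1r.
- by rewrite chZ1 mulrDl linearD /= phi_X2 phi_X0 subrK.
have -> : chZ j.+2 * p = chZ j.+1 * ('X_i2 * p) - chZ j * ('X_i0 ^+ 2 * p).
  by rewrite chZ_SS; ring.
by rewrite linearB /= IH1 phi_X2 IH0 phi_X0n ?addSn ?addnS addrK.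
Qed.

Lemma phi_bk a i j p : phi 0 0 0 (chb a i j * p) = phi i j (a + i + j)%N p.
Proof.
rewrite /chb -mulrA phi_X0n -mulrA phi_chY phi_chZ addn0; congr phi; lia.
Qed.

Lemma phi_1 i j N : phi i j N 1 = [&& N == T, i == 0%N & j == 0%N]%:R.
Proof.
rewrite -mpolyX0 /phi mlinX mdeg0 !mnm0E /=.
by rewrite -!natrM !mulnb.
Qed.

Lemma phi_1chZ i j N j' : phi i j N (chZ j') = [&& j' + N == T, i == 0%N & j == j']%N%:R.
Proof.
elim/two_step: j' i j N => [||j' IH0 IH1] i j N.
- by rewrite phi_1.
- rewrite chZ1 linearD /= -['X_i2]mulr1 -['X_i0]mulr1 phi_X2 phi_X0 !phi_1 add1n.
  case: j => [|j]; first by rewrite subrK !andbF.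
  by rewrite phi_1 /= !andbF add0r addr0; congr (_%:R).
rewrite chZ_SS linearB /= phi_X2 phi_X0n !IH1 IH0 !addSn !addnS !eqSS.
case: j => [|j]; rewrite ?IH1 ?addSn ?addnS /= ?andbF ?oppr0 ?addr0 ?subrr //.
by rewrite !eqSS addrAC subrr add0r.
Qed.

Lemma phi_cheb (i j N : nat) i' j' : phi i j N (chY i' * chZ j') =
  [&& i' + j' + N == T, i == i' & j == j']%N%:R.
Proof.
elim/two_step: i' i j N => [||i' IH0 IH1] i j N.
- by rewrite mul1r phi_1chZ.
- rewrite chY1 phi_X1; case: i => [|i]; rewrite !phi_1chZ.
    by rewrite !andbF addr0.
  by rewrite andbF add0r addnS -!addSn eqSS.
have -> : chY i'.+2 * chZ j' = 'X_i1 * (chY i'.+1 * chZ j') - 'X_i0 ^+ 2 * (chY i' * chZ j').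
  by rewrite chY_SS; ring.
rewrite linearB /= phi_X1 phi_X0n !IH1 IH0 !addSn !addnS !eqSS.
case: i => [|i]; rewrite ?IH1 ?addSn ?addnS /= ?andbF ?addr0 ?subrr //.
by rewrite !eqSS addrAC subrr add0r.
Qed.

Lemma phi_bk1 i j N a i' j' : phi i j N (chb a i' j') =
  [&& a + i' + j' + N == T, i == i' & j == j']%N%:R.
Proof.
rewrite /chb phi_X0n phi_cheb; congr ((_ && _)%:R); congr (_ == _); lia.
Qed.

Definition cf (b c : nat) : R -> k :=
  mlin (fun m => [&& m i0 == 0%N, m i1 == b & m i2 == c]%:R).

HB.instance Definition _ b c := GRing.Linear.on (cf b c).

Lemma cf_X0 b c p : cf b c ('X_i0 * p) = 0.
Proof. by rewrite -(mlin0 p); apply: mlinMx => m; rewrite mnmUD. Qed.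

Lemma cf_X1 b c p : cf b c ('X_i1 * p) = if b is b'.+1 then cf b' c p else 0.
Proof.
case: b => [|b]; last by apply: mlinMx => m; rewrite !mnmUD.
by rewrite -(mlin0 p); apply: mlinMx => m; rewrite !mnmUD andbF.
Qed.

Lemma cf_X2 b c p : cf b c ('X_i2 * p) = if c is c'.+1 then cf b c' p else 0.
Proof.
case: c => [|c]; last by apply: mlinMx => m; rewrite !mnmUD.
by rewrite -(mlin0 p); apply: mlinMx => m; rewrite !mnmUD !andbF.
Qed.

Lemma cf_chY i b c p : cf b c (chY i * p) = if (i <= b)%N then cf (b - i)%N c p else 0.
Proof.
elim/two_step: i b p => [||i IH0 IH1] b p.
- by rewrite mul1r subn0.
- by rewrite cf_X1; case: b => // b; rewrite subn1.
have -> : chY i.+2 * p = 'X_i1 * (chY i.+1 * p) - 'X_i0 * ('X_i0 * (chY i * p)).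
  by rewrite chY_SS; ring.
by rewrite linearB /= cf_X1 cf_X0 subr0; case: b => // b; rewrite IH1.
Qed.

Lemma cf_chZ i b c p : cf b c (chZ i * p) = if (i <= c)%N then cf b (c - i)%N p else 0.
Proof.
elim/two_step: i c p => [||i IH0 IH1] c p.
- by rewrite mul1r subn0.
- rewrite mulrDl linearD /= cf_X0 addr0 cf_X2.
  by case: c => // c; rewrite subn1.
have -> : chZ i.+2 * p = 'X_i2 * (chZ i.+1 * p) - 'X_i0 * ('X_i0 * (chZ i * p)).
  by rewrite chZ_SS; ring.
by rewrite linearB /= cf_X2 cf_X0 subr0; case: c => // c; rewrite IH1.
Qed.

Lemma cf_bkS a b c i j p : cf b c (chb a.+1 i j * p) = 0.
Proof. by rewrite -X0_bk -mulrA cf_X0. Qed.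

Lemma cf_bk0 b c i j p : cf b c (chb 0 i j * p) =
  if (i <= b)%N && (j <= c)%N then cf (b - i)%N (c - j)%N p else 0.
Proof. by rewrite /chb mul1r -mulrA cf_chY; case: leqP => //= _; rewrite cf_chZ. Qed.

Lemma cf_1 b c : cf b c 1 = ((b == 0%N) && (c == 0%N))%:R.
Proof.
rewrite -mpolyX0 /cf mlinX !mnm0E /=.
by rewrite [b == _]eq_sym [c == _]eq_sym.
Qed.

Lemma cf_bk b c a i j : cf b c (chb a i j) = [&& a == 0%N, b == i & c == j]%:R.
Proof.
rewrite -[chb a i j]mulr1; case: a => [|a]; last by rewrite cf_bkS.
rewrite cf_bk0 cf_1 /= !subn_eq0.
by case: (ltngtP i b); case: (ltngtP j c).
Qed.

(* In top degree the functional [phi] only sees the monomial y^i z^j. *)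
Lemma phi_top i j N p : (i + j + N = T)%N -> phi i j N p = cf i j p.
Proof.
move=> hN; apply: eq_mlin => m _.
have [hd|hd] := eqVneq (mdeg m + N)%N T; last first.
  rewrite mul0r; case: and3P => // -[/eqP h0 /eqP h1 /eqP h2].
  by move: hd; rewrite mdeg3 h0 h1 h2 add0n hN eqxx.
rewrite mul1r; case: and3P => [[_ /eqP-> /eqP->]|h]; first by rewrite !psi_diag mulr1.
apply/eqP; apply: contraT; rewrite mulf_eq0 negb_or => /andP[/psi_neq0 h1 /psi_neq0 h2].
case: h; rewrite mdeg3 in hd; split; apply/eqP; lia.
Qed.

Lemma phi_gt i j N p : (T < i + j + N)%N -> phi i j N p = 0.
Proof.
move=> hN; rewrite -(mlin0 p); apply: eq_mlin => m _.
have [hd|hd] := eqVneq (mdeg m + N)%N T; last by rewrite mul0r.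
rewrite mul1r; apply/eqP; apply: contraT.
rewrite mulf_eq0 negb_or => /andP[/psi_neq0 h1 /psi_neq0 h2].
rewrite mdeg3 in hd; lia.
Qed.

(* The pairing is triangular with respect to the exponent of x. *)
Lemma phi_inj N p : (forall i j, phi i j N p = 0) ->
  forall m, (mdeg m + N = T)%N -> p@_m = 0.
Proof.
move=> hp m; move: {2}(m i0) (leqnn (m i0)) => d; elim: d m => [|d IHd] m le_m hm.
  have := hp (m i1) (m i2); rewrite phi_top; last by rewrite mdeg3 in hm; lia.
  move=> <-; rewrite mlin_coef; apply: eq_mlin => m' _; congr (nat_of_bool _)%:R.
  apply/eqP/and3P => [->|[/eqP h0 /eqP h1 /eqP h2]].
    by split=> //; rewrite -leqn0.
  by apply: mnm3P => //; rewrite h0; apply/esym/eqP; rewrite -leqn0.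
rewrite mlin_coef -[RHS](hp (m i1) (m i2)).
apply: eq_mlin => m' pm'; have [->|ne_m] := eqVneq m' m.
  by rewrite hm eqxx !psi_diag !mulr1.
have [hd|hd] := eqVneq (mdeg m' + N)%N T; last by rewrite mul0r.
apply/esym/eqP; rewrite mul1r; apply: contraT.
rewrite mulf_eq0 negb_or => /andP[/psi_neq0 h1 /psi_neq0 h2].
case/eqP: pm'; apply: IHd => //.
rewrite leqNgt; apply/negP => lt_m; case/eqP: ne_m.
rewrite !mdeg3 in hd hm; apply: mnm3P; lia.
Qed.

End ThreeVariables.

(** * Order of a polynomial at the origin *)

Section Order.
Variables (k : fieldType) (n : nat).
Local Notation R := {mpoly k[n]}.
Implicit Types (p q : R).

Definition low (d : nat) p := forall m, (mdeg m < d)%N -> p@_m = 0.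

Lemma low0 p : low 0 p. Proof. by []. Qed.

Lemma lowM d e p q : low d p -> low e q -> low (d + e) (p * q).
Proof.
move=> hp hq m hm; rewrite mcoeffM big1 // => -[m1 m2] /= /eqP em.
have [lt_m1|le_m1] := ltnP (mdeg m1) d; first by rewrite hp ?mul0r.
rewrite (hq m2) ?mulr0 //.
have : mdeg m = (mdeg m1 + mdeg m2)%N by rewrite {1}em mdegD.
lia.
Qed.

Lemma low_le d e p : (d <= e)%N -> low e p -> low d p.
Proof. by move=> de hp m hm; apply: hp; apply: leq_trans de. Qed.

Lemma lowX m : low (mdeg m) ('X_[m] : R).
Proof. by move=> m' hm; rewrite mcoeffX; case: eqP hm => // ->; rewrite ltnn. Qed.

Lemma low_homog d p : p \is d.-homog -> low d p.
Proof. by move=> hp m hm; apply: dhomog_nemf_coeff hp _; rewrite neq_ltn hm. Qed.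

Lemma mpoly_subspace_all (Z : R -> Prop) :
  subspace Z -> Z 1 -> (forall i p, Z p -> Z ('X_i * p)) -> forall p, Z p.
Proof.
move=> sZ Z1 ZX p; rewrite [p]mpolyE; apply: (subspace_sum _ sZ) => m _.
apply: (subspaceZ _ sZ); rewrite mpolyXE_id; elim/big_rec: _ => // i q _ Zq.
by elim: (m i) => [|a IHa]; rewrite ?mul1r // exprS -mulrA; apply: ZX.
Qed.
End Order.

(** * Exactness of the Koszul complex of R *)
Section KoszulExact.
Variable k : fieldType.
Local Notation R := {mpoly k[3]}.
Implicit Types (p q : R) (m : 'X_{1..3}).

Definition nx (i : 'I_3) : 'I_3 :=
  if i == i0 then i1 else if i == i1 then i2 else i0.

(** The cross product, with indices taken cyclically by [nx]. The Koszul differentials become, up to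
    sign, multiplication by the vector (x, y, z), cross product with it and dot product with it. *)
Definition crs (A : comNzRingType) (u v : 'I_3 -> A) (i : 'I_3) : A :=
  u (nx i) * v (nx (nx i)) - u (nx (nx i)) * v (nx i).

Definition dot (A : comNzRingType) (u v : 'I_3 -> A) : A := \sum_j u j * v j.

Lemma dotE (A : comNzRingType) (u v : 'I_3 -> A) :
  dot u v = u i0 * v i0 + u i1 * v i1 + u i2 * v i2.
Proof. exact: sum_I3. Qed.

Lemma nx0 : nx i0 = i1. Proof. by []. Qed.
Lemma nx1 : nx i1 = i2. Proof. by []. Qed.
Lemma nx2 : nx i2 = i0. Proof. by []. Qed.
Definition nxE := (nx0, nx1, nx2).

Definition Xv (i : 'I_3) : R := 'X_i.

Lemma split_var (i : 'I_3) (p : R) :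
  exists a r, p = 'X_i * a + r /\ forall m, m i != 0%N -> r@_m = 0.
Proof.
elim/mpolyind: p => [|c m p _ _ [a [r [-> hr]]]].
  by exists 0, 0; rewrite mulr0 addr0; split=> // m _; rewrite mcoeff0.
have [h|h] := eqVneq (m i) 0%N.
  exists a, (c *: 'X_[m] + r); split; first by rewrite addrCA.
  move=> m' hm'; rewrite mcoeffD mcoeffZ mcoeffX hr // addr0.
  case: (m =P m') => [e|_]; last exact: mulr0.
  by rewrite -e h in hm'.
exists (c *: 'X_[m - U_(i)] + a), r; split=> //.
by rewrite mulrDr -scalerAr -mpolyXD addmC submK ?lep1mP // addrA.
Qed.

Lemma var_free_eq0 (i : 'I_3) p r :
  (forall m, m i != 0%N -> r@_m = 0) -> 'X_i * p + r = 0 -> p = 0 /\ r = 0.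
Proof.
move=> hr e0; have cE m : ('X_i * p + r)@_m = 0 by rewrite e0 mcoeff0.
have p0 : p = 0.
  apply/mpolyP => m; rewrite mcoeff0 -[LHS](mcoeffMX p U_(i)) mulrC.
  have := cE (U_(i) + m)%MM; rewrite mcoeffD (hr (U_(i) + m)%MM) ?addr0 //.
  by rewrite mnmDE mnm1E eqxx.
by split=> //; move: e0; rewrite p0 mulr0 add0r.
Qed.

Lemma var_freeMX (i j : 'I_3) (r : R) : i != j ->
  (forall m, m i != 0%N -> r@_m = 0) -> forall m, m i != 0%N -> ('X_j * r)@_m = 0.
Proof.
move=> ne_ij hr m hm; have [h|h] := boolP (U_(j) <= m)%MM.
  rewrite [_ * r]mulrC -(submK h) addmC mcoeffMX hr //.
  by rewrite mnmBE mnm1E [j == i]eq_sym (negbTE ne_ij) subn0.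
apply/eqP; rewrite mcoeff_eq0; apply: contra h; rewrite mulrC.
move/msuppM_le/allpairsP => [[m1 m2] /= [_ h2 ->]].
by move: h2; rewrite msuppX inE => /eqP->; apply: lem_addl.
Qed.

(** The variables form a regular sequence. Write u_1 and u_2 as x a_i + r_i with r_i free of x. The
    multiples of x in the relation give u_0 = -(y a_1 + z a_2), the rest gives y r_1 + z r_2 = 0,
    and splitting r_2 along y turns this into r_1 = - z b, r_2 = y b. *)
Lemma koszul_exact (u : 'I_3 -> R) : dot Xv u = 0 ->
  exists h : 'I_3 -> R, forall i, u i = crs Xv h i.
Proof.
rewrite dotE /Xv => e0.
have [a1 [r1 [e1 hr1]]] := split_var i0 (u i1).
have [a2 [r2 [e2 hr2]]] := split_var i0 (u i2).
have : 'X_i0 * (u i0 + 'X_i1 * a1 + 'X_i2 * a2) + ('X_i1 * r1 + 'X_i2 * r2) = 0.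
  by rewrite -[RHS]e0 e1 e2; ring.
case/var_free_eq0 => [m hm|eu0 er].
  by rewrite mcoeffD (var_freeMX _ hr1) // (var_freeMX _ hr2) // addr0.
have [b [t [eb ht]]] := split_var i1 r2.
have : 'X_i1 * (r1 + 'X_i2 * b) + 'X_i2 * t = 0 by rewrite -[RHS]er eb; ring.
case/var_free_eq0 => [m hm|er1 /eqP]; first by rewrite (var_freeMX _ ht).
have nzX : ('X_i2 : R) != 0.
  apply/eqP => /mpolyP/(_ U_(i2)%MM).
  by rewrite mcoeffX eqxx mcoeff0 => /eqP; rewrite oner_eq0.
rewrite mulf_eq0 (negbTE nzX) /= => /eqP et.
rewrite et addr0 in eb.
exists (fun i => if i == i0 then - b else if i == i1 then a2 else - a1).
apply: forall_I3; rewrite /crs !nxE /=.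
- by apply/eqP; rewrite -subr_eq0 -[X in _ == X]eu0; apply/eqP; ring.
- rewrite e1; have -> : r1 = - ('X_i2 * b) by apply/eqP; rewrite -addr_eq0 er1.
  ring.
- by rewrite e2 eb; ring.
Qed.

Lemma lift_homog d p : p \is d.+1.-homog ->
  exists u : 'I_3 -> R, (forall j, u j \is d.-homog) /\ dot Xv u = p.
Proof.
move=> hp; pose Z p := exists u : 'I_3 -> R, (forall j, u j \is d.-homog) /\ dot Xv u = p.
have sZ : subspace Z.
  split; first by exists (fun=> 0); split=> [j|]; rewrite ?rpred0 // /dot big1 // => j _; rewrite mulr0.
  move=> c p1 p2 [u1 [h1 <-]] [u2 [h2 <-]]; exists (fun j => c *: u1 j + u2 j); split.
    by move=> j; apply: dhomogD; rewrite ?dhomogZ.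
  rewrite /dot scaler_sumr -big_split; apply: eq_bigr => j _ /=.
  by rewrite mulrDr scalerAr.
change (Z p); rewrite [p]mpolyE big_seq; apply: (subspace_sum _ sZ) => m hm.
apply: (subspaceZ _ sZ); have dm : mdeg m = d.+1 by apply: (dhomogP _ _ _ hp).
have [i hi] : exists i, m i != 0%N.
  apply/existsP; apply: contraT; rewrite negb_exists => /forallP h0.
  suff : mdeg m = 0%N by rewrite dm.
  by rewrite mdegE big1 // => i _; apply/eqP; rewrite -[_ == _]negbK.
exists (fun j => if j == i then 'X_[m - U_(i)] else 0); split.
  move=> j; case: ifP => _; last exact: dhomog0.
  rewrite dhomogX; apply/eqP; apply/eqP; rewrite -eqSS -dm -{2}(submK (_ : U_(i) <= m)%MM) ?lep1mP //.
  by rewrite mdegD mdeg1 addn1.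
rewrite /dot (bigD1 i) //= eqxx big1 ?addr0 => [|j /negbTE->]; last exact: mulr0.
by rewrite -mpolyXD addmC submK // lep1mP.
Qed.

Definition vec3 (T : Type) (a b c : T) (i : 'I_3) : T :=
  if i == i0 then a else if i == i1 then b else c.

Lemma dot_crs (A : comNzRingType) (x h w : 'I_3 -> A) :
  dot (crs x h) w = - dot (crs x w) h.
Proof. by rewrite !dotE /crs !nxE; ring. Qed.

Definition unitv (j : 'I_3) (p : R) (t : 'I_3) : R := if t == j then p else 0.

Lemma dot_unitv (x : 'I_3 -> R) j p : dot x (unitv j p) = x j * p.
Proof.
rewrite /dot (bigD1 j) //= /unitv eqxx big1 ?addr0 // => t /negbTE->.
exact: mulr0.
Qed.

Lemma dot_unitvl (w : 'I_3 -> R) j p : dot (unitv j p) w = p * w j.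
Proof.
rewrite /dot (bigD1 j) //= /unitv eqxx big1 ?addr0 // => t /negbTE->.
exact: mul0r.
Qed.

Lemma dotDZ c (u u' w : 'I_3 -> R) : dot (fun t => c *: u t + u' t) w = c *: dot u w + dot u' w.
Proof.
rewrite /dot scaler_sumr -big_split; apply: eq_bigr => j _ /=.
by rewrite mulrDl scalerAl.
Qed.

Lemma dotDZr c (u u' w : 'I_3 -> R) : dot w (fun t => c *: u t + u' t) = c *: dot w u + dot w u'.
Proof.
rewrite /dot scaler_sumr -big_split; apply: eq_bigr => j _ /=.
by rewrite mulrDr scalerAr.
Qed.

Lemma mcoeffX0 (j : 'I_3) (p : R) (m : 'X_{1..3}) : m j = 0%N -> ('X_j * p)@_m = 0.
Proof.
move=> hm; apply/eqP; rewrite mcoeff_eq0 mulrC; apply/negP.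
move/msuppM_le/allpairsP => [[m1 m2] /= [_ h2 e]]; move: h2 hm.
by rewrite msuppX inE e => /eqP->; rewrite mnmDE mnm1E eqxx addn1.
Qed.

Lemma mcoeffXS (j : 'I_3) (p : R) (m : 'X_{1..3}) : ('X_j * p)@_(U_(j) + m) = p@_m.
Proof. by rewrite mulrC mcoeffMX. Qed.

End KoszulExact.

(** * Euler characteristic of the Koszul complex of R/I *)
Section MoreDimension.
Variable k : fieldType.

Lemma dim_mod_exists_fin (V : lmodType k) (n : nat) (Z B : V -> Prop) :
  dim_mod (fun _ : V => True) (fun v => v = 0) n ->
  subspace Z -> subspace B -> (forall v, B v -> Z v) -> exists d, dim_mod Z B d.
Proof.
move=> [w [_ _ span]] sZ sB BZ; apply: (@dim_mod_exists _ _ _ _ n w) => // v _.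
by case: (span v I) => c /subr0_eq ->; exists c.
Qed.

Lemma rank_nullity (V V' : lmodType k) (f : V -> V') n : linear f ->
  dim_mod (fun _ : V => True) (fun v => v = 0) n ->
  exists a b, [/\ dim_mod (fun v => f v = 0) (fun v => v = 0) a,
    dim_mod (fun v' => exists v, v' = f v) (fun v' => v' = 0) b & n = (a + b)%N].
Proof.
move=> lf hn.
have f0 : f 0 = 0 by have := lf (-1) 0 0; rewrite scaler0 addr0 scaleN1r addNr.
have sK : subspace (fun v => f v = 0).
  split=> // c u v hu hv; rewrite -[LHS]/(f (c *: u + v)).
  by have := lf c u v; rewrite hu hv scaler0 addr0.
have sT := subspaceT V; have s0 := subspace0 V; have s0' := subspace0 V'.
have [b hb] : exists b, dim_mod (fun _ : V => True) (fun v => f v = 0) b.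
  exact: dim_mod_exists_fin hn sT sK _.
have [a ha] : exists a, dim_mod (fun v => f v = 0) (fun v => v = 0) a.
  by apply: dim_mod_exists_fin hn sK s0 _ => v ->.
exists a, b; split=> //.
  apply: (dim_mod_map lf sT s0' _ _ _ _ hb) => //; first by move=> u _; exists u.
  by move=> z [v ->]; exists v; rewrite ?subrr.
rewrite addnC; apply: (dim_mod_uniq s0 hn).
by apply: (dim_mod_cat sT sK _ _ hb ha) => // u ->.
Qed.

Lemma dim_ffun3 (V : lmodType k) n :
  dim_mod (fun _ : V => True) (fun v => v = 0) n ->
  dim_mod (fun _ : {ffun 'I_3 -> V} => True) (fun v => v = 0) (3 * n).
Proof.
move=> [w [_ iw sw]].
have -> : (3 * n)%N = #|{: 'I_3 * 'I_n}| by rewrite card_prod !card_ord.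
pose v (t : 'I_3 * 'I_n) : {ffun 'I_3 -> V} := [ffun i => if i == t.1 then w t.2 else 0].
have sumE (c : 'I_3 * 'I_n -> k) i :
    (\sum_t c t *: v t) i = \sum_j c (i, j) *: w j.
  rewrite sum_ffunE.
  transitivity (\sum_i' \sum_j (c (i', j) *: v (i', j)) i).
    by rewrite pair_bigA; apply: eq_bigr => -[].
  rewrite (bigD1 i) //= [X in _ + X]big1 ?addr0 => [|i' ne].
    by apply: eq_bigr => j _; rewrite !ffunE eqxx.
  by apply: big1 => j _; rewrite !ffunE eq_sym (negbTE ne) scaler0.
apply: (@has_dim_fin _ _ _ _ v) => //.
  move=> c hc [i j]; apply: (iw (fun j => c (i, j))).
  by rewrite -sumE hc ffunE.
move=> z _; have h i : exists c : 'I_n -> k, z i = \sum_j c j *: w j.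
  by case: (sw (z i) I) => c /subr0_eq ->; exists c.
have [c0 h0] := h i0; have [c1 h1] := h i1; have [c2 h2] := h i2.
exists (fun t => if t.1 == i0 then c0 t.2 else if t.1 == i1 then c1 t.2 else c2 t.2).
by apply/ffunP; apply: forall_I3; rewrite sumE.
Qed.

End MoreDimension.

Section Quotient.
Variables (k : fieldType) (I : idealr {mpoly k[3]}).
Local Notation R := {mpoly k[3]}.
Local Notation A := {ideal_quot I}.
Local Notation V3 := {ffun 'I_3 -> A}.
Local Notation xq := (@quot_var k I).

Lemma pi_eq (p q : R) : \pi_A p = \pi_A q <-> p - q \in I.
Proof.
split=> [h|h]; first by rewrite Quotient.idealrBE; apply/eqP.
by apply/eqP; rewrite -Quotient.idealrBE.
Qed.

Lemma pi_eq0 (p : R) : \pi_A p = 0 <-> p \in I.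
Proof. by rewrite -[p in p \in I]subr0 -pi_eq rmorph0. Qed.

Lemma piZ c (p : R) : \pi_A (c *: p) = c *: \pi_A p.
Proof. by rewrite -mul_mpolyC rmorphM. Qed.

Lemma pi_repr (a : A) : exists p : R, a = \pi_A p.
Proof. by exists (repr a); rewrite reprK. Qed.

Lemma pi_sum (J : Type) (r : seq J) (P : pred J) (F : J -> R) :
  \pi_A (\sum_(i <- r | P i) F i) = \sum_(i <- r | P i) \pi_A (F i).
Proof. exact: rmorph_sum. Qed.

Lemma quot_scaleAr c (a b : A) : a * (c *: b) = c *: (a * b).
Proof. by rewrite mulrC -scalerAl mulrC. Qed.

(** The Koszul differentials of A on coordinate vectors. With the cycles and boundaries below, T_1
    is [Z1] / [B1] and T_2 is [Z2] / [B2], while T_3 is the kernel of [sclq], the socle. *)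
Definition dotq (u : V3) : A := dot xq u.
Definition crsq (u : V3) : V3 := [ffun i => crs xq u i].
Definition sclq (a : A) : V3 := [ffun i => xq i * a].

Lemma dotq_linear : linear dotq.
Proof.
move=> c u v; rewrite /dotq /dot scaler_sumr -big_split; apply: eq_bigr => j _ /=.
by rewrite !ffunE mulrDr quot_scaleAr.
Qed.

Lemma crsq_linear : linear crsq.
Proof.
move=> c u v; apply/ffunP => i; rewrite !ffunE /crs !ffunE !mulrDr !quot_scaleAr.
by rewrite scalerBr opprD addrACA.
Qed.

Lemma sclq_linear : linear sclq.
Proof. by move=> c a b; apply/ffunP => i; rewrite !ffunE mulrDr quot_scaleAr. Qed.

Definition Z1 (u : V3) : Prop := dotq u = 0.
Definition B1 (u : V3) : Prop := exists w, u = crsq w.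
Definition Z2 (w : V3) : Prop := crsq w = 0.
Definition B2 (w : V3) : Prop := exists a, w = sclq a.

Lemma ker_subspace (V V' : lmodType k) (f : V -> V') : linear f ->
  subspace (fun v => f v = 0).
Proof.
move=> lf; have f0 : f 0 = 0 by have := lf (-1) 0 0; rewrite scaler0 addr0 scaleN1r addNr.
by split=> // c u v hu hv; have := lf c u v; rewrite hu hv scaler0 addr0.
Qed.

Lemma im_subspace (V V' : lmodType k) (f : V -> V') : linear f ->
  subspace (fun v => exists u, v = f u).
Proof.
move=> lf; have f0 : f 0 = 0 by have := lf (-1) 0 0; rewrite scaler0 addr0 scaleN1r addNr.
split=> [|c u v [u' ->] [v' ->]]; first by exists 0.
exists (c *: u' + v'); exact: (esym (lf c u' v')).
Qed.

Lemma Z1_sub : subspace Z1. Proof. exact: ker_subspace dotq_linear. Qed.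
Lemma B1_sub : subspace B1. Proof. exact: im_subspace crsq_linear. Qed.
Lemma Z2_sub : subspace Z2. Proof. exact: ker_subspace crsq_linear. Qed.
Lemma B2_sub : subspace B2. Proof. exact: im_subspace sclq_linear. Qed.

Lemma B1_Z1 u : B1 u -> Z1 u.
Proof. by move=> [w ->]; rewrite /Z1 /dotq dotE !ffunE /crs !nxE; ring. Qed.

Lemma B2_Z2 w : B2 w -> Z2 w.
Proof.
move=> [a ->]; apply/ffunP; apply: forall_I3; rewrite !ffunE /crs !ffunE !nxE; ring.
Qed.

Lemma aug_decomp (p : R) : exists u : 'I_3 -> R, p = (p@_0%MM)%:MP + dot (@Xv k) u.
Proof.
pose Z (p : R) := exists u : 'I_3 -> R, p = (p@_0%MM)%:MP + dot (@Xv k) u.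
apply: (@mpoly_subspace_all _ _ Z); rewrite /Z.
- split; first by exists (fun=> 0); rewrite mcoeff0 add0r /dot big1 // => j _; rewrite mulr0.
  move=> c q q' [u ->] [u' ->]; exists (fun t => c *: u t + u' t).
  rewrite dotDZr mcoeffD mcoeffZ !mcoeffD !mcoeffC !eqxx !mulr1.
  have d0 (v : 'I_3 -> R) : (dot (@Xv k) v)@_0%MM = 0.
    rewrite /dot raddf_sum big1 // => j _ /=.
    by rewrite mcoeffX0 // mnm0E.
  rewrite !d0 !addr0 mpolyCD -mul_mpolyC mpolyCM -mul_mpolyC; ring.
- exists (fun=> 0); rewrite mcoeff1 eqxx mpolyC1 /dot big1 ?addr0 // => j _.
  by rewrite mulr0.
- move=> i q _; exists (unitv i q); rewrite mcoeffX0 ?mnm0E // mpolyC0 add0r.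
  by rewrite dot_unitv.
Qed.

(* The terms of the Koszul complex of A have dimensions n, 3n, 3n, n, so the
   alternating sum of the dimensions of the T_i vanishes. *)
Lemma euler_T2 n m : (forall p : R, p \in I -> p@_0%MM = 0) ->
  has_dim (fun _ : A => True) n -> has_dim (@socle k I) 2 ->
  dim_mod Z1 B1 m -> dim_mod Z2 B2 m.+1.
Proof.
move=> I_aug hn hsoc hm; have h3 := dim_ffun3 hn.
have [z1 [m0 [hz1 hm0 e1]]] := rank_nullity dotq_linear h3.
have [z2 [b1 [hz2 hb1 e2]]] := rank_nullity crsq_linear h3.
have [c0 [b2 [hc0 hb2 e3]]] := rank_nullity sclq_linear hn.
have sA := subspace0 A; have sV := subspace0 (V3 : lmodType k).
(* The kernel of [sclq] is the socle, so dim T_3 = 2. The equation n = 1 + m0 proved next says dim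
   T_0 = 1. *)
have ec : c0 = 2.
  apply: (dim_mod_uniq sA hc0).
  case: hsoc => v [hv iv sv]; exists v; split=> //.
    by move=> i; apply/ffunP => j; rewrite !ffunE; apply: hv.
  by move=> z hz; apply: sv => j; move/ffunP/(_ j): hz; rewrite !ffunE.
have sM := im_subspace dotq_linear.
have em : (n = 1 + m0)%N.
  apply: (dim_mod_uniq sA hn).
  apply: (dim_mod_cat (@subspaceT _ _) sM _ _ _ hm0) => //; first by move=> u ->; case: sM.
  exists (fun=> 1); split=> // [c|a _].
    rewrite big_ord1 => -[u hu] i; rewrite ord1.
    have [v hv] : exists v : 'I_3 -> R, forall j, u j = \pi_A (v j).
      have [v0 h0] := pi_repr (u i0); have [v1 h1] := pi_repr (u i1).
      have [v2 h2] := pi_repr (u i2); exists (vec3 v0 v1 v2).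
      exact: forall_I3.
    have : (c ord0)%:MP - dot (@Xv k) v \in I.
      apply/pi_eq; rewrite -[(_)%:MP]mulr1 mul_mpolyC piZ rmorph1 hu /dotq /dot pi_sum.
      by apply: eq_bigr => j _; rewrite rmorphM hv.
    move/I_aug; rewrite mcoeffB mcoeffC eqxx mulr1 /dot raddf_sum big1 ?subr0 // => j _.
    by rewrite /= mcoeffX0 // mnm0E.
  have [p ->] := pi_repr a; have [u hu] := aug_decomp p.
  exists (fun=> p@_0%MM); rewrite big_ord1; exists [ffun j => \pi_A (u j)].
  rewrite {1}hu rmorphD /= -[(_)%:MP]mulr1 mul_mpolyC piZ rmorph1 addrC addKr.
  by rewrite /dotq /dot pi_sum; apply: eq_bigr => j _; rewrite ffunE rmorphM.
have [t2 ht2] : exists t2, dim_mod Z2 B2 t2.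
  exact: dim_mod_exists_fin h3 Z2_sub B2_sub B2_Z2.
have ez1 : z1 = (m + b1)%N.
  apply: (dim_mod_uniq sV hz1); apply: (dim_mod_cat Z1_sub B1_sub B1_Z1 _ hm hb1).
  by move=> u ->; case: B1_sub.
have ez2 : z2 = (t2 + b2)%N.
  apply: (dim_mod_uniq sV hz2); apply: (dim_mod_cat Z2_sub B2_sub B2_Z2 _ ht2 hb2).
  by move=> u ->; case: B2_sub.
by rewrite (_ : m.+1 = t2) //; lia.
Qed.

End Quotient.

(** * The Koszul algebra in three variables *)
Section KoszulThree.
Variables (k : fieldType) (I : idealr {mpoly k[3]}).
Local Notation A := {ideal_quot I}.
Local Notation V3 := {ffun 'I_3 -> A}.
Local Notation xq := (@quot_var k I).
Local Notation K := (koszul A 3).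
Implicit Types (S U : {set 'I_3}).

Lemma sum_I3n (F : 'I_3 -> nat) : (\sum_i F i = F i0 + F i1 + F i2)%N.
Proof.
rewrite !big_ord_recl big_ord0 addn0 addnA.
by congr (F _ + F _ + F _)%N; apply: val_inj.
Qed.

Lemma card_set3 (S : {set 'I_3}) : #|S| = ((i0 \in S) + (i1 \in S) + (i2 \in S))%N.
Proof.
rewrite -sum1_card big_mkcond /= sum_I3n.
by case: (i0 \in S); case: (i1 \in S); case: (i2 \in S).
Qed.

Lemma card1C3 (i : 'I_3) : #|~: [set i]| = 2.
Proof. by have := cardsC [set i]; rewrite cards1 card_ord => -[]. Qed.

Lemma sum_ne (V : nmodType) (i : 'I_3) (F : 'I_3 -> V) :
  \sum_(j | j != i) F j = F (nx i) + F (nx (nx i)).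
Proof.
by move: i; apply: forall_I3; rewrite big_mkcond sum_I3 /= ?add0r ?addr0 // addrC.
Qed.

Lemma sum_card1 (V : nmodType) (F : {set 'I_3} -> V) :
  (forall S, #|S| != 1%N -> F S = 0) -> \sum_S F S = \sum_i F [set i].
Proof.
move=> h; rewrite (bigID (fun S : {set 'I_3} => #|S| == 1%N)) /= addrC big1 ?add0r //.
rewrite (reindex_onto (fun i => [set i]) (fun S : {set 'I_3} => odflt i0 [pick i in S])) /=.
  apply: eq_bigl => i; rewrite cards1 /=; case: pickP => [j|/(_ i)]; rewrite inE.
    by move=> /eqP->; rewrite eqxx.
  by rewrite eqxx.
move=> S /cards1P[i ->]; case: pickP => [j|/(_ i)]; rewrite inE ?eqxx //.
by move/eqP->.
Qed.

Definition K1 (u : V3) : K := [ffun S => if [pick i : 'I_3 | S == [set i]] is Some i then u i else 0].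
(** Coordinate i belongs to the complement of {i}. The sign makes the product of two elements [K1]
    the cross product and the product of [K1] and [K2] the dot product, in either order. *)
Definition K2 (w : V3) : K :=
  [ffun S => if [pick i : 'I_3 | S == ~: [set i]] is Some i then (-1) ^+ i * w i else 0].
Definition K3 (a : A) : K := [ffun S => if S == setT then a else 0].

Lemma K1E u i : K1 u [set i] = u i.
Proof.
rewrite ffunE; case: pickP => [j /eqP/set1_inj->|/(_ i)] //.
by rewrite eqxx.
Qed.

Lemma K2E w i : K2 w (~: [set i]) = (-1) ^+ i * w i.
Proof.
rewrite ffunE; case: pickP => [j /eqP/setC_inj/set1_inj->|/(_ i)] //.
by rewrite eqxx.
Qed.

Lemma K1_deg u : koszul_deg 1 (K1 u).
Proof. by move=> S hS; rewrite ffunE; case: pickP => // i /eqP e; rewrite e cards1 in hS. Qed.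

Lemma K2_deg w : koszul_deg 2 (K2 w).
Proof. by move=> S hS; rewrite ffunE; case: pickP => // i /eqP e; rewrite e card1C3 in hS. Qed.

Lemma K3_deg a : koszul_deg 3 (K3 a).
Proof. by move=> S hS; rewrite ffunE; case: eqP => // e; rewrite e cardsT card_ord in hS. Qed.

Lemma koszul_ext p (u v : K) : koszul_deg p u -> koszul_deg p v ->
  (forall S, #|S| = p -> u S = v S) -> u = v.
Proof.
move=> hu hv h; apply/ffunP => S; have [/h //|ne] := eqVneq #|S| p.
by rewrite hu ?hv.
Qed.

Lemma koszul_ext1 (u v : K) : koszul_deg 1 u -> koszul_deg 1 v ->
  (forall i, u [set i] = v [set i]) -> u = v.
Proof.
by move=> hu hv h; apply: koszul_ext hu hv _ => S /eqP/cards1P[i ->].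
Qed.

Lemma koszul_ext2 (u v : K) : koszul_deg 2 u -> koszul_deg 2 v ->
  (forall i, u (~: [set i]) = v (~: [set i])) -> u = v.
Proof.
move=> hu hv h; apply: koszul_ext hu hv _ => S hS.
have /eqP/cards1P[i e] : #|~: S| = 1%N by have := cardsC S; rewrite hS card_ord => -[].
by rewrite -[S]setCK e.
Qed.

Lemma koszul_ext3 (u v : K) : koszul_deg 3 u -> koszul_deg 3 v ->
  u setT = v setT -> u = v.
Proof.
move=> hu hv h; apply: koszul_ext hu hv _ => S hS.
by have -> : S = setT by apply/eqP; rewrite eqEcard subsetT cardsT card_ord hS.
Qed.

Lemma koszul_d_deg p (u : K) : koszul_deg p.+1 u -> koszul_deg p (koszul_d xq u).
Proof.
move=> hu S hS; rewrite ffunE big1 // => j hj; rewrite hu ?mulr0 //.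
by rewrite cardsU1 hj add1n eqSS.
Qed.

Lemma koszul_mul_deg p q (u v : K) : koszul_deg p u -> koszul_deg q v ->
  koszul_deg (p + q) (koszul_mul u v).
Proof.
move=> hu hv U hU; rewrite ffunE big1 // => S sS.
have [eS|neS] := eqVneq #|S| p; last by rewrite hu // mulr0 mul0r.
rewrite hv ?mulr0 //; apply: contra hU => /eqP eq; apply/eqP.
by rewrite -(cardsID S U) (setIidPr sS) eS eq.
Qed.

Lemma set1U_C (i : 'I_3) : nx i |: [set i] = ~: [set nx (nx i)] /\
  nx (nx i) |: [set i] = ~: [set nx i].
Proof.
by move: i; apply: forall_I3; split; apply/setP; apply: forall_I3; rewrite !inE.
Qed.

Lemma d_K1 (u : V3) : koszul_d xq (K1 u) set0 = dotq u.
Proof.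
rewrite ffunE /dotq /dot; apply: eq_big => [j|j _]; first by rewrite inE.
rewrite setU0 K1E (_ : [set i : 'I_3 in set0 | (i < j)%N] = set0) ?cards0 ?expr0 ?mul1r //.
by apply/setP => i; rewrite !inE.
Qed.

Lemma d_K2 (w : V3) : koszul_d xq (K2 w) = - K1 (crsq w).
Proof.
have dN (v : V3) : koszul_deg 1 (- K1 v) by move=> S hS; rewrite ffunE K1_deg ?oppr0.
apply: koszul_ext1 => //; first exact: koszul_d_deg (K2_deg w).
move=> i; rewrite [RHS]ffunE K1E ffunE.
have -> : \sum_(j | j \notin [set i])
    (-1) ^+ #|[set t in [set i] | (t < j)%N]| * xq j * K2 w (j |: [set i]) =
  \sum_(j | j != i) (-1) ^+ (i < j)%N * xq j * K2 w (j |: [set i]).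
  apply: eq_big => [j|j _]; first by rewrite inE.
  congr (_ ^+ _ * _ * _); rewrite card_set3 !inE.
  by move: i; apply: forall_I3; rewrite /= ?andbT ?add0n ?addn0.
have [e1 e2] := set1U_C i; rewrite sum_ne e1 e2 !K2E ffunE /crs.
by move: i {e1 e2}; apply: forall_I3; rewrite !nxE /=; ring.
Qed.

Lemma d_K3 (a : A) : koszul_d xq (K3 a) = K2 (sclq a).
Proof.
apply: koszul_ext2; [exact: koszul_d_deg (K3_deg a)|exact: K2_deg|] => i.
rewrite K2E !ffunE (bigD1 i) /=; last by rewrite !inE eqxx.
rewrite big1 ?addr0 => [|j]; last by rewrite !inE negbK => /andP[->].
rewrite ffunE setUCr eqxx mulrA; congr (_ ^+ _ * _ * _).
by rewrite card_set3 !inE; move: i; apply: forall_I3.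
Qed.

Lemma inversionsE (S U : {set 'I_3}) :
  inversions S U = (\sum_(i in S) \sum_(j in U) (j < i))%N.
Proof.
rewrite /inversions -sum1_card pair_big_dep /=.
rewrite big_mkcond [RHS]big_mkcond; apply: eq_bigr => -[i j] _ /=.
by rewrite !inE /=; do 2!case: (_ \in _) => //=; case: ltnP.
Qed.

Lemma setDT (S : {set 'I_3}) : setT :\: S = ~: S.
Proof. by apply/setP => i; rewrite !inE andbT. Qed.

Lemma mul_K1K1 (u v : V3) : koszul_mul (K1 u) (K1 v) = K2 [ffun i => crs u v i].
Proof.
apply: koszul_ext2; [exact: koszul_mul_deg (K1_deg u) (K1_deg v)|exact: K2_deg|].
move=> i; rewrite K2E ffunE big_mkcond sum_card1 => [|S hS]; last first.
  by rewrite K1_deg // mulr0 mul0r; case: ifP.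
rewrite (bigD1 i) //= sub1set !inE eqxx /= add0r.
have [e1 e2] := set1U_C (nx i).
rewrite sum_ne !sub1set !inE.
have D1 : ~: [set i] :\: [set nx i] = [set nx (nx i)].
  by move: i {e1 e2}; apply: forall_I3; apply/setP; apply: forall_I3; rewrite !inE.
have D2 : ~: [set i] :\: [set nx (nx i)] = [set nx i].
  by move: i {e1 e2 D1}; apply: forall_I3; apply/setP; apply: forall_I3; rewrite !inE.
rewrite D1 D2 !K1E !inversionsE !big_set1 !ffunE /crs.
by move: i {e1 e2 D1 D2}; apply: forall_I3; rewrite !nxE /=; ring.
Qed.

Lemma inv_1C (i : 'I_3) : inversions [set i] (~: [set i]) = i.
Proof.
rewrite inversionsE big_set1 big_mkcond /= sum_I3n !inE.
by move: i; apply: forall_I3.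
Qed.

Lemma inv_C1 (i : 'I_3) : inversions (~: [set i]) [set i] = (2 - i)%N.
Proof.
rewrite inversionsE big_mkcond /= sum_I3n !big_set1 !inE.
by move: i; apply: forall_I3.
Qed.

Lemma mul_K1K2 (u w : V3) : koszul_mul (K1 u) (K2 w) = K3 (dot u w).
Proof.
apply: koszul_ext3; [exact: koszul_mul_deg (K1_deg u) (K2_deg w)|exact: K3_deg|].
rewrite [RHS]ffunE eqxx ffunE.
under eq_bigl do rewrite subsetT.
rewrite sum_card1 => [|S hS]; last by rewrite K1_deg // mulr0 mul0r.
apply: eq_bigr => i _; rewrite setDT K1E K2E inv_1C.
by move: i; apply: forall_I3 => /=; ring.
Qed.

Lemma mul_K2K1 (u w : V3) : koszul_mul (K2 w) (K1 u) = K3 (dot u w).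
Proof.
apply: koszul_ext3; [exact: koszul_mul_deg (K2_deg w) (K1_deg u)|exact: K3_deg|].
rewrite [RHS]ffunE eqxx ffunE.
under eq_bigl do rewrite subsetT.
rewrite (reindex_inj (@setC_inj _)) /= sum_card1 => [|S hS]; last first.
  by rewrite setDT setCK K1_deg // mulr0.
apply: eq_bigr => i _; rewrite setDT setCK K1E K2E inv_C1.
by move: i; apply: forall_I3 => /=; ring.
Qed.

Lemma K1_surj (u : K) : koszul_deg 1 u -> u = K1 [ffun i => u [set i]].
Proof. by move=> hu; apply: koszul_ext1 => // [|i]; [apply: K1_deg|rewrite K1E ffunE]. Qed.

Lemma sgn_sq (i : nat) : (-1) ^+ i * (-1) ^+ i = 1 :> A.
Proof. by rewrite -expr2 sqrr_sign. Qed.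

Lemma K2_surj (u : K) : koszul_deg 2 u -> u = K2 [ffun i : 'I_3 => (-1) ^+ i * u (~: [set i])].
Proof.
move=> hu; apply: koszul_ext2 => // [|i]; first exact: K2_deg.
by rewrite K2E ffunE mulrA sgn_sq mul1r.
Qed.

Lemma K3_surj (u : K) : koszul_deg 3 u -> u = K3 (u setT).
Proof. by move=> hu; apply: koszul_ext3 => //; [apply: K3_deg|rewrite ffunE eqxx]. Qed.

Lemma K1_linear : linear K1.
Proof.
move=> c u v; apply/ffunP => S; rewrite !ffunE; case: pickP => [i _|_].
  by rewrite !ffunE.
by rewrite scaler0 addr0.
Qed.

Lemma K2_linear : linear K2.
Proof.
move=> c u v; apply/ffunP => S; rewrite !ffunE; case: pickP => [i _|_].
  by rewrite !ffunE mulrDr quot_scaleAr.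
by rewrite scaler0 addr0.
Qed.

Lemma K3_linear : linear K3.
Proof.
move=> c u v; apply/ffunP => S; rewrite !ffunE; case: eqP => // _.
by rewrite scaler0 addr0.
Qed.

Lemma K1_inj u v : K1 u = K1 v -> u = v.
Proof. by move=> h; apply/ffunP => i; rewrite -!K1E h. Qed.

Lemma K2_inj u v : K2 u = K2 v -> u = v.
Proof.
move=> h; apply/ffunP => i.
by rewrite -[u i]mul1r -[v i]mul1r -(sgn_sq i) -!mulrA -!K2E h.
Qed.

Lemma koszul_d_linear : linear (koszul_d xq).
Proof.
move=> c u v; apply/ffunP => S; rewrite !ffunE scaler_sumr -big_split.
apply: eq_bigr => j _ /=; rewrite !ffunE mulrDr quot_scaleAr.
by [].
Qed.

Lemma koszul_boundary_sub p : subspace (koszul_boundary xq p).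
Proof.
have dl := koszul_d_linear; split.
  exists 0; first by move=> S _; rewrite ffunE.
  by have := dl (-1) 0 0; rewrite scaler0 addr0 scaleN1r addNr.
move=> c u v [u' hu ->] [v' hv ->]; exists (c *: u' + v'); last exact: (esym (dl c u' v')).
by move=> S hS; rewrite !ffunE hu // hv // scaler0 addr0.
Qed.

Lemma bnd1P u : koszul_boundary xq 1 (K1 u) <-> B1 u.
Proof.
split=> [[w hw e]|[w ->]].
  rewrite (K2_surj hw) d_K2 in e; set w' := finfun _ in e; exists (- w').
  apply: K1_inj; rewrite e; apply: koszul_ext1.
  - by move=> S hS; rewrite ffunE K1_deg ?oppr0.
  - exact: K1_deg.
  by move=> i; rewrite [LHS]ffunE !K1E !ffunE /crs !ffunE; ring.
exists (K2 (- w)); first exact: K2_deg.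
rewrite d_K2; apply: koszul_ext1.
- exact: K1_deg.
- by move=> S hS; rewrite ffunE K1_deg ?oppr0.
by move=> i; rewrite [RHS]ffunE !K1E !ffunE /crs !ffunE; ring.
Qed.

Lemma bnd2P w : koszul_boundary xq 2 (K2 w) <-> B2 w.
Proof.
split=> [[a ha e]|[a ->]].
  by exists (a setT); apply: K2_inj; rewrite e -d_K3 -K3_surj.
by exists (K3 a); [apply: K3_deg|rewrite d_K3].
Qed.

Lemma bnd3P u : koszul_boundary xq 3 u <-> u = 0.
Proof.
split=> [[w hw ->]|->]; last by case: (koszul_boundary_sub 3).
have -> : w = 0.
  apply/ffunP => S; rewrite ffunE hw // neq_ltn ltnS.
  by have := max_card (mem S); rewrite card_ord => ->.
by have [_ ] := koszul_boundary_sub 3; have := koszul_d_linear (-1) 0 0;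
  rewrite scaler0 addr0 scaleN1r addNr.
Qed.

Lemma cyc1P u : koszul_cycle xq 1 (K1 u) <-> Z1 u.
Proof.
split=> [[_ e]|e]; first by rewrite /Z1 -d_K1 e ffunE.
split; first exact: K1_deg.
apply: koszul_ext (koszul_d_deg (K1_deg u)) _ _; first by move=> S _; rewrite ffunE.
by move=> S /eqP; rewrite cards_eq0 => /eqP->; rewrite d_K1 [RHS]ffunE.
Qed.

Lemma cyc2P' w : koszul_cycle xq 2 (K2 w) <-> Z2 w.
Proof.
have K10 : K1 0 = 0.
  by apply/ffunP => S; rewrite !ffunE; case: pickP => // i _; rewrite ffunE.
split=> [[_ e]|e].
  by apply: K1_inj; rewrite K10; apply/eqP; rewrite -oppr_eq0 -d_K2 e.
by split; [exact: K2_deg|rewrite d_K2 e K10 oppr0].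
Qed.

Lemma cyc3P a : koszul_cycle xq 3 (K3 a) <-> socle a.
Proof.
have K20 : K2 0 = 0.
  by apply/ffunP => S; rewrite !ffunE; case: pickP => // i _; rewrite ffunE mulr0.
split=> [[_ e] i|h].
  by move: e; rewrite d_K3 -K20 => /K2_inj/ffunP/(_ i); rewrite !ffunE.
split; first exact: K3_deg.
rewrite d_K3 -K20; congr K2; apply/ffunP => i; rewrite !ffunE; exact: h.
Qed.

Lemma tor_basis1 d (v : 'I_d -> V3) : is_basis_mod (@Z1 k I) (@B1 k I) v ->
  tor_basis 1 (fun i => K1 (v i)).
Proof.
apply: (is_basis_mod_map K1_linear (@Z1_sub k I) (koszul_boundary_sub 1)).
- by move=> u /cyc1P.
- by move=> u _ /bnd1P.
- by move=> u /bnd1P.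
move=> z hz; have [dz _] := hz; exists [ffun i => z [set i]].
  by apply/cyc1P; rewrite -K1_surj.
by rewrite -K1_surj // subrr; case: (koszul_boundary_sub 1).
Qed.

Lemma tor_basis2 d (v : 'I_d -> V3) : is_basis_mod (@Z2 k I) (@B2 k I) v ->
  tor_basis 2 (fun i => K2 (v i)).
Proof.
apply: (is_basis_mod_map K2_linear (@Z2_sub k I) (koszul_boundary_sub 2)).
- by move=> u /cyc2P'.
- by move=> u _ /bnd2P.
- by move=> u /bnd2P.
move=> z hz; have [dz _] := hz; exists [ffun i : 'I_3 => (-1) ^+ i * z (~: [set i])].
  by apply/cyc2P'; rewrite -K2_surj.
by rewrite -K2_surj // subrr; case: (koszul_boundary_sub 2).
Qed.

Lemma tor_basis3 d (v : 'I_d -> A) : is_basis (@socle k I) v ->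
  tor_basis 3 (fun i => K3 (v i)).
Proof.
have sS : subspace (@socle k I).
  split=> [i|c a b ha hb i]; first by rewrite mulr0.
  by rewrite mulrDr quot_scaleAr ha hb scaler0 addr0.
have K30 : K3 0 = 0 by apply/ffunP => S; rewrite !ffunE; case: ifP.
apply: (is_basis_mod_map K3_linear sS (koszul_boundary_sub 3)).
- by move=> u /cyc3P.
- by move=> u _ /bnd3P/ffunP/(_ setT); rewrite !ffunE eqxx.
- by move=> u ->; apply/bnd3P.
move=> z hz; have [dz _] := hz; exists (z setT).
  by apply/cyc3P; rewrite -K3_surj.
by rewrite -K3_surj // subrr; case: (koszul_boundary_sub 3).
Qed.

End KoszulThree.

(** * Artinian criterion, homogeneous components, ideals from predicates, spans *)

(** The chain is constant from an index N at which the dimension of J N is minimal: J N / J i then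
    has dimension 0 for i >= N. *)
Lemma artinian_fin (k : fieldType) (n : nat) (I : idealr {mpoly k[n]}) d :
  has_dim (fun _ : {ideal_quot I} => True) d -> artinian {ideal_quot I}.
Proof.
move=> hd J idJ decJ.
have s0 : subspace (fun a : {ideal_quot I} => a = 0) by apply: subspace0.
have sJ i : subspace (J i).
  case: (idJ i) => J0 JD JM; split=> // c u v Ju Jv.
  by apply: JD => //; apply: JM.
have J0 i : forall a, a = 0 -> J i a by move=> a ->; case: (sJ i).
have [dm hdm] : exists dm : nat -> nat, forall i, dim_mod (J i) (fun a => a = 0) (dm i).
  have h i : exists e, dim_mod (J i) (fun a => a = 0) e.
    exact: dim_mod_exists_fin hd (sJ i) s0 (J0 i).
  exists (fun i => proj1_sig (constructive_indefinite_description _ (h i))) => i.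
  by case: (constructive_indefinite_description _ (h i)).
have [N hN] : exists N, forall i, (dm N <= dm i)%N.
  suff H e : forall i, (dm i <= e)%N -> exists N, forall i, (dm N <= dm i)%N.
    exact: (H (dm 0%N) 0%N).
  elim: e => [|e IHe] i le_i; first by exists i => j; move: le_i; rewrite leqn0 => /eqP->.
  have [le_i'|lt_i] := leqP (dm i) e; first exact: IHe le_i'.
  case: (classic (exists j, (dm j <= e)%N)) => [[j]|no]; first exact: IHe.
  exists i => j; apply: leq_trans le_i _; rewrite ltnNge; apply/negP => le_j.
  by apply: no; exists j.
have sub i j : (i <= j)%N -> forall a, J j a -> J i a.
  elim: j => [|j IHj]; first by rewrite leqn0 => /eqP->.
  rewrite leq_eqVlt => /orP[/eqP-> //|]; rewrite ltnS => /IHj h a /decJ; exact: h.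
exists N => i le_i a JN.
have [e he] : exists e, dim_mod (J N) (J i) e.
  exact: dim_mod_exists_fin hd (sJ N) (sJ i) (sub _ _ le_i).
have e0 : dm N = (e + dm i)%N.
  apply: (dim_mod_uniq s0 (hdm N)).
  exact: dim_mod_cat (sJ N) (sJ i) (sub _ _ le_i) (J0 i) he (hdm i).
have ee : e = 0%N by have := hN i; lia.
by rewrite ee in he; apply: dim_mod0 he _ JN.
Qed.

Section HomogComponents.
Variables (k : fieldType) (n : nat).
Local Notation R := {mpoly k[n]}.
Implicit Types p : R.

Lemma mcoeff_pihomog d p m : (pihomog mdeg d p)@_m = p@_m *+ (mdeg m == d).
Proof.
rewrite pihomogE raddf_sum big_mkcond -mulr_natr [p@_m]mlin_coef /mlin mulr_suml.
apply: eq_bigr => m' _ /=; rewrite -mulrA -natrM mulnb.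
have [<-|ne] := eqVneq m' m; case: ifP => _; rewrite /= ?mulr0 ?mcoeff0 //.
  by rewrite mcoeffZ mcoeffX eqxx.
by rewrite mcoeffZ mcoeffX (negbTE ne) mulr0.
Qed.

Lemma pihomog_X d i p : pihomog mdeg d.+1 ('X_i * p) = 'X_i * pihomog mdeg d p.
Proof.
elim/mpolyind: p => [|c m p _ _ IHp]; first by rewrite !(mulr0, pihomog0).
rewrite mulrDr !pihomogD IHp mulrDr; congr (_ + _).
rewrite -scalerAr !linearZ /= -mpolyXD !pihomogX /= mdegD mdeg1 add1n eqSS.
by case: ifP => _; rewrite ?scaler0 ?mulr0 // mpolyXD scalerAr.
Qed.

End HomogComponents.

(** Membership in an [idealr] is boolean, whereas I is given by a quantified condition; excluded
    middle bridges the two. *)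
Lemma idealr_of_prop (k : fieldType) (n : nat) (P : {mpoly k[n]} -> Prop) :
  ~ P 1 -> P 0 -> (forall a p q, P p -> P q -> P (a * p + q)) ->
  exists I : idealr {mpoly k[n]}, forall p, p \in I <-> P p.
Proof.
move=> P1 P0 PD.
pose S : {mpoly k[n]} -> bool := fun p => if excluded_middle_informative (P p) then true else false.
have SE p : S p <-> P p by rewrite /S; case: excluded_middle_informative.
have cS : idealr_closed S.
  split; first exact/SE.
    by apply/negP => /SE.
  by move=> a p q /SE hp /SE hq; apply/SE/PD.
pose m := isIdealr.Build _ S cS.
pose I : idealr {mpoly k[n]} := HB.pack S m.
by exists I.
Qed.

Lemma span_subspace (k : fieldType) (V : lmodType k) (T : finType) (v : T -> V) :
  subspace (fun z => exists c : T -> k, z = \sum_t c t *: v t).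
Proof.
split; first by exists (fun=> 0); rewrite big1 // => t _; rewrite scale0r.
move=> c _ _ [c1 ->] [c2 ->]; exists (fun t => c * c1 t + c2 t).
by rewrite scaler_sumr -big_split; apply: eq_bigr => t _ /=; rewrite scalerDl scalerA.
Qed.

Lemma span_mem (k : fieldType) (V : lmodType k) (T : finType) (v : T -> V) t :
  exists c : T -> k, v t = \sum_t c t *: v t.
Proof.
exists (fun t' => (t' == t)%:R); rewrite (bigD1 t) //= eqxx scale1r big1 ?addr0 // => t' /negbTE->.
exact: scale0r.
Qed.

(** The type encodes the pairs (i, j) with i + j <= e, which index the basis elements U_i W_j used
    in one degree. *)
Lemma card_triangle e : #|{: {x : 'I_e.+1 & 'I_(e.+1 - x)}}| = 'C(e.+2, 2).
Proof.
rewrite card_tagged sumnE big_map big_enum /=.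
under eq_bigr do rewrite card_ord.
elim: e => [|e IHe]; first by rewrite big_ord_recl big_ord0.
rewrite big_ord_recl binS bin1 /= subn0 addnC; congr (_ + _)%N.
by rewrite -IHe; apply: eq_bigr => i _; rewrite /bump leq0n add1n subSS.
Qed.

(** * The ideal I and its inverse system *)
Section Compressed.
Variables (k : fieldType) (s mm : nat) (beta : k).
Hypotheses (s_gt0 : (0 < s)%N) (lt_mm : (mm < s)%N).
Local Notation R := {mpoly k[3]}.
Implicit Types (p q : R) (m : 'X_{1..3}).

Local Notation T := (2 * s - 1)%N.
Local Notation bk := (chb k).

(* Dual socle generator of degree 2s - 1: the product of the two Chebyshev
   moment functionals, perturbed by the coefficient of y^mm z^(2s-1-mm). *)
Definition Fs p : k := phi T 0 0 0 p + cf mm (T - mm) p.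
Fact Fs_linear : linear_for *%R Fs.
Proof. by move=> c p q; rewrite /Fs !linearP /=; ring. Qed.
HB.instance Definition _ := GRing.isLinear.Build k R k _ Fs Fs_linear.

(* Dual socle generator of degree s: evaluation of the degree s component at
   the point (0, 1, beta). *)
Definition Hs p : k := \sum_(b < s.+1) beta ^+ (s - b) * cf b (s - b) p.
Fact Hs_linear : linear_for *%R Hs.
Proof.
move=> c p q; rewrite /Hs /= mulr_sumr -big_split; apply: eq_bigr => b _ /=.
by rewrite linearP /=; ring.
Qed.
HB.instance Definition _ := GRing.isLinear.Build k R k _ Hs Hs_linear.

Lemma cf_deg b c p : (forall m, mdeg m = (b + c)%N -> p@_m = 0) -> cf b c p = 0.
Proof.
move=> hp; rewrite -(mlin0 p); apply: eq_mlin => m pm.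
case: and3P => // -[/eqP h0 /eqP h1 /eqP h2]; case/eqP: pm; apply: hp.
by rewrite mdeg3 h0 h1 h2.
Qed.

Lemma Fs_deg p : (forall m, mdeg m = T -> p@_m = 0) -> Fs p = 0.
Proof.
move=> hp; rewrite /Fs cf_deg ?addr0; last first.
  by move=> m hm; apply: hp; rewrite hm; lia.
rewrite -(mlin0 p); apply: eq_mlin => m pm; rewrite addn0.
case: (mdeg m =P T) => [hm|_]; last by rewrite mul0r.
by rewrite hp ?eqxx in pm.
Qed.

Lemma Hs_deg p : (forall m, mdeg m = s -> p@_m = 0) -> Hs p = 0.
Proof.
move=> hp; rewrite /Hs big1 // => b _; rewrite cf_deg ?mulr0 // => m hm.
by apply: hp; rewrite hm subnKC // -ltnS.
Qed.

Lemma Fs_low p : low T.+1 p -> Fs p = 0.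
Proof. by move=> hp; apply: Fs_deg => m hm; apply: hp; rewrite hm. Qed.

Lemma Hs_low p : low s.+1 p -> Hs p = 0.
Proof. by move=> hp; apply: Hs_deg => m hm; apply: hp; rewrite hm. Qed.

Lemma Fs_homog d p : p \is d.-homog -> d != T -> Fs p = 0.
Proof.
move=> hp hd; apply: Fs_deg => m hm; apply: (dhomog_nemf_coeff hp).
by apply: contraNneq hd => <-; apply/eqP.
Qed.

Lemma Hs_homog d p : p \is d.-homog -> d != s -> Hs p = 0.
Proof.
move=> hp hd; apply: Hs_deg => m hm; apply: (dhomog_nemf_coeff hp).
by apply: contraNneq hd => <-; apply/eqP.
Qed.

Lemma Hs_X0 p : Hs ('X_i0 * p) = 0.
Proof. by rewrite /Hs big1 // => b _; rewrite cf_X0 mulr0. Qed.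

Lemma Hs_X1 p : Hs ('X_i1 * p) = \sum_(l < s) beta ^+ (s.-1 - l) * cf l (s.-1 - l) p.
Proof.
rewrite /Hs big_ord_recl cf_X1 mulr0 add0r; apply: eq_bigr => l _.
rewrite cf_X1 /= /bump leq0n add1n.
by have -> : (s - l.+1 = s.-1 - l)%N by lia.
Qed.

Lemma Hs_bk a i j : Hs (bk a i j) = ((a == 0%N) && (i + j == s)%N)%:R * beta ^+ j.
Proof.
rewrite /Hs; under eq_bigr do rewrite cf_bk.
case: (a =P 0%N) => /= _; last by rewrite big1 ?mul0r // => b _; rewrite mulr0.
have [e|ne] := eqVneq (i + j)%N s; last first.
  rewrite mul0r big1 // => b _; case: andP; rewrite ?mulr0 // => -[/eqP eb /eqP ej].
  by case/eqP: ne; rewrite -eb -ej subnKC // -ltnS.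
have lt_i : (i < s.+1)%N by lia.
rewrite (bigD1 (Ordinal lt_i)) //= eqxx big1 ?addr0.
  by rewrite -e addKn eqxx mulr1 mul1r.
move=> b /eqP ne_b; case: (nat_of_ord b =P i) => [e'|]; rewrite ?mulr0 //.
by case: ne_b; apply: val_inj.
Qed.

Lemma Fs_bkS a i j p : Fs (bk a.+1 i j * p) = phi T i j (a.+1 + i + j) p.
Proof. by rewrite /Fs cf_bkS addr0 phi_bk. Qed.

Lemma Fs_ortho a i j a' i' j' : (i + j < s)%N -> (i' + j' < s)%N ->
  Fs (bk a i j * bk a' i' j') =
  [&& a + i + j + (a' + i' + j') == T, i == i' & j == j']%N%:R.
Proof.
move=> h h'; rewrite /Fs phi_bk phi_bk1 (_ : cf _ _ _ = 0) ?addr0; last first.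
  case: a => [|a]; last by rewrite cf_bkS.
  case: a' => [|a']; last by rewrite mulrC cf_bkS.
  rewrite cf_bk0 cf_bk; case: ifP => //= /andP[h1 h2].
  by case: andP => // -[/eqP h3 /eqP h4]; lia.
by rewrite addnC.
Qed.

(** The only partner of x^a U_i W_j under F_0 would be x^(T-a-2(i+j)) U_i W_j, and this exponent is
    negative. Since a > 0, the perturbation is not seen. *)
Lemma bk_G a i j : (0 < a)%N -> (2 * s <= a + 2 * (i + j))%N ->
  forall q, Fs (bk a i j * q) = 0.
Proof. by case: a => // a _ h q; rewrite Fs_bkS phi_gt //; lia. Qed.

(* The degree s part of the annihilator of [Fs] has basis Q_0, ..., Q_s, and
   Q_i = y^i z^(s-i) modulo x. *)
Definition Qs i : R := bk 0 i (s - i) -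
  (if (i <= mm)%N then bk 1 (mm - i) (s.-1 - (mm - i)) else 0).

(** F_0 annihilates U_i W_(s-i). If i <= mm the perturbation does not: it leaves the coefficient of
    y^(mm-i) z^(s-1-(mm-i)) in q. The second term of Q_i yields the same coefficient by
    [phi_top]. *)
Lemma Qs_G i : (i <= s)%N -> forall q, Fs (Qs i * q) = 0.
Proof.
move=> le_is q; rewrite mulrBl linearB /= {1}/Fs phi_bk phi_gt ?add0r; last by lia.
rewrite cf_bk0; case: leqP => [le_i|lt_i] /=; last by rewrite mul0r linear0 subr0.
rewrite (_ : (s - i <= T - mm)%N); last by lia.
rewrite Fs_bkS phi_top; last by lia.
by rewrite (_ : T - mm - (s - i) = s.-1 - (mm - i))%N ?subrr //; lia.
Qed.

Lemma Qs_homog i : (i <= s)%N -> Qs i \is s.-homog.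
Proof.
move=> le_is; apply: dhomogD; first by apply: bk_homog; lia.
rewrite dhomogN; case: leqP => [le_i|_]; last exact: dhomog0.
by apply: bk_homog; lia.
Qed.

Lemma Hs_Qs i : (i <= s)%N -> Hs (Qs i) = beta ^+ (s - i).
Proof.
move=> le_is; rewrite linearB /= Hs_bk subnKC // !eqxx mul1r.
by case: ifP; rewrite ?linear0 ?Hs_bk ?mul0r subr0.
Qed.

(** The largest ideal in the common kernel of F and H, that is, the ideal with inverse system
    generated by F and H. *)
Definition inI p : Prop := forall q, Fs (p * q) = 0 /\ Hs (p * q) = 0.

Lemma inI_subspace : subspace inI.
Proof.
split=> [q|c p p' hp hp' q]; first by rewrite mul0r !linear0.
rewrite mulrDl -scalerAl !linearP /=.
by have [-> ->] := hp q; have [-> ->] := hp' q; rewrite !mulr0 !addr0.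
Qed.

Lemma inI_mul a p : inI p -> inI (a * p).
Proof. by move=> hp q; rewrite -mulrA mulrCA; apply: hp. Qed.

(** In degree d < s, the test elements x^a U_i W_j with i + j <= d of complementary degree have a >=
    T - 2d >= 1. Hence the perturbation is invisible and [phi_inj] applies. *)
Lemma G_low p : (forall q, Fs (p * q) = 0) -> low s p.
Proof.
move=> hp m hm; apply: (phi_inj (T := T) (N := (T - mdeg m)%N)) => [i j|]; last by lia.
have [h|h] := ltnP (mdeg m) (i + j); first by rewrite phi_gt //; lia.
pose a := (T - mdeg m - i - j).-1.
rewrite (_ : T - mdeg m = a.+1 + i + j)%N; last by rewrite /a; lia.
by rewrite -Fs_bkS mulrC hp.
Qed.

Lemma inI_low p : inI p -> low s p.
Proof. by move=> hp; apply: G_low => q; case: (hp q). Qed.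

(** By [G_low] p has order at least s, so in H(p q) only the constant term of q counts. *)
Lemma inI_G p : (forall q, Fs (p * q) = 0) -> Hs p = 0 -> inI p.
Proof.
move=> hp h0 q; split=> //; have lp := G_low hp.
rewrite [q]mpolyE mulr_sumr linear_sum big1 // => m _.
rewrite -scalerAr linearZ /=; have [->|nz_m] := eqVneq m 0%MM.
  by rewrite mpolyX0 mulr1 h0 mulr0.
rewrite Hs_low ?mulr0 //; apply: low_le (_ : low (s + 1) _); first by rewrite addn1.
apply: lowM => //.
by apply: low_le (@lowX _ _ m); rewrite lt0n mdeg_eq0.
Qed.

Lemma inI_FH p : inI p -> Fs p = 0 /\ Hs p = 0.
Proof. by move=> /(_ 1); rewrite mulr1. Qed.

Lemma bk_inI a i j : (0 < a)%N -> (2 * s <= a + 2 * (i + j))%N -> inI (bk a i j).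
Proof.
move=> a_gt0 h; apply: inI_G; first exact: bk_G.
by rewrite Hs_bk; case: a a_gt0 {h} => // a _; rewrite mul0r.
Qed.

(** The projection of Q_i to V along Q_s, on which H is 1. In particular [vs s] is 0. *)
Definition vs i : R := Qs i - beta ^+ (s - i) *: Qs s.

Lemma vs_homog i : (i <= s)%N -> vs i \is s.-homog.
Proof.
move=> le_i; apply: dhomogD; first exact: Qs_homog.
by rewrite dhomogN; apply: dhomogZ; apply: Qs_homog.
Qed.

Lemma vs_inI i : (i <= s)%N -> inI (vs i).
Proof.
move=> le_i; apply: inI_G => [q|].
  by rewrite mulrBl -scalerAl linearB linearZ /= !Qs_G // mulr0 subr0.
by rewrite linearB linearZ /= !Hs_Qs // subnn mulr1 subrr.
Qed.

Lemma XQs_inI j : inI ('X_j * Qs s).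
Proof.
apply: inI_G => [q|]; first by rewrite -mulrA mulrCA Qs_G.
apply: (@Hs_homog s.+1); last by rewrite neq_ltn ltnSn orbT.
by apply: (@dhomogM _ _ _ 1); [apply: X_homog|apply: Qs_homog].
Qed.

(* The smallest subspace containing explicit generators of I and (x, y, z) I;
   [inI_inN] shows that it is I. *)
Definition inN p : Prop := forall Z : R -> Prop, subspace Z ->
  (forall i, (i < s)%N -> Z (vs i)) ->
  (forall l, (l < s)%N -> Z (bk 2 l (s.-1 - l))) ->
  (forall j, Z ('X_j * Qs s)) ->
  (forall j h, inI h -> Z ('X_j * h)) -> Z p.

Lemma inN_subspace : subspace inN.
Proof.
split=> [Z sZ *|c p q hp hq Z sZ h1 h2 h3 h4]; first by case: sZ.
by case: (sZ) => _; apply; [apply: hp|apply: hq].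
Qed.

Lemma inN_inI p : inN p -> inI p.
Proof.
apply; first exact: inI_subspace.
- by move=> i lt_i; apply: vs_inI; apply: ltnW.
- by move=> l lt_l; apply: bk_inI => //; lia.
- exact: XQs_inI.
- by move=> j h; apply: inI_mul.
Qed.

Lemma inN_X j h : inI h -> inN ('X_j * h).
Proof. by move=> hh Z _ _ _ _; apply. Qed.

Lemma inN_vs i : (i <= s)%N -> inN (vs i).
Proof.
rewrite leq_eqVlt => /orP[/eqP->|lt_i]; last by move=> Z _ + _ _ _; apply.
by rewrite /vs subnn scale1r subrr; case: inN_subspace.
Qed.

Lemma inN_XQs j : inN ('X_j * Qs s).
Proof. by move=> Z _ _ _ + _; apply. Qed.

Lemma Qs_vs i : Qs i = vs i + beta ^+ (s - i) *: Qs s.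
Proof. by rewrite subrK. Qed.

Lemma bk_inN a i j : (i + j < s)%N -> (2 * s <= a + 2 * (i + j))%N -> inN (bk a i j).
Proof.
move=> lt_ij h; have [e1|nz_a] := eqVneq a 1%N; first by lia.
have [e|ne] := eqVneq (a + 2 * (i + j))%N (2 * s)%N; last first.
  case: a h nz_a ne => [|a] h nz_a ne; first by lia.
  by rewrite -X0_bk; apply: inN_X; apply: bk_inI; lia.
have [a2|a2] := eqVneq a 2%N.
  move=> Z _ _ hZ _ _; rewrite a2.
  have -> : j = (s.-1 - i)%N by lia.
  by apply: hZ; lia.
(* On the line a + 2(i+j) = 2s the exponent a is even, hence at least 4 here. The recurrence
   expresses the element through x^(a-2) U_(i+1) W_j and x^(a-3) U_(i+2) W_j, both in I by
   [bk_inI]. *)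
have -> : bk a i j = 'X_i1 * bk (a - 2) i.+1 j - 'X_i0 * bk (a - 3) i.+2 j.
  rewrite X1_bkS X0_bk (_ : (a - 3).+1 = a - 2)%N; last by lia.
  by rewrite (_ : (a - 2).+2 = a); [rewrite addrC addKr|lia].
by apply: (subspaceB inN_subspace); apply: inN_X; apply: bk_inI; lia.
Qed.

(** * Dual bases and coordinates modulo I *)

Definition idx := ('I_s * 'I_s * 'I_(2 * s))%type.
(** The admissible triples index a basis [bt] of R/G. The dual basis [bt'] for F reverses the
    exponent of x, sending a to T - 2(i+j) - a (see [Fs_bt]). *)
Definition okx (t : idx) : bool :=
  (t.1.1 + t.1.2 < s)%N && (t.2 + 2 * (t.1.1 + t.1.2) < 2 * s)%N.
Definition bt (t : idx) : R := bk t.2 t.1.1 t.1.2.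
Definition bt' (t : idx) : R := bk (T - 2 * (t.1.1 + t.1.2) - t.2) t.1.1 t.1.2.

Lemma Fs_bt (t t' : idx) : okx t -> okx t' -> Fs (bt t * bt' t') = (t == t')%:R.
Proof.
case: t t' => [[i j] a] [[i' j'] a'] /andP[/= h1 h2] /andP[/= h3 h4].
rewrite Fs_ortho //=; congr (nat_of_bool _)%:R.
apply/and3P/eqP => [[/eqP e1 /eqP e2 /eqP e3]|[-> -> ->]].
  by congr (_, _, _); apply: val_inj => //=; lia.
by split=> //; apply/eqP; lia.
Qed.

Lemma Hs_bt t : okx t -> Hs (bt t) = 0.
Proof.
by case/andP=> h _; rewrite Hs_bk [(_ + _ == _)%N]ltn_eqF // andbF mul0r.
Qed.

Definition inS p : Prop := exists (c : idx -> k) (d : k),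
  inN (p - \sum_(t | okx t) c t *: bt t - d *: Qs s).

Lemma inN_inS p : inN p -> inS p.
Proof.
move=> hp; exists (fun=> 0), 0; rewrite scale0r subr0 big1 ?subr0 // => t _.
exact: scale0r.
Qed.

Lemma inS_subspace : subspace inS.
Proof.
split; first by apply: inN_inS; case: inN_subspace.
move=> c p q [c1 [d1 h1]] [c2 [d2 h2]].
exists (fun t => c * c1 t + c2 t), (c * d1 + d2).
have := inN_subspace.2 c _ _ h1 h2; congr inN.
have -> : \sum_(t | okx t) (c * c1 t + c2 t) *: bt t =
    c *: \sum_(t | okx t) c1 t *: bt t + \sum_(t | okx t) c2 t *: bt t.
  rewrite scaler_sumr -big_split; apply: eq_bigr => t _ /=.
  by rewrite scalerDl scalerA.
move: (Qs s) => Q; rewrite !scalerBr scalerDl scalerA; ring.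
Qed.

Lemma inS_Qs : inS (Qs s).
Proof.
exists (fun=> 0), 1; rewrite big1; first by rewrite subr0 scale1r subrr; case: inN_subspace.
by move=> t _; rewrite scale0r.
Qed.

Lemma inS_bk0 a i j : (i + j < s)%N -> inS (bk a i j).
Proof.
move=> lt_ij; have [h|h] := ltnP (a + 2 * (i + j)) (2 * s); last first.
  by apply: inN_inS; apply: bk_inN.
have lt_i : (i < s)%N by lia.
have lt_j : (j < s)%N by lia.
have lt_a : (a < 2 * s)%N by lia.
pose t0 : idx := (Ordinal lt_i, Ordinal lt_j, Ordinal lt_a).
exists (fun t => (t == t0)%:R), 0.
have ok0 : okx t0 by rewrite /okx /= lt_ij.
rewrite (bigD1 t0) //= eqxx scale1r big1; last first.
  by move=> t /andP[_ /negbTE->]; rewrite scale0r.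
by rewrite addr0 scale0r subr0 subrr; case: inN_subspace.
Qed.

(** For i + j = s, Q_i replaces U_i W_j by an element with index sum s - 1. What remains is a
    multiple of Q_i = [vs i] + beta^(s-i) Q_s. *)
Lemma inS_bk a i j : (i + j <= s)%N -> inS (bk a i j).
Proof.
rewrite leq_eqVlt => /orP[/eqP e|]; last exact: inS_bk0.
have -> : bk a i j = 'X_i0 ^+ a * Qs i +
    'X_i0 ^+ a * (if (i <= mm)%N then bk 1 (mm - i) (s.-1 - (mm - i)) else 0).
  rewrite -mulrDr subrK X0n_bk addn0; congr bk; lia.
apply: (subspaceD inS_subspace).
- rewrite Qs_vs mulrDr -scalerAr.
  apply: (subspaceD inS_subspace).
    case: a => [|a]; first by rewrite mul1r; apply: inN_inS; apply: inN_vs; lia.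
    rewrite exprS -mulrA; apply: inN_inS; apply: inN_X; apply: inI_mul.
    by apply: vs_inI; lia.
  apply: (subspaceZ _ inS_subspace).
  case: a => [|a]; first by rewrite mul1r; apply: inS_Qs.
  apply: inN_inS; rewrite exprS -mulrA; case: a => [|a].
    by rewrite mul1r; apply: inN_XQs.
  by apply: inN_X; rewrite exprSr -mulrA; apply: inI_mul; apply: XQs_inI.
- case: ifP => [le_i|_]; last by rewrite mulr0; case: inS_subspace.
  by rewrite X0n_bk; apply: inS_bk0; lia.
Qed.

(** The predicate [inS] contains 1 and is stable under the variables: a variable raises i + j by at
    most one, so from i + j < s only elements covered by [inS_bk] arise. *)
Lemma inS_all p : inS p.
Proof.
have sS := inS_subspace; apply: mpoly_subspace_all => //.
  have -> : 1 = bk 0 0 0 by rewrite /chb !mul1r.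
  exact: inS_bk.
move=> v {}p [c [d h]].
have -> : 'X_v * p = 'X_v * (p - \sum_(t | okx t) c t *: bt t - d *: Qs s) +
    \sum_(t | okx t) c t *: ('X_v * bt t) + d *: ('X_v * Qs s).
  have -> : \sum_(t | okx t) c t *: ('X_v * bt t) = 'X_v * \sum_(t | okx t) c t *: bt t.
    by rewrite mulr_sumr; apply: eq_bigr => t _; rewrite scalerAr.
  by move: (Qs s) (\sum_(t | okx t) _) => Q S; rewrite scalerAr; ring.
apply: (subspaceD sS); last by apply: (subspaceZ _ sS); apply: inN_inS; apply: inN_XQs.
apply: (subspaceD sS); first by apply: inN_inS; apply: inN_X; apply: inN_inI.
apply: (subspace_sum _ sS) => -[[i j] a] /andP[/= lt_ij _]; apply: (subspaceZ _ sS).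
rewrite /bt /=; case: i j lt_ij => [i lt_i] [j lt_j] /= lt_ij.
move: v; apply: forall_I3.
- by rewrite X0_bk; apply: inS_bk; lia.
- case: i lt_i lt_ij => [|i] lt_i lt_ij; first by rewrite X1_bk0; apply: inS_bk; lia.
  by rewrite X1_bkS; apply: (subspaceD sS); apply: inS_bk; lia.
- case: j lt_j lt_ij => [|j] lt_j lt_ij.
    by rewrite X2_bk0; apply: (subspaceB sS); apply: inS_bk; lia.
  by rewrite X2_bkS; apply: (subspaceD sS); apply: inS_bk; lia.
Qed.

(** The coefficients provided by [inS_all] are forced: F against [bt' t] reads off that of [bt t],
    and H reads off that of Q_s. *)
Lemma coord_inN p :
  inN (p - \sum_(t | okx t) Fs (p * bt' t) *: bt t - Hs p *: Qs s).
Proof.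
have [c [d h]] := inS_all p; have := h; congr inN.
have [_ hH] := inI_FH (inN_inI h).
congr (_ - _ - _).
  apply: eq_bigr => t ok_t; congr (_ *: _).
  have [hF _] := inN_inI h (bt' t); move: hF.
  have E S Q b : Fs ((p - S - d *: Q) * b) = Fs (p * b) - Fs (S * b) - d * Fs (Q * b).
    by rewrite !mulrBl !linearB /= -scalerAl linearZ.
  rewrite E Qs_G // mulr0 subr0.
  rewrite mulr_suml linear_sum (bigD1 t) //= -scalerAl linearZ /= Fs_bt // eqxx mulr1.
  rewrite big1 ?addr0; first by move/subr0_eq.
  move=> t' /andP[ok_t' /negbTE ne]; rewrite -scalerAl linearZ /= Fs_bt //.
  by rewrite ne mulr0.
have E S Q : Hs (p - S - d *: Q) = Hs p - Hs S - d * Hs Q by rewrite !linearB linearZ.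
congr (_ *: _); move: hH; rewrite E Hs_Qs // subnn mulr1.
rewrite linear_sum big1 ?subr0; first by move/subr0_eq.
by move=> t ok_t; rewrite linearZ /= Hs_bt // mulr0.
Qed.

Lemma inI_inN p : inI p -> inN p.
Proof.
move=> hp; have := coord_inN p; have [_ ->] := inI_FH hp.
rewrite scale0r subr0 big1 ?subr0 // => t _.
by case: (hp (bt' t)) => -> _; rewrite scale0r.
Qed.

(** * Cycles lifted to R, and Macaulay duality *)

Section Cycles.
Hypothesis s_ge3 : (3 <= s)%N.

Definition cyc1 (u : 'I_3 -> R) : Prop := inI (dot (@Xv k) u).
Definition cyc2 (w : 'I_3 -> R) : Prop := forall i, inI (crs (@Xv k) w i).

Lemma cyc2P w : cyc2 w <-> forall i j, inI ('X_i * w j - 'X_j * w i).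
Proof.
have sI := inI_subspace; split=> [h|h i]; last exact: h.
have swap i j : inI ('X_i * w j - 'X_j * w i) -> inI ('X_j * w i - 'X_i * w j).
  by move=> hij; rewrite -opprB; apply: (subspaceN sI).
have h0 := h i0; have h1 := h i1; have h2 := h i2; rewrite /crs !nxE in h0 h1 h2.
apply: forall_I3; apply: forall_I3; rewrite ?subrr //; try exact: sI.1;
  try exact: swap.
Qed.

Lemma inI_dot u v : (forall i, inI (u i)) -> inI (dot u v).
Proof.
move=> hu; rewrite /dot; apply: (subspace_sum _ inI_subspace) => i _.
by rewrite mulrC; apply: inI_mul.
Qed.

Lemma pair_bnd u h w : (forall i, u i = crs (@Xv k) h i) -> cyc2 w -> inI (dot u w).
Proof.
move=> hu hw; have -> : dot u w = dot (crs (@Xv k) h) w.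
  by apply: eq_bigr => i _; rewrite hu.
by rewrite dot_crs; apply: (subspaceN inI_subspace); apply: inI_dot.
Qed.

Lemma scalar_low (theta : {scalar R}) d p : (forall m, (d <= mdeg m)%N -> theta 'X_[m] = 0) ->
  low d p -> theta p = 0.
Proof.
move=> h hp; rewrite mlin_ext -(mlin0 p); apply: eq_mlin => m pm.
by apply: h; rewrite leqNgt; apply: contra pm => /hp ->.
Qed.

(* Macaulay duality for the Gorenstein quotient defined by [Fs]. *)
Lemma rep (theta : {scalar R}) : (forall m, (s <= mdeg m)%N -> theta 'X_[m] = 0) ->
  exists a, (forall q, Fs (a * q) = theta q) /\ forall j, Hs ('X_j * a) = 0.
Proof.
move=> h; have low0 p : low s p -> theta p = 0 by apply: scalar_low.
exists (\sum_(t | okx t) theta (bt t) *: bt' t); split=> [q|j].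
  have := coord_inN q => /inN_inI/inI_low/low0.
  have E S Q d : theta (q - S - d *: Q) = theta q - theta S - d * theta Q.
    by rewrite !linearB linearZ.
  rewrite E [X in _ * X]low0 ?mulr0 ?subr0; last by apply: low_homog; apply: Qs_homog.
  move/subr0_eq ->; rewrite mulr_suml !linear_sum; apply: eq_bigr => t _.
  by rewrite -scalerAl !linearZ /= mulrC [bt' t * _]mulrC.
rewrite mulr_sumr linear_sum big1 // => -[[i i'] a] /andP[/= h1 h2].
rewrite -scalerAr linearZ /=.
(* If [bt t] has degree at least s, then theta kills it; otherwise [bt' t] has degree at least T -
   (s-1) = s, and multiplying by a variable leads beyond degree s, where H vanishes. *)
have [hd|hd] := leqP s (a + i + i').
  rewrite low0 ?mul0r //; apply: low_le hd _; apply: low_homog.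
  exact: bk_homog.
rewrite (@Hs_homog (T - (a + i + i')).+1) ?mulr0 //; last by lia.
apply: (@dhomogM _ _ _ 1); first exact: X_homog.
by apply: bk_homog => /=; lia.
Qed.

(** Through [rep], w_t represents the functional sending q to the coefficient of y^i z^(s-i) in x_t
    q; the cycle condition holds because the variables commute. The pairing of w with u is then that
    coefficient of x u_0 + y u_1 + z u_2, which detects [vs i]. *)
Lemma dualV i : (i < s)%N -> exists w : 'I_3 -> R, cyc2 w /\
  forall t q, Fs (w t * q) = cf i (s - i) ('X_t * q).
Proof.
move=> lt_i; pose f t m : k := cf i (s - i) ('X_t * 'X_[m]).
have hf t : exists a, (forall q, Fs (a * q) = mlin (f t) q) /\ forall j, Hs ('X_j * a) = 0.
  apply: rep => m hm; rewrite /= mlinX /f cf_deg // => m'.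
  rewrite subnKC ?(ltnW lt_i) // -mpolyXD mcoeffX => hm'.
  by case: eqP => // e; move: hm'; rewrite -e mdegD mdeg1; lia.
have [w hw] : exists w : 'I_3 -> R, forall t,
    (forall q, Fs (w t * q) = mlin (f t) q) /\ forall j, Hs ('X_j * w t) = 0.
  have [a0 h0] := hf i0; have [a1 h1] := hf i1; have [a2 h2] := hf i2.
  exists (fun t => if t == i0 then a0 else if t == i1 then a1 else a2).
  exact: forall_I3.
have hF t q : Fs (w t * q) = cf i (s - i) ('X_t * q).
  by have [-> _] := hw t; rewrite [RHS]scalarM.
exists w; split=> //; apply/cyc2P => a b; apply: inI_G => [q|]; last first.
  by rewrite linearB /=; have [_ ->] := hw a; have [_ ->] := hw b; rewrite subrr.
rewrite mulrBl linearB /=.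
have -> : 'X_a * w b * q = w b * ('X_a * q) by ring.
have -> : 'X_b * w a * q = w a * ('X_b * q) by ring.
by rewrite !hF mulrCA subrr.
Qed.

(** * Linear syzygies among the Q_i *)

(** Index i - 1 with U_(-1) = 0, so that y U_i = U_(i+1) + x^2 U_(i-1) also holds for i = 0. *)
Definition bp a i j : R := if i is i'.+1 then bk a i' j else 0.

Lemma X1_bk a i j : 'X_i1 * bk a i j = bk a i.+1 j + bp a.+2 i j.
Proof. by case: i => [|i]; rewrite ?X1_bk0 ?addr0 // X1_bkS. Qed.

Lemma X2_bp a i j : 'X_i2 * bp a i j.+1 = bp a i j.+2 + bp a.+2 i j.
Proof. by case: i => [|i] /=; rewrite ?mulr0 ?addr0 // X2_bkS. Qed.

Lemma X0_bp a i j : 'X_i0 * bp a i j = bp a.+1 i j.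
Proof. by case: i => [|i] /=; rewrite ?mulr0 // X0_bk. Qed.

(* For l < mm, the linear syzygy
   x (Q_(mm-l+1) - Q_(mm-l-1)) + y Q_l - z Q_(l+1) = 0, as the cross product
   of (x, y, z) with this vector; see [crs_Wv]. *)
Definition Wv l : 'I_3 -> R := vec3 (bk 0 l (s.-1 - l))
  (bp 1 l (s.-1 - l) + bp 0 (mm - l) (s - mm + l))
  (bk 1 l (s - 2 - l) + bk 0 (mm - l) (s.-1 - mm + l)).

Lemma bp_homog a i j d : (a + i + j)%N = d.+1 -> bp a i j \is d.-homog.
Proof. by case: i => [|i] /= h; [apply: dhomog0|apply: bk_homog; lia]. Qed.

Lemma Wv_homog l : (l < mm)%N -> forall t, Wv l t \is (s.-1).-homog.
Proof.
move=> lt_l; apply: forall_I3; rewrite /Wv /=.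
- by apply: bk_homog; lia.
- by apply: dhomogD; apply: bp_homog; lia.
- by apply: dhomogD; apply: bk_homog; lia.
Qed.

Lemma QsE i : (i <= mm)%N -> Qs i = bk 0 i (s - i) - bk 1 (mm - i) (s.-1 - (mm - i)).
Proof. by rewrite /Qs => ->. Qed.

Lemma crs_Wv l : (l < mm)%N ->
  [/\ crs (@Xv k) (Wv l) i0 = Qs (mm - l).+1 - Qs (mm - l).-1,
      crs (@Xv k) (Wv l) i1 = Qs l
    & crs (@Xv k) (Wv l) i2 = - Qs l.+1].
Proof.
move=> lt_l; rewrite /crs !nxE /Wv /vec3 /= /Xv; split.
- have [c ec] : exists c, c.+1 = (s.-1 - l)%N by exists (s.-1 - l).-1; lia.
  have [d ed] : exists d, d.+1 = (s - mm + l)%N by exists (s - mm + l).-1; lia.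
  have [e ee] : exists e, e.+1 = (mm - l)%N by exists (mm - l).-1; lia.
  rewrite -ec -ed -ee (_ : s - 2 - l = c)%N; last by lia.
  rewrite (_ : s.-1 - mm + l = d)%N; last by lia.
  rewrite !mulrDr !X1_bk !X2_bp /= (@QsE e); last by lia.
  rewrite /Qs (_ : s - e.+2 = d)%N; last by lia.
  (* For l = 0 the form with index mm - l + 1 = mm + 1 has no correction term; this matches U_(-1) =
     0 in [bp]. *)
  case: l lt_l ec ed ee => [|l] lt_l ec ed ee.
    rewrite ifF; last by lia.
    rewrite (_ : mm - e = 1)%N; last by lia.
    rewrite (_ : s - e = d.+2)%N; last by lia.
    rewrite (_ : s.-1 - 1 = c)%N; last by lia.
    by rewrite /bp; ring.
  rewrite ifT; last by lia.
  rewrite (_ : mm - e.+2 = l)%N; last by lia.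
  rewrite (_ : mm - e = l.+2)%N; last by lia.
  rewrite (_ : s - e = d.+2)%N; last by lia.
  rewrite (_ : s.-1 - l = c.+2)%N; last by lia.
  rewrite (_ : s.-1 - l.+2 = c)%N; last by lia.
  by rewrite /bp; ring.
- have [c ec] : exists c, c.+1 = (s.-1 - l)%N by exists (s.-1 - l).-1; lia.
  rewrite -ec X2_bkS mulrDr !X0_bk QsE; last by lia.
  rewrite (_ : s - 2 - l = c)%N; last by lia.
  rewrite (_ : s - l = c.+2)%N; last by lia.
  rewrite (_ : s.-1 - (mm - l) = s.-1 - mm + l)%N; last by lia.
  by ring.
- have [e ee] : exists e, e.+1 = (mm - l)%N by exists (mm - l).-1; lia.
  rewrite -ee mulrDr !X0_bp X1_bk QsE; last by lia.
  rewrite (_ : s - l.+1 = s.-1 - l)%N; last by lia.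
  rewrite (_ : mm - l.+1 = e)%N; last by lia.
  rewrite (_ : s.-1 - e = s - mm + l)%N; last by lia.
  by rewrite /=; ring.
Qed.

(* The additional linear syzygy x (Q_1 - Q_s) + y Q_(s-1) - z Q_s = 0, which
   exists when mm = s - 1. *)
Definition Wtop : 'I_3 -> R := vec3 (bk 0 s.-1 0) (bk 1 (s - 2) 0)
  (bk 0 0 s.-1 - bk 0 s.-1 0).

Lemma Wtop_homog t : Wtop t \is (s.-1).-homog.
Proof.
move: t; apply: forall_I3; rewrite /Wtop /=.
- by apply: bk_homog; lia.
- by apply: bk_homog; lia.
- by apply: dhomogD; rewrite ?dhomogN; apply: bk_homog; lia.
Qed.

Lemma crs_Wtop : mm.+1 = s ->
  [/\ crs (@Xv k) Wtop i0 = Qs 1 - Qs s,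
      crs (@Xv k) Wtop i1 = Qs mm
    & crs (@Xv k) Wtop i2 = - Qs s].
Proof.
move=> es; rewrite /crs !nxE /Wtop /vec3 /= /Xv.
have Qss : Qs s = bk 0 s 0 by rewrite /Qs ifF ?subr0 ?subnn //; lia.
have [c ec] : exists c, s = c.+3 by exists (s - 3)%N; lia.
rewrite ec /= !subSS !subn0 in Qss *; have em : mm = c.+2 by lia.
split.
- rewrite mulrBr X1_bk0 X1_bkS X2_bk0 Qss QsE; last by lia.
  rewrite ec em /= !subSS !subn0 (_ : c.+1 - c = 1)%N; last by lia.
  by ring.
- rewrite em mulrBr X2_bk0 !X0_bk QsE; last by lia.
  rewrite ec em /= subnn subn0 (_ : c.+3 - c.+2 = 1)%N; last by lia.
  by ring.
- by rewrite Qss X0_bk X1_bkS; ring.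
Qed.

(* The hyperplane [Hs] = 0 has exactly mm linear syzygies in both cases. *)
Hypothesis hcase : (mm.+1 < s)%N /\ beta = 0 \/ mm.+1 = s /\ beta = 1.

(** For beta = 0 only Q_i with i < s occur in [crs_Wv], as mm + 1 < s, and these lie in I. For mm =
    s-1, subtracting [Wtop] turns every component into a combination of differences Q_i - Q_j, which
    lie in I for beta = 1. The subtraction changes only the coefficient with index s-1 = mm in w_0,
    which is outside the range l' < mm. *)
Lemma dualW l : (l < mm)%N -> exists w : 'I_3 -> R,
  [/\ cyc2 w, forall t, w t \is (s.-1).-homog
    & forall l', (l' < mm)%N -> cf l' (s.-1 - l') (w i0) = (l' == l)%:R].
Proof.
move=> lt_l; have [c0 c1 c2] := crs_Wv lt_l.
case: hcase => [[lt_m b0]|[es b1]].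
  have H0 i : (i < s)%N -> Hs (Qs i) = 0.
    by move=> lt_i; rewrite Hs_Qs ?(ltnW lt_i) // b0 expr0n subn_eq0 leqNgt lt_i.
  exists (Wv l); split; last 2 first.
  - exact: Wv_homog.
  - by move=> l' lt_l'; rewrite /Wv /= cf_bk /=; case: eqP => // ->; rewrite eqxx.
  have QI i : (i < s)%N -> inI (Qs i).
    by move=> lt_i; apply: inI_G; [apply: Qs_G; apply: ltnW|apply: H0].
  apply: forall_I3; rewrite ?c0 ?c1 ?c2.
  - by apply: (subspaceB inI_subspace); apply: QI; lia.
  - by apply: QI; lia.
  - by apply: (subspaceN inI_subspace); apply: QI; lia.
have [d0 d1 d2] := crs_Wtop es.
exists (fun t => Wv l t - Wtop t); split; last 2 first.
- move=> t; apply: dhomogD; first exact: Wv_homog.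
  by rewrite dhomogN; apply: Wtop_homog.
- move=> l' lt_l'; rewrite linearB /= /Wv /Wtop /= !cf_bk /=.
  rewrite [(l' == s.-1)%N]ltn_eqF /= ?subr0; last by lia.
  by case: eqP => // ->; rewrite eqxx.
have E i : crs (@Xv k) (fun t => Wv l t - Wtop t) i =
    crs (@Xv k) (Wv l) i - crs (@Xv k) Wtop i.
  by rewrite /crs; ring.
have QQ i j : (i <= s)%N -> (j <= s)%N -> inI (Qs i - Qs j).
  move=> le_i le_j; apply: inI_G => [q|].
    by move: (Qs_G le_i q) (Qs_G le_j q); move: (Qs i) (Qs j) => Q Q' h h';
      rewrite mulrBl linearB /= h h' subrr.
  move: (Hs_Qs le_i) (Hs_Qs le_j); rewrite b1 !expr1n.
  by move: (Qs i) (Qs j) => Q Q' h h'; rewrite linearB /= h h' subrr.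
apply: forall_I3; rewrite E ?c0 ?c1 ?c2 ?d0 ?d1 ?d2.
- by apply: (subspaceB inI_subspace); apply: QQ; lia.
- by apply: QQ; lia.
- by rewrite opprK addrC; apply: QQ; lia.
Qed.

(** * Upper bound for the rank of the pairing *)

(** Apply H to x w_1 - y w_0, which is in I. The point (0, 1, beta) lies on the line x = 0, so what
    remains is the value there of the component of w_0 of degree s - 1. Below, alpha_l denotes
    [cf l (s.-1 - l) (w i0)]. *)
Lemma alpha_sum w : cyc2 w ->
  \sum_(l < s) beta ^+ (s.-1 - l) * cf l (s.-1 - l) (w i0) = 0.
Proof.
move/cyc2P/(_ i0 i1)/inI_FH => [_]; rewrite linearB /= Hs_X0 Hs_X1 sub0r.
by move/eqP; rewrite oppr_eq0 => /eqP.
Qed.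

Lemma Fs_bk1 l p : (l < s)%N -> Fs (bk 1 l (s.-1 - l) * p) = cf l (s.-1 - l) p.
Proof. by move=> lt_l; rewrite Fs_bkS phi_top //; lia. Qed.

Lemma pair_syz (u w : 'I_3 -> R) : cyc2 w -> dot (@Xv k) u = 0 -> Fs (dot u w) = 0.
Proof.
move=> hw /koszul_exact[h hu].
by case: (inI_FH (pair_bnd hu hw)).
Qed.

(** Beyond mm the Q_i have no correction term, and the recurrences give y Q_(i+1) - z Q_(i+2) as x^2
    times the difference of U_i W_(s-1-i) and U_(i+2) W_(s-3-i). This syzygy of the variables pairs
    to 0 with w, and F annihilates its terms with Q, so alpha_i - alpha_(i+2) = 0. *)
Lemma alpha_step i w : cyc2 w -> (mm < i.+1)%N -> (i.+2 < s)%N ->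
  cf i (s.-1 - i) (w i0) = cf i.+2 (s.-1 - i.+2) (w i0).
Proof.
move=> hw lt_i lt_s; have [c ec] : exists c, s = (i + c).+3 by exists (s - i.+3)%N; lia.
have Q1 : Qs i.+1 = bk 0 i.+1 c.+2.
  by rewrite /Qs ifF ?subr0; [congr chb|]; lia.
have Q2 : Qs i.+2 = bk 0 i.+2 c.+1.
  by rewrite /Qs ifF ?subr0; [congr chb|]; lia.
pose u := vec3 (bk 1 i (s.-1 - i) - bk 1 i.+2 (s.-1 - i.+2)) (- Qs i.+1) (Qs i.+2).
have hu : dot (@Xv k) u = 0.
  rewrite dotE /u /vec3 /= /Xv Q1 Q2 mulrBr mulrN !X0_bk X1_bkS X2_bkS.
  rewrite (_ : s.-1 - i = c.+2)%N; last by lia.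
  by rewrite (_ : s.-1 - i.+2 = c)%N; [ring|lia].
have := pair_syz hw hu; rewrite dotE /u /vec3 /=.
have lt_i2 : (i < s)%N by lia.
have le1 : (i.+1 <= s)%N by lia.
have le2 : (i.+2 <= s)%N by lia.
move: (Qs_G le1 (w i1)) (Qs_G le2 (w i2)); move: (Qs i.+1) (Qs i.+2) => q q' e e'.
rewrite !mulrDl !mulNr !linearD !linearN /= e e' !Fs_bk1 // oppr0 !addr0.
by move/subr0_eq.
Qed.

(** The end of the chain of [alpha_step]: z W_0 = W_1 - x W_0 replaces the recurrence for z, so only
    alpha_(s-2) and terms in Q, annihilated by F, occur. *)
Lemma alpha_last w : cyc2 w -> (mm.+1 < s)%N -> cf (s - 2) 1 (w i0) = 0.
Proof.
move=> hw lt_m; have [c ec] : exists c, s = c.+2 by exists (s - 2)%N; lia.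
have Q1 : Qs c.+1 = bk 0 c.+1 1.
  by rewrite /Qs ifF ?subr0; [congr chb|]; lia.
have Q2 : Qs s = bk 0 c.+2 0.
  by rewrite /Qs ifF ?subr0; [congr chb|]; lia.
pose u := vec3 (bk 1 c 1 + Qs s) (- Qs c.+1) (Qs s).
have hu : dot (@Xv k) u = 0.
  rewrite dotE /u /vec3 /= /Xv Q1 Q2 mulrDr mulrN !X0_bk X1_bkS X2_bk0.
  by ring.
have := pair_syz hw hu; rewrite dotE /u /vec3 /=.
have le1 : (c.+1 <= s)%N by lia.
have lt_c : (c < s)%N by lia.
have := Fs_bk1 (w i0) lt_c; rewrite (_ : s.-1 - c = 1)%N; last by lia.
move: (Qs_G le1 (w i1)) (Qs_G (leqnn s) (w i2)) (Qs_G (leqnn s) (w i0)).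
move: (Qs c.+1) (Qs s) => q q' e e' e'' e1.
rewrite !mulrDl !mulNr !linearD !linearN /= e e' e'' e1 oppr0 !addr0.
by rewrite ec !subSS subn0.
Qed.

(** For beta = 0, alpha_(s-1) = 0 by [alpha_sum], alpha_(s-2) = 0 by [alpha_last], and [alpha_step]
    descends by two to every l >= mm. For beta = 1 only alpha_(s-1) is left, and the sum of all
    alpha_l is 0. *)
Lemma alpha_tail w : cyc2 w -> (forall l, (l < mm)%N -> cf l (s.-1 - l) (w i0) = 0) ->
  forall l, (l < s)%N -> cf l (s.-1 - l) (w i0) = 0.
Proof.
move=> hw h; have := alpha_sum hw.
case: hcase => [[lt_m ->]|[es ->]] hsum.
  have last0 : cf s.-1 0 (w i0) = 0.
    have lt_s1 : (s.-1 < s)%N by lia.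
    move: hsum; rewrite (bigD1 (Ordinal lt_s1)) //= big1 ?addr0.
      by rewrite subnn expr0 mul1r.
    move=> l /eqP ne; rewrite expr0n subn_eq0 leqNgt.
    suff -> : (l < s.-1)%N by rewrite mul0r.
    rewrite ltn_neqAle; apply/andP; split; last by have := ltn_ord l; lia.
    by apply/eqP => e; apply: ne; apply: val_inj.
  suff H d : forall l, (l + d = s.-1)%N -> cf l d (w i0) = 0.
    by move=> l lt_l; apply: H; lia.
  elim/two_step: d => [l|l hl|d IH0 _ l hl]; first by rewrite addn0 => ->.
    by have := alpha_last hw lt_m; congr (cf _ _ _ = 0); lia.
  have [lt_l|le_l] := ltnP l mm; first by have := h l lt_l; congr (cf _ _ _ = 0); lia.
  have := @alpha_step l w hw; rewrite (_ : s.-1 - l = d.+2)%N; last by lia.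
  rewrite (_ : s.-1 - l.+2 = d)%N; last by lia.
  by move=> ->; [apply: IH0| |]; lia.
move=> l lt_l; have [/h //|le_l] := ltnP l mm.
have el : l = mm by lia.
move: hsum; rewrite (bigD1 (Ordinal lt_l)) //= expr1n mul1r big1 ?addr0 //.
move=> l' /eqP ne; rewrite h ?mulr0 //.
rewrite ltnNge; apply/negP => le'; apply: ne; apply: val_inj => /=.
by have := ltn_ord l'; lia.
Qed.

(* The remaining classes of T_1 are those of x^2 U_l W_(s-1-l) with l >= mm,
   killed by [alpha_tail], and of the multiples of Q_s, killed since Q_s is in
   the Gorenstein ideal of [Fs]. *)
Lemma pair_zero (eV : nat -> 'I_3 -> R) w : cyc2 w ->
  (forall i, (i < s)%N -> dot (@Xv k) (eV i) = vs i) ->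
  (forall i, (i < s)%N -> Fs (dot (eV i) w) = 0) ->
  (forall l, (l < mm)%N -> cf l (s.-1 - l) (w i0) = 0) ->
  forall u, cyc1 u -> Fs (dot u w) = 0.
Proof.
move=> hw heV hV hW u /inI_inN hu.
(* By [pair_syz] the pairing with w depends on u only through x u_0 + y u_1 + z u_2, so one lift
   with zero pairing for each generator listed in [inN] is enough. *)
pose Z p := exists u' : 'I_3 -> R, dot (@Xv k) u' = p /\ Fs (dot u' w) = 0.
have [u' [e' F0]] : Z (dot (@Xv k) u).
  apply: hu.
  - split.
      by exists (fun=> 0); split; rewrite /dot big1 ?linear0 // => j _; rewrite ?mulr0 ?mul0r.
    move=> c p q [u1 [<- h1]] [u2 [<- h2]]; exists (fun t => c *: u1 t + u2 t).
    by rewrite dotDZr dotDZ linearP /= h1 h2 mulr0 addr0.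
  - by move=> i lt_i; exists (eV i); rewrite heV // hV.
  - move=> l lt_l; exists (unitv i0 (bk 1 l (s.-1 - l))).
    by rewrite dot_unitv dot_unitvl X0_bk Fs_bk1 // (alpha_tail hw).
  - by move=> j; exists (unitv j (Qs s)); rewrite dot_unitv dot_unitvl Qs_G.
  - by move=> j h hh; exists (unitv j h); rewrite dot_unitv dot_unitvl; case: (hh (w j)).
have := @pair_syz (fun t => -1 *: u' t + u t) w hw.
rewrite dotDZr e' dotDZ linearP /= F0 mulr0 add0r; apply.
by rewrite scaleN1r addNr.
Qed.

(** The elements x_i w_j - x_j w_i lie in I and have order at least s >= 3, so the parts of w of
    degree 0 and 1 satisfy the cycle equations exactly, in R. *)
Lemma cyc2_low w : cyc2 w -> exists c, forall j, low 2 (w j - c *: 'X_j).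
Proof.
move=> /cyc2P hw; have l3 i j : low 3 ('X_i * w j - 'X_j * w i).
  by apply: low_le (inI_low (hw i j)).
have h0 i j : i != j -> (w j)@_0%MM = 0.
  move=> ne; have := l3 i j (U_(i) + 0)%MM; rewrite mdegD mdeg1 mdeg0 => /(_ isT).
  rewrite mcoeffB mcoeffXS mcoeffX0 ?subr0 //.
  by rewrite mnmDE mnm1E mnm0E (negbTE ne).
have h1 i j : i != j -> (w j)@_U_(i) = 0.
  move=> ne; have := l3 i j (U_(i) + U_(i))%MM; rewrite mdegD mdeg1 => /(_ isT).
  rewrite mcoeffB mcoeffXS mcoeffX0 ?subr0 //.
  by rewrite mnmDE !mnm1E (negbTE ne).
have h2 i j : (w j)@_U_(j) = (w i)@_U_(i).
  have := l3 i j (U_(i) + U_(j))%MM; rewrite mdegD !mdeg1 => /(_ isT).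
  by rewrite mcoeffB mcoeffXS addmC mcoeffXS => /subr0_eq.
exists (w i0)@_U_(i0) => j m hm; rewrite mcoeffB mcoeffZ mcoeffX.
have [d0|d1] : mdeg m = 0%N \/ mdeg m = 1%N by lia.
  move/eqP: d0; rewrite mdeg_eq0 => /eqP->.
  rewrite mnm1_eq0 mulr0 subr0.
  by case: (eqVneq j i0) => [->|ne]; [apply: (h0 i1)|apply: (h0 i0); rewrite eq_sym].
move/eqP/mdeg1P: d1 => [i /eqP->]; rewrite eq_mnm1.
have [<-|ne] := eqVneq j i; first by rewrite mulr1 (h2 j i0) subrr.
by rewrite mulr0 subr0 h1 // eq_sym.
Qed.

(* A 2-cycle has linear part c (x, y, z), so T_1 T_2 has no component on the
   socle element of degree s. *)
Lemma Hs_pair u w : cyc2 w -> cyc1 u -> (forall t, low s.-1 (u t)) -> Hs (dot u w) = 0.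
Proof.
move=> /cyc2_low[c hc] hu lu.
have -> : dot u w = c *: dot (@Xv k) u + dot u (fun j => w j - c *: 'X_j).
  rewrite /dot scaler_sumr -big_split; apply: eq_bigr => j _ /=.
  by rewrite mulrBr -scalerAr [u j * 'X_j]mulrC addrC subrK.
rewrite linearP /=; have [_ ->] := inI_FH hu; rewrite mulr0 add0r.
rewrite /dot linear_sum big1 // => j _; apply: Hs_low.
by rewrite (_ : s.+1 = s.-1 + 2)%N; [apply: lowM|lia].
Qed.

Lemma crs_cyc2 u u' : cyc1 u -> cyc1 u' -> cyc2 (crs u u').
Proof.
move=> hu hu' i.
have -> : crs (@Xv k) (crs u u') i = u i * dot (@Xv k) u' - u' i * dot (@Xv k) u.
  by move: i; apply: forall_I3; rewrite !dotE /crs !nxE; ring.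
by apply: (subspaceB inI_subspace); apply: inI_mul.
Qed.

(* T_2 vanishes in internal degrees >= s + 3; this kills T_1 T_1. *)
Lemma cyc2_bnd (w : 'I_3 -> R) d : (s < d)%N -> (forall t, w t \is d.-homog) -> cyc2 w ->
  exists a, forall t, inI (w t - 'X_t * a).
Proof.
move=> lt_d hd /cyc2P hw.
(* The required a satisfies F(a x_t q) = F(w_t q). On a monomial this value is defined through some
   variable dividing it; the cycle condition makes the choice irrelevant ([gE]). The cut at degree s
   is what [rep] asks for, and is harmless by [FX]. *)
pose g (j : 'I_3) m := Fs (w j * 'X_[m - U_(j)]).
pose f m : k := if (mdeg m < s)%N then
  (if m i0 != 0%N then g i0 m else if m i1 != 0%N then g i1 m
   else if m i2 != 0%N then g i2 m else 0) else 0.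
have FX t m : (s <= (mdeg m).+1)%N -> Fs (w t * 'X_[m]) = 0.
  move=> hm; apply: (@Fs_homog (d + mdeg m)); last by lia.
  by apply: dhomogM => //; rewrite dhomogX.
have gE t j m : (U_(t) + m)%MM j != 0%N -> g j (U_(t) + m)%MM = Fs (w t * 'X_[m]).
  rewrite /g; have [->|ne] := eqVneq t j; first by rewrite addmC addmK.
  rewrite mnmDE mnm1E (negbTE ne) add0n -lep1mP => le_j.
  rewrite -addmBA // -{2}(submK le_j) [(_ + U_(j))%MM]addmC !mpolyXD.
  have [+ _] := hw t j 'X_[m - U_(j)]; rewrite mulrBl linearB /= => /subr0_eq.
  by congr (Fs _ = Fs _); ring.
have fE t m : f (U_(t) + m)%MM = Fs (w t * 'X_[m]).
  rewrite /f mdegD mdeg1 add1n; case: ltnP => [_|/FX-> //].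
  case: ifP => [/gE //|h0]; case: ifP => [/gE //|h1]; case: ifP => [/gE //|h2].
  have : (U_(t) + m)%MM t = 0%N.
    by move: t h0 h1 h2; apply: forall_I3 => /negbFE/eqP h0 /negbFE/eqP h1 /negbFE/eqP h2.
  by rewrite mnmDE mnm1E eqxx.
have [a [Fa Ha]] : exists a, (forall q, Fs (a * q) = mlin f q) /\ forall j, Hs ('X_j * a) = 0.
  by apply: rep => m hm; rewrite /= mlinX /f ltnNge hm.
exists a => t; apply: inI_G => [q|]; last first.
  by rewrite linearB /= Ha subr0 (Hs_homog (hd t)) // neq_ltn lt_d orbT.
rewrite mulrBl linearB /= -mulrA mulrCA Fa mlinMX scalarM.
by apply/eqP; rewrite subr_eq0; apply/eqP; apply: eq_mlin => m _; rewrite fE.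
Qed.

(** * Socle elements in terms of F and H *)

Lemma Fs_X0T : Fs ('X_i0 ^+ T) = 1.
Proof.
have -> : 'X_i0 ^+ T = bk T 0 0 * bk 0 0 0 by rewrite /chb !mulr1.
by rewrite Fs_ortho ?addn0 // eqxx.
Qed.

Lemma Hs_X0T : Hs ('X_i0 ^+ T) = 0.
Proof.
by rewrite (@Hs_homog T) //; [apply: Xn_homog|lia].
Qed.

Lemma inI_X0T j : inI ('X_j * 'X_i0 ^+ T).
Proof.
have lX : low (1 + T) ('X_j * 'X_i0 ^+ T : R).
  by apply: lowM; apply: low_homog; [apply: X_homog|apply: Xn_homog].
move=> q; rewrite Fs_low ?Hs_low //.
  by apply: low_le (lowM lX (@low0 _ _ q)); lia.
by apply: low_le (lowM lX (@low0 _ _ q)); lia.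
Qed.

Lemma inI_aug p : Fs p = 0 -> Hs p = 0 -> (forall j, inI ('X_j * p)) -> inI p.
Proof.
move=> hF hH hX; apply: inI_G => // q.
rewrite scalarM -(mlin0 q); apply: eq_mlin => m _.
have [->|nz_m] := eqVneq m 0%MM; first by rewrite mpolyX0 mulr1.
have [i hi] : exists i, m i != 0%N.
  apply/existsP; apply: contraR nz_m; rewrite negb_exists => /forallP h0.
  by apply/eqP/mnmP => i; rewrite mnm0E; apply/eqP; rewrite -[_ == _]negbK.
have -> : p * 'X_[m] = 'X_i * p * 'X_[m - U_(i)].
  by rewrite -{1}(@submK _ U_(i) m) ?lep1mP // mpolyXD; ring.
by case: (hX i 'X_[m - U_(i)]).
Qed.

(** F and H are dual to the socle elements x^T and Q_s; the difference is killed by the variables,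
    by F and by H, hence lies in I. *)
Lemma socle_lift p : (forall j, inI ('X_j * p)) ->
  inI (p - Fs p *: 'X_i0 ^+ T - Hs p *: Qs s).
Proof.
move=> hp; have FQ : Fs (Qs s) = 0 by rewrite -[Qs s]mulr1 Qs_G.
have HQ : Hs (Qs s) = 1 by rewrite Hs_Qs // subnn.
have XQ j := XQs_inI j.
move: (Qs s) FQ HQ XQ => Q FQ HQ XQ; apply: inI_aug.
- by rewrite !linearB !linearZ /= FQ Fs_X0T mulr0 mulr1 !subrr.
- by rewrite !linearB !linearZ /= HQ Hs_X0T mulr0 mulr1 subr0 subrr.
move=> j; rewrite !mulrBr -!scalerAr.
apply: (subspaceB inI_subspace); last by apply: (subspaceZ _ inI_subspace).
apply: (subspaceB inI_subspace) => //; apply: (subspaceZ _ inI_subspace).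
exact: inI_X0T.
Qed.

Lemma inI_not1 : ~ inI 1.
Proof.
by move=> /(_ ('X_i0 ^+ T))[+ _]; rewrite mul1r Fs_X0T => /eqP; rewrite oner_eq0.
Qed.

(** * The quotient R/I *)
Section Ring.
Variable I : idealr R.
Hypothesis hI : forall p, p \in I <-> inI p.
Local Notation A := {ideal_quot I}.
Local Notation V3 := {ffun 'I_3 -> A}.
Local Notation xq := (@quot_var k I).

Lemma pi_eqI (p q : R) : inI (p - q) -> \pi_A p = \pi_A q.
Proof. by move=> h; apply/pi_eq/hI. Qed.

Lemma pi_eqIr (p q : R) : \pi_A p = \pi_A q -> inI (p - q).
Proof. by move=> /pi_eq/hI. Qed.

Lemma pi_eqI0 (p : R) : \pi_A p = 0 <-> inI p.
Proof. by rewrite -hI pi_eq0. Qed.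

(** F and H each live in a single degree: F(p_d q) sees only monomials q of degree T - d, and on
    these p_d may be replaced by p. *)
Lemma inI_homog p d : inI p -> inI (pihomog mdeg d p).
Proof.
move=> hp.
have D m : mdeg m = d -> (p - pihomog mdeg d p)@_m = 0.
  by move=> hm; rewrite mcoeffB mcoeff_pihomog hm eqxx subrr.
have hd := @pihomogP _ _ mdeg d p.
apply: inI_G => [q|].
  rewrite scalarM -(mlin0 q); apply: eq_mlin => m _ /=.
  have [e|ne] := eqVneq (d + mdeg m)%N T; last first.
    by apply: (@Fs_homog (d + mdeg m)) => //; apply: dhomogM => //; rewrite dhomogX.
  have [F0 _] := hp 'X_[m]; rewrite -F0; apply/eqP; rewrite -subr_eq0 -linearB -mulrBl.
  apply/eqP; rewrite /= -opprB mulNr linearN /=; apply/eqP; rewrite oppr_eq0; apply/eqP.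
  apply: Fs_deg => m' hm'; have [le_m|nle] := boolP (m <= m')%MM.
    rewrite -(submK le_m) addmC mcoeffMX; apply: D; apply/eqP.
    by rewrite -(eqn_add2r (mdeg m)) -mdegD submK // hm' e.
  apply/eqP; rewrite mcoeff_eq0; apply: contra nle.
  move/msuppM_le/allpairsP => [[m1 m2] /= [_ h2 ->]].
  by move: h2; rewrite msuppX inE => /eqP->; apply: lem_addl.
have [e|ne] := eqVneq d s; last exact: Hs_homog hd ne.
have [_ H0] := inI_FH hp; rewrite -H0; apply/eqP; rewrite eq_sym -subr_eq0 -linearB.
by apply/eqP; apply: Hs_deg => m hm; apply: D; rewrite hm.
Qed.

Lemma homogeneous_I : homogeneous_ideal I.
Proof. by move=> p /hI hp d; apply/hI/inI_homog. Qed.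

Definition gam : A := \pi_A (Qs s).
Definition ome : A := \pi_A ('X_i0 ^+ T).

Definition FA (a : A) : k := Fs (repr a).
Definition HA (a : A) : k := Hs (repr a).

Lemma repr_inI (p : R) : inI (repr (\pi_A p) - p).
Proof. by apply: pi_eqIr; rewrite reprK. Qed.

Lemma FA_pi p : FA (\pi_A p) = Fs p.
Proof.
by have [+ _] := inI_FH (repr_inI p); rewrite linearB => /subr0_eq.
Qed.

Lemma HA_pi p : HA (\pi_A p) = Hs p.
Proof.
by have [_ +] := inI_FH (repr_inI p); rewrite linearB => /subr0_eq.
Qed.

Fact FA_linear : linear_for *%R FA.
Proof.
move=> c a b; have [p ->] := pi_repr a; have [q ->] := pi_repr b.
by rewrite -piZ -rmorphD !FA_pi linearP.
Qed.
HB.instance Definition _ := GRing.isLinear.Build k A k _ FA FA_linear.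

Fact HA_linear : linear_for *%R HA.
Proof.
move=> c a b; have [p ->] := pi_repr a; have [q ->] := pi_repr b.
by rewrite -piZ -rmorphD !HA_pi linearP.
Qed.
HB.instance Definition _ := GRing.isLinear.Build k A k _ HA HA_linear.

Lemma FA_ome : FA ome = 1. Proof. by rewrite FA_pi Fs_X0T. Qed.
Lemma HA_ome : HA ome = 0. Proof. by rewrite HA_pi Hs_X0T. Qed.
Lemma FA_gam : FA gam = 0.
Proof. by rewrite FA_pi -[Qs s]mulr1 Qs_G. Qed.
Lemma HA_gam : HA gam = 1.
Proof. by rewrite HA_pi Hs_Qs // subnn. Qed.

Lemma socle_gam : socle gam.
Proof. by move=> j; rewrite /gam -rmorphM; apply/pi_eqI0/XQs_inI. Qed.

Lemma socle_ome : socle ome.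
Proof. by move=> j; rewrite /ome -rmorphM; apply/pi_eqI0/inI_X0T. Qed.

Lemma socleE a : socle a -> a = FA a *: ome + HA a *: gam.
Proof.
have [p ->] := pi_repr a => hp; rewrite FA_pi HA_pi -!piZ -rmorphD.
apply: pi_eqI; rewrite opprD addrA; apply: socle_lift => j.
by apply/pi_eqI0; rewrite rmorphM; apply: hp.
Qed.

(** The flag t sets the order: [socle_iso] lists degree s first, whereas in [tor_class_G] the first
    basis element must be the target of the products, of degree 2s - 1. *)
Lemma socv_basis (v : 'I_2 -> A) (t : bool) :
  (forall i, v i = if (i == ord0) (+) t then gam else ome) -> is_basis (@socle k I) v.
Proof.
move=> vE; have v0 := vE ord0; have v1 := vE (lift ord0 ord0).
split.
- by move=> i; rewrite vE; case: ifP => _; [apply: socle_gam|apply: socle_ome].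
- move=> c; rewrite !big_ord_recl big_ord0 addr0 v0 v1 => e0.
  have := congr1 FA e0; have := congr1 HA e0.
  rewrite !linearD !linear0 !linearZ /= => hH hF.
  have cc : c ord0 = 0 /\ c (lift ord0 ord0) = 0.
    by move: hH hF; case: t {vE v0 v1 e0} => /=;
      rewrite FA_ome HA_ome FA_gam HA_gam !mulr0 !mulr1 ?add0r ?addr0.
  by case: cc => c0 c1 i; case: (unliftP ord0 i) => [j ->|-> //]; rewrite ord1.
- move=> z /socleE ez.
  exists (fun i => if (i == ord0) (+) t then HA z else FA z).
  rewrite !big_ord_recl big_ord0 addr0 v0 v1 {1}ez.
  by case: t {vE v0 v1} => /=; [|rewrite [X in X - _]addrC]; rewrite subrr.
Qed.

Lemma has_dim_socle : has_dim (@socle k I) 2.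
Proof. by exists (fun i => if (i == ord0) (+) false then gam else ome); apply: (@socv_basis _ false). Qed.

Lemma deg_gam : @quot_deg k I s gam.
Proof. by exists (Qs s) => //; apply: Qs_homog. Qed.

Lemma deg_ome : @quot_deg k I T ome.
Proof. by exists ('X_i0 ^+ T) => //; apply: Xn_homog. Qed.

Lemma socle_iso_I : socle_iso I [:: s; (2 * s - 1)%N].
Proof.
exists (fun i : 'I_2 => if (i == ord0) (+) false then gam else ome); split.
  exact: (@socv_basis _ false).
case=> [[|[|//]] lt_i] /=; [exact: deg_gam|exact: deg_ome].
Qed.

Lemma has_dim_socle_deg l :
  has_dim (@socle_deg k I l) ((l == s) + (l == T))%N.
Proof.
have neT : s != T by lia.
have sdeg a : socle_deg l a -> a = (if l == T then FA a *: ome else 0) + (if l == s then HA a *: gam else 0).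
  move=> [/socleE + [p hp ea]].
  have -> : (if l == T then FA a *: ome else 0) = FA a *: ome.
    by case: ifP => // /negbT ne; rewrite ea FA_pi (Fs_homog hp) // scale0r.
  have -> : (if l == s then HA a *: gam else 0) = HA a *: gam.
    by case: ifP => // /negbT ne; rewrite ea HA_pi (Hs_homog hp) // scale0r.
  by [].
have [es|nes] := eqVneq l s.
  subst l; rewrite (negbTE neT) addn0; exists (fun=> gam); split=> [i|c|z hz].
  - by split; [apply: socle_gam|apply: deg_gam].
  - by rewrite big_ord1 => /(congr1 HA); rewrite linearZ linear0 /= HA_gam mulr1 => h i; rewrite ord1.
  - exists (fun=> HA z); rewrite big_ord1 {1}(sdeg z hz) (negbTE neT) eqxx add0r.
    exact: subrr.
have [eT|neT'] := eqVneq l T.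
  subst l; exists (fun=> ome); split=> [i|c|z hz].
  - by split; [apply: socle_ome|apply: deg_ome].
  - by rewrite big_ord1 => /(congr1 FA); rewrite linearZ linear0 /= FA_ome mulr1 => h i; rewrite ord1.
  - exists (fun=> FA z); rewrite big_ord1 {1}(sdeg z hz) eqxx [T == s]eq_sym (negbTE neT) addr0.
    exact: subrr.
exists (fun=> 0); split=> [[]|? ? []|z hz] //; exists (fun=> 0); rewrite big_ord0 subr0.
by rewrite (sdeg z hz) (negbTE nes) (negbTE neT') addr0.
Qed.

(** * Hilbert function of R/I *)

Lemma coord_A p : \pi_A p =
  \sum_(t | okx t) Fs (p * bt' t) *: \pi_A (bt t) + Hs p *: gam.
Proof.
have -> : \sum_(t | okx t) Fs (p * bt' t) *: \pi_A (bt t) =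
    \pi_A (\sum_(t | okx t) Fs (p * bt' t) *: bt t).
  by rewrite pi_sum; apply: eq_bigr => t _; rewrite piZ.
rewrite -piZ -rmorphD; apply: pi_eqI; rewrite opprD addrA.
by apply: inN_inI; apply: coord_inN.
Qed.

Lemma A_fin : exists n, has_dim (fun _ : A => True) n.
Proof.
pose v (t : idx + unit) : A := if t is inl t then \pi_A (bt t) else gam.
pose N := #|{: idx + unit}|.
apply: (@dim_mod_exists _ _ _ _ N (fun i => v (enum_val i))) => //; first exact: subspace0.
move=> a _; have [p ->] := pi_repr a.
have sv := span_subspace v.
have [c ->] : exists c : idx + unit -> k, \pi_A p = \sum_t c t *: v t.
  rewrite coord_A; apply: (subspaceD sv).
    apply: (subspace_sum _ sv) => t _; apply: (subspaceZ _ sv).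
    exact: (span_mem v (inl t)).
  by apply: (subspaceZ _ sv); apply: (span_mem v (inr tt)).
exists (fun i => c (enum_val i)).
by rewrite (reindex (@enum_val _ {: idx + unit})) //; apply/onW_bij/enum_val_bij.
Qed.

Lemma artinian_I : artinian A.
Proof. by have [n hn] := A_fin; apply: artinian_fin hn. Qed.

Lemma bt'_homog (t : idx) : okx t -> bt' t \is (T - (t.2 + t.1.1 + t.1.2))%N.-homog.
Proof. by case: t => [[i j] a] /andP[/= h1 h2]; apply: bk_homog => /=; lia. Qed.

Lemma okx_le (t : idx) : okx t -> (t.2 + t.1.1 + t.1.2 <= T)%N.
Proof. by case: t => [[i j] a] /andP[/= h1 h2]; lia. Qed.

Lemma okx_min (t : idx) i : okx t -> (t.2 + t.1.1 + t.1.2)%N = i ->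
  (t.1.1 + t.1.2 <= minn i (T - i))%N.
Proof. by case: t => [[i1 j] a] /andP[/= h1 h2] h3; lia. Qed.

(** A basis consists of the x^c U_a W_b of degree i with a + b <= min(i, T - i), plus [gam] if i =
    s. The bound i is c >= 0, and the bound T - i is admissibility, c + 2(a+b) < 2s. *)
Lemma has_dim_deg i : (i <= T)%N ->
  has_dim (@quot_deg k I i) ('C((minn i (T - i)).+2, 2) + (i == s)).
Proof.
move=> le_i; have arith d : (d <= T)%N -> d != i -> (i + (T - d) != T)%N by lia.
have arith2 a b c : (a + b <= c)%N -> (b < c.+1 - a)%N by lia.
have arith3 a b c : (a + b <= c)%N -> (a < c.+1)%N by lia.
have arith4 a b c d : (a + b + c)%N = d -> (d - (b + c) = a)%N by lia.
set e := minn i (T - i).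
have le_e1 : (e <= i)%N by rewrite /e; lia.
have le_e2 : (e <= T - i)%N by rewrite /e; lia.
pose Te := {x : 'I_e.+1 & 'I_(e.+1 - x)}.
have tP (x : Te) : (tag x + tagged x <= e)%N.
  by have := ltn_ord (tagged x); have := ltn_ord (tag x); lia.
pose b (x : Te) : R := bk (i - (tag x + tagged x)) (tag x) (tagged x).
pose v (t : (Te + 'I_(i == s))%type) : A := if t is inl x then \pi_A (b x) else gam.
have -> : ('C(e.+2, 2) + (i == s) = #|{: Te + 'I_(i == s)}|)%N.
  by rewrite card_sum card_triangle card_ord.
have Fb (x y : Te) : Fs (b x * bk (T - i - (tag y + tagged y)) (tag y) (tagged y)) = (x == y)%:R.
  have hx := tP x; have hy := tP y.
  rewrite Fs_ortho; [|lia|lia]; congr (nat_of_bool _)%:R.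
  apply/and3P/eqP => [[_ /eqP e1 /eqP e2]|->]; last by split=> //; apply/eqP; lia.
  case: x y e1 e2 {hx hy} => [x1 x2] [y1 y2] /= /val_inj e1; rewrite -e1 in y2 *.
  by move=> /val_inj->.
have Hb x : Hs (b x) = 0.
  by rewrite Hs_bk; have := tP x; case: andP => [[/eqP h1 /eqP h2]|]; rewrite ?mul0r //; lia.
have FQ q : Fs (Qs s * q) = 0 by apply: Qs_G.
apply: (@has_dim_fin _ _ _ _ v).
- case=> [x|j] /=; last first.
    have -> : i = s by case: j; case: eqP.
    exact: deg_gam.
  by exists (b x) => //; apply: bk_homog; have := tP x; lia.
- move=> c; rewrite big_sumType /= => e0.
  have : \pi_A (\sum_x c (inl x) *: b x + \sum_j c (inr j) *: Qs s) = 0.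
    rewrite -[RHS]e0 rmorphD /= !pi_sum; congr (_ + _); apply: eq_bigr => t _; exact: piZ.
  move/pi_eqI0 => hp.
  have cl y : c (inl y) = 0.
    have [+ _] := hp (bk (T - i - (tag y + tagged y)) (tag y) (tagged y)).
    rewrite mulrDl linearD /= !mulr_suml !linear_sum [X in _ + X]big1 ?addr0 => [|j _].
      rewrite (bigD1 y) //= -scalerAl linearZ /= Fb eqxx mulr1 big1 ?addr0 // => x ne.
      by rewrite -scalerAl linearZ /= Fb (negbTE ne) mulr0.
    by rewrite -scalerAl linearZ /= FQ mulr0.
  have [_] := inI_FH hp; rewrite linearD !linear_sum /= big1 ?add0r => [|x _]; last first.
    by rewrite linearZ /= Hb mulr0.
  move=> hH [x|j]; first exact: cl.
  have H1 : Hs (Qs s) = 1 by rewrite Hs_Qs // subnn.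
  have lt_j := ltn_ord j; have le1 : ((i == s) <= 1)%N by case: (i == s).
  move: hH; rewrite (bigD1 j) //= linearZ /= H1 mulr1 big1 ?addr0 // => j' /eqP ne.
  case: ne; apply: val_inj; have /= := ltn_ord j'; lia.
- move=> z [p hp ->]; have sv := span_subspace v.
  rewrite coord_A; apply: (subspaceD sv).
    apply: (subspace_sum _ sv) => t ok_t.
    have [ed|ned] := eqVneq (t.2 + t.1.1 + t.1.2)%N i; last first.
      rewrite (@Fs_homog (i + (T - (t.2 + t.1.1 + t.1.2)))) ?scale0r; first by case: sv.
        by apply: dhomogM => //; apply: bt'_homog.
      exact: arith (okx_le ok_t) ned.
    apply: (subspaceZ _ sv); have le_t := okx_min ok_t ed; rewrite -/e in le_t.
    have lt1 : (t.1.1 < e.+1)%N := arith3 _ _ _ le_t.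
    have lt2 : (t.1.2 < e.+1 - Ordinal lt1)%N := arith2 _ _ _ le_t.
    pose x0 : Te := @Tagged _ (Ordinal lt1) (fun x : 'I_e.+1 => 'I_(e.+1 - x)) (Ordinal lt2).
    have -> : \pi_A (bt t) = v (inl x0).
      by rewrite /v /b /bt /=; congr (\pi_A (chb _ _ _ _)); apply/esym/arith4.
    exact: span_mem.
  have [es|nes] : i = s \/ i != s by case: (i =P s); [left|right].
    apply: (subspaceZ _ sv); have lt0 : (0 < (i == s))%N by rewrite es eqxx.
    exact: (span_mem v (inr (Ordinal lt0))).
  by rewrite (Hs_homog hp) // scale0r; case: sv.
Qed.

(** The minimum is the binomial for i < s and the sum for i >= s. At i = s the sum is C(s+1, 2) + 1,
    the summand 1 being the socle element of degree s. *)
Lemma compressed_I : compressed I T.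
Proof.
exists (fun l => ((l == s) + (l == T))%N); first exact: has_dim_socle_deg.
move=> i le_i; have := has_dim_deg le_i; congr has_dim.
have binE n : 'C(2 + n, n) = 'C(n.+2, 2) by rewrite -bin_sub ?leq_addl // addnK.
have -> : (\sum_(l < T.+1 | (i <= l)%N) ((l == s :> nat) + (l == T :> nat)) * 'C(2 + (l - i), l - i) =
    (if (i <= s)%N then 'C((s - i).+2, 2) else 0) + 'C((T - i).+2, 2))%N.
  have lt_sT : (s < T)%N by lia.
  have ltT : (T < T.+1)%N by [].
  rewrite (bigD1 (Ordinal ltT)) //= eqxx binE [T == s]eq_sym (ltn_eqF lt_sT) mul1n addnC.
  congr (_ + _)%N.
  have lt_s : (s < T.+1)%N by lia.
  have rest (P : pred 'I_T.+1) : (forall l, P l -> l != s :> nat /\ l != T :> nat) ->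
      (\sum_(l < T.+1 | P l) ((l == s :> nat) + (l == T :> nat)) * 'C(2 + (l - i), l - i) = 0)%N.
    by move=> hP; apply: big1 => l /hP[/negbTE-> /negbTE->].
  case: ifP => le_is; last first.
    apply: rest => l /andP[h1 h2]; split; first by apply/eqP => e'; lia.
    by apply: contraNneq h2 => e'; apply/eqP/val_inj.
  rewrite (bigD1 (Ordinal lt_s)) /=; last first.
    by rewrite le_is; apply/eqP => /(congr1 val) /= e'; lia.
  rewrite eqxx (ltn_eqF lt_sT) mul1n binE rest ?addn0 // => l /andP[/andP[_ h1] h2].
  by split; [apply: contraNneq h2|apply: contraNneq h1] => e'; apply/eqP/val_inj.
have mono a b : (a <= b)%N -> ('C(a.+2, 2) <= 'C(b.+2, 2))%N.
  by move=> le_ab; apply: leq_bin2l.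
rewrite binE; have [lt_i|lt_i|->] := ltngtP i s.
- rewrite addn0 (minn_idPl _); last by lia.
  by rewrite (minn_idPl _) //; apply: leq_trans (mono i (T - i)%N _) (leq_addl _ _); lia.
- rewrite addn0 add0n (minn_idPr _); last by lia.
  by rewrite (minn_idPr _) //; apply: mono; lia.
- rewrite subnn (minn_idPr _); last by lia.
  have [c ec] : exists c, s = c.+1 by exists s.-1; lia.
  rewrite (_ : T - s = c)%N; last by lia.
  rewrite ec addnC (minn_idPr _) //.
  by rewrite [X in (_ <= X)%N]binS bin1 addnC leq_add2l.
Qed.

(** * Koszul cycles of R/I through their lifts *)

Definition pv (u : 'I_3 -> R) : V3 := [ffun i => \pi_A (u i)].

Lemma dot_pv (u w : 'I_3 -> R) : dot (pv u) (pv w) = \pi_A (dot u w).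
Proof. by rewrite /dot pi_sum; apply: eq_bigr => j _; rewrite !ffunE rmorphM. Qed.

Lemma dotq_pv u : dotq (pv u) = \pi_A (dot (@Xv k) u).
Proof. by rewrite /dotq /dot pi_sum; apply: eq_bigr => j _; rewrite ffunE rmorphM. Qed.

Lemma crsq_pv w i : crsq (pv w) i = \pi_A (crs (@Xv k) w i).
Proof. by rewrite ffunE /crs !ffunE rmorphB !rmorphM. Qed.

Lemma Z1_pv u : Z1 (pv u) <-> cyc1 u.
Proof. by rewrite /Z1 dotq_pv pi_eqI0. Qed.

Lemma Z2_pv w : Z2 (pv w) <-> cyc2 w.
Proof.
split=> [h i|h]; first by apply/pi_eqI0; rewrite -crsq_pv h ffunE.
by apply/ffunP => i; rewrite crsq_pv [RHS]ffunE; apply/pi_eqI0.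
Qed.

Lemma pv_surj (u : V3) : exists v, u = pv v.
Proof.
exists (fun i => repr (u i)); apply/ffunP => i; by rewrite ffunE reprK.
Qed.

Lemma pvDZ c u u' : pv (fun t => c *: u t + u' t) = c *: pv u + pv u'.
Proof. by apply/ffunP => i; rewrite !ffunE rmorphD /= piZ. Qed.

Lemma pv_sum (J : finType) (c : J -> k) (u : J -> 'I_3 -> R) :
  pv (fun t => \sum_j c j *: u j t) = \sum_j c j *: pv (u j).
Proof.
apply/ffunP => i; rewrite sum_ffunE ffunE pi_sum; apply: eq_bigr => j _.
by rewrite !ffunE piZ.
Qed.

(** The coordinate of the product T_1 T_2 on the socle element of degree 2s - 1; it is defined on
    homology by [prg_B1] and [prg_B2]. *)
Definition prg (u w : V3) : k := FA (dot u w).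

Lemma dotqDl c (u u' w : V3) : dot (c *: u + u') w = c *: dot u w + dot u' w.
Proof.
rewrite /dot scaler_sumr -big_split; apply: eq_bigr => j _ /=.
by rewrite !ffunE mulrDl scalerAl.
Qed.

Lemma dotqDr c (u u' w : V3) : dot w (c *: u + u') = c *: dot w u + dot w u'.
Proof.
rewrite /dot scaler_sumr -big_split; apply: eq_bigr => j _ /=.
by rewrite !ffunE mulrDr quot_scaleAr.
Qed.

Lemma prgDl c u u' w : prg (c *: u + u') w = c * prg u w + prg u' w.
Proof. by rewrite /prg dotqDl linearP. Qed.

Lemma prgDr c u u' w : prg w (c *: u + u') = c * prg w u + prg w u'.
Proof. by rewrite /prg dotqDr linearP. Qed.

Lemma prg0l w : prg 0 w = 0.
Proof. by have := prgDl (-1) 0 0 w; rewrite scaler0 addr0 mulN1r addNr. Qed.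

Lemma prg0r w : prg w 0 = 0.
Proof. by have := prgDr (-1) 0 0 w; rewrite scaler0 addr0 mulN1r addNr. Qed.

Lemma prg_suml d (c : 'I_d -> k) (u : 'I_d -> V3) w :
  prg (\sum_i c i *: u i) w = \sum_i c i * prg (u i) w.
Proof.
elim/big_rec2: _ => [|i y1 y2 _ <-]; first exact: prg0l.
by rewrite prgDl.
Qed.

Lemma prg_sumr d (c : 'I_d -> k) (u : 'I_d -> V3) w :
  prg w (\sum_i c i *: u i) = \sum_i c i * prg w (u i).
Proof.
elim/big_rec2: _ => [|i y1 y2 _ <-]; first exact: prg0r.
by rewrite prgDr.
Qed.

Lemma prgBl u u' w : prg (u - u') w = prg u w - prg u' w.
Proof. by rewrite addrC -scaleN1r prgDl mulN1r addrC. Qed.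

Lemma prgBr u u' w : prg w (u - u') = prg w u - prg w u'.
Proof. by rewrite addrC -scaleN1r prgDr mulN1r addrC. Qed.

Lemma prg_pv u w : prg (pv u) (pv w) = Fs (dot u w).
Proof. by rewrite /prg dot_pv FA_pi. Qed.

Lemma prg_B1 u w : B1 u -> Z2 w -> prg u w = 0.
Proof.
move=> [h ->] hw; rewrite /prg.
have -> : dot (crsq h) w = - dot (crsq w) h.
  by rewrite !dotE !ffunE /crs !nxE; ring.
by rewrite hw /dot big1 ?oppr0 ?linear0 // => j _; rewrite ffunE mul0r.
Qed.

Lemma prg_B2 u w : Z1 u -> B2 w -> prg u w = 0.
Proof.
move=> hu [a ->]; rewrite /prg.
have -> : dot u (sclq a) = dotq u * a.
  by rewrite /dotq !dotE !ffunE; ring.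
by rewrite hu mul0r linear0.
Qed.

(** T_1 is I / (x, y, z) I, by u |-> x u_0 + y u_1 + z u_2. This lemma is injectivity of that map,
    and [dot_B1] is its well-definedness. *)
Lemma bnd_pv u h : (forall t, inI (h t)) -> dot (@Xv k) u = dot (@Xv k) h -> B1 (pv u).
Proof.
move=> hh e; have : dot (@Xv k) (fun t => -1 *: h t + u t) = 0.
  by rewrite dotDZr e scaleN1r addNr.
case/koszul_exact => g hg; exists (pv g); apply/ffunP => i.
rewrite crsq_pv -hg ffunE rmorphD /= piZ (_ : \pi_A (h i) = 0) ?scaler0 ?add0r //.
exact/pi_eqI0.
Qed.

Definition liftV_spec (eV : nat -> 'I_3 -> R) := forall i, (i < s)%N ->
  (forall t, eV i t \is (s.-1).-homog) /\ dot (@Xv k) (eV i) = vs i.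

Lemma liftV_exists : exists eV, liftV_spec eV.
Proof.
have h i : exists u : 'I_3 -> R, (i < s)%N ->
    (forall t, u t \is (s.-1).-homog) /\ dot (@Xv k) u = vs i.
  have [lt_i|_] := ltnP i s; last by exists (fun=> 0).
  have hv : vs i \is (s.-1.+1).-homog by rewrite prednK //; apply: vs_homog; apply: ltnW.
  by have [u hu] := lift_homog hv; exists u.
exists (fun i => proj1_sig (constructive_indefinite_description _ (h i))) => i.
by case: (constructive_indefinite_description _ (h i)).
Qed.

Lemma choice_fam (J : finType) (T' : Type) (P : J -> T' -> Prop) :
  (forall j, exists x, P j x) -> exists f : J -> T', forall j, P j (f j).
Proof.
move=> h; exists (fun j => proj1_sig (constructive_indefinite_description _ (h j))) => j.
by case: (constructive_indefinite_description _ (h j)).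
Qed.

Lemma cf_vs i j : (i < s)%N -> (j < s)%N -> cf j (s - j) (vs i) = (i == j)%:R.
Proof.
move=> lt_i lt_j; have cfQ i' : cf j (s - j) (Qs i') = ((j == i') && (s - j == s - i')%N)%:R.
  rewrite linearB /= cf_bk; case: ifP; rewrite ?linear0 ?cf_bk ?subr0 //.
rewrite linearB linearZ /= !cfQ [(j == s)%N]ltn_eqF // mulr0 subr0 eq_sym.
by case: eqP => // ->; rewrite eqxx.
Qed.

(** * The pairing of T_1 and T_2 *)
Section Pairing.
Variables (eV : nat -> 'I_3 -> R) (dV : 'I_s -> 'I_3 -> R) (dW : 'I_mm -> 'I_3 -> R).
Hypothesis heV : liftV_spec eV.
Hypothesis hdV : forall i : 'I_s, cyc2 (dV i) /\
  forall t q, Fs (dV i t * q) = cf i (s - i) ('X_t * q).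
Hypothesis hdW : forall l : 'I_mm, [/\ cyc2 (dW l), forall t, dW l t \is (s.-1).-homog
    & forall l', (l' < mm)%N -> cf l' (s.-1 - l') (dW l i0) = (l' == l)%:R].

Definition eWl (l : 'I_mm) : 'I_3 -> R := unitv i0 (bk 1 l (s.-1 - l)).
Definition e1 : 'I_(s + mm) -> 'I_3 -> R := fam_cat (fun i : 'I_s => eV i) eWl.
Definition f1 : 'I_(s + mm) -> 'I_3 -> R := fam_cat dV dW.

Lemma unitv_homog d j p : p \is d.-homog -> forall t, unitv j p t \is d.-homog.
Proof. by move=> hp t; rewrite /unitv; case: ifP => // _; apply: dhomog0. Qed.

Lemma eWl_homog l t : eWl l t \is s.-homog.
Proof. by apply: unitv_homog; apply: bk_homog; have := ltn_ord l; lia. Qed.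

Lemma dV_pair (i : 'I_s) u : Fs (dot u (dV i)) = cf i (s - i) (dot (@Xv k) u).
Proof.
have [_ h] := hdV i; rewrite /dot !linear_sum; apply: eq_bigr => t _ /=.
by rewrite mulrC h.
Qed.

Lemma e1_cyc i : cyc1 (e1 i).
Proof.
rewrite /e1; apply: (fam_cat_all (P := cyc1)) => {}i; rewrite /cyc1.
  by have [_ ->] := heV (ltn_ord i); apply: vs_inI; apply: ltnW.
by rewrite dot_unitv X0_bk; apply: bk_inI => //; have := ltn_ord i; lia.
Qed.

Lemma f1_cyc i : cyc2 (f1 i).
Proof.
rewrite /f1; apply: (fam_cat_all (P := cyc2)) => {}i; first by case: (hdV i).
by case: (hdW i).
Qed.

(** The diagonal blocks are the normalizations of [dV] and [dW]. The lifts of V pair to 0 with [dW]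
    because 2(s-1) differs from T, and [eWl] pairs to 0 with [dV] because a multiple of x has no
    term y^i z^(s-i). *)
Lemma prg_ef i j : prg (pv (e1 i)) (pv (f1 j)) = (i == j)%:R.
Proof.
rewrite prg_pv -(splitK i) -(splitK j).
case: (split i) => i'; case: (split j) => j' /=;
  rewrite /e1 /f1 ?fam_catl ?fam_catr.
- rewrite dV_pair; have [_ ->] := heV (ltn_ord i').
  by rewrite cf_vs // eq_lshift.
- rewrite eq_lrshift /dot linear_sum big1 // => t _.
  have [h _] := heV (ltn_ord i'); have [_ h' _] := hdW j'.
  by apply: (Fs_homog (dhomogM (h t) (h' t))); lia.
- rewrite dV_pair dot_unitv X0_bk -[bk _ _ _]mulr1 cf_bkS.
  by rewrite eq_rlshift.
- rewrite dot_unitvl Fs_bk1; last by have := ltn_ord i'; lia.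
  by have [_ _ ->] := hdW j'; rewrite ?eq_rshift.
Qed.

(* The radicals of the pairing between 1-cycles and 2-cycles. *)
Definition N1 (u : V3) : Prop := Z1 u /\ forall w, Z2 w -> prg u w = 0.
Definition N2 (w : V3) : Prop := Z2 w /\ forall i, prg (pv (e1 i)) w = 0.

Lemma N1_sub : subspace N1.
Proof.
split; first by split; [case: (@Z1_sub k I)|move=> w _; apply: prg0l].
move=> c u v [hu hu'] [hv hv']; split; first exact: (@Z1_sub k I).2.
by move=> w hw; rewrite prgDl hu' // hv' // mulr0 addr0.
Qed.

Lemma N2_sub : subspace N2.
Proof.
split; first by split; [case: (@Z2_sub k I)|move=> w; apply: prg0r].
move=> c u v [hu hu'] [hv hv']; split; first exact: (@Z2_sub k I).2.
by move=> i; rewrite prgDr hu' // hv' // mulr0 addr0.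
Qed.

Lemma B1_N1 u : B1 u -> N1 u.
Proof. by move=> hu; split; [apply: B1_Z1|move=> w; apply: prg_B1]. Qed.

Lemma B2_N2 w : B2 w -> N2 w.
Proof.
move=> hw; split; first exact: B2_Z2.
by move=> i; apply: prg_B2 hw; apply/Z1_pv/e1_cyc.
Qed.

(** By [pair_zero], orthogonality to the finite family [e1] already gives orthogonality to all
    1-cycles. This bounds the rank of the pairing by s + mm. *)
Lemma N2_perp w u : N2 w -> Z1 u -> prg u w = 0.
Proof.
have [w' ->] := pv_surj w; have [u' ->] := pv_surj u.
move=> [/Z2_pv hw h] /Z1_pv hu; rewrite prg_pv.
apply: (@pair_zero eV) hu => //.
- by move=> i lt_i; case: (heV lt_i).
- move=> i lt_i; have := h (lshift mm (Ordinal lt_i)).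
  by rewrite prg_pv /e1 fam_catl.
- move=> l lt_l; have := h (rshift s (Ordinal lt_l)).
  by rewrite prg_pv /e1 fam_catr dot_unitvl Fs_bk1 //=; lia.
Qed.

Lemma split_Z2 w : Z2 w -> N2 (w - \sum_i prg (pv (e1 i)) w *: pv (f1 i)).
Proof.
move=> hw; split.
  apply: (subspaceB (@Z2_sub k I)) => //; apply: (subspace_sum _ (@Z2_sub k I)) => i _.
  by apply: (subspaceZ _ (@Z2_sub k I)); apply/Z2_pv/f1_cyc.
move=> i; rewrite prgBr prg_sumr (bigD1 i) //= prg_ef eqxx mulr1 big1 ?addr0 ?subrr //.
by move=> j /negbTE ne; rewrite prg_ef eq_sym ne mulr0.
Qed.

Lemma basis_N1 : is_basis_mod (@Z1 k I) N1 (fun i => pv (e1 i)).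
Proof.
split.
- by move=> i; apply/Z1_pv/e1_cyc.
- move=> c [_ h] i; have := h (pv (f1 i)); rewrite prg_suml (bigD1 i) //= prg_ef eqxx mulr1.
  rewrite big1 ?addr0 => [|j /negbTE ne]; last by rewrite prg_ef ne mulr0.
  by apply; apply/Z2_pv/f1_cyc.
- move=> u hu; exists (fun i => prg u (pv (f1 i))); split.
    apply: (subspaceB (@Z1_sub k I)) => //; apply: (subspace_sum _ (@Z1_sub k I)) => i _.
    by apply: (subspaceZ _ (@Z1_sub k I)); apply/Z1_pv/e1_cyc.
  move=> w hw; rewrite prgBl prg_suml.
  have /N2_perp/(_ hu) := split_Z2 hw; rewrite prgBr prg_sumr => /subr0_eq->.
  apply/eqP; rewrite subr_eq0; apply/eqP; apply: eq_bigr => i _; exact: mulrC.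
Qed.

Lemma basis_N2 : is_basis_mod (@Z2 k I) N2 (fun i => pv (f1 i)).
Proof.
split.
- by move=> i; apply/Z2_pv/f1_cyc.
- move=> c [_ h] i; have := h i; rewrite prg_sumr (bigD1 i) //= prg_ef eqxx mulr1.
  by rewrite big1 ?addr0 // => j /negbTE ne; rewrite prg_ef eq_sym ne mulr0.
- by move=> w hw; exists (fun i => prg (pv (e1 i)) w); apply: split_Z2.
Qed.

(* T_1 lives in internal degrees s and s + 1. *)
Lemma N1_homog u : N1 u -> exists h : 'I_3 -> R, (forall t, h t \is s.-homog) /\ B1 (u - pv h).
Proof.
have [u' ->] := pv_surj u => -[/Z1_pv hu hN].
pose P (u : 'I_3 -> R) := exists (c : 'I_s -> k) (h : 'I_3 -> R),
  (forall t, h t \is s.-homog) /\ B1 (pv u - (\sum_i c i *: pv (eV i) + pv h)).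
have sB := @B1_sub k I.
have P_ext v v' : dot (@Xv k) v = dot (@Xv k) v' -> P v -> P v'.
  move=> e [c [h [hh hB]]]; exists c, h; split=> //.
  have hB' : B1 (pv (fun t => -1 *: v t + v' t)).
    apply: (@bnd_pv _ (fun=> 0)); first by move=> t; case: inI_subspace.
    by rewrite dotDZr e scaleN1r addNr /dot big1 // => j _; rewrite mulr0.
  move: hB'; rewrite pvDZ scaleN1r => /(subspaceD sB hB); congr B1.
  by rewrite addrC [- _ + _]addrC addrA subrK.
pose Z p := exists v, dot (@Xv k) v = p /\ P v.
have sZ : subspace Z.
  split.
    exists (fun=> 0); split; first by rewrite /dot big1 // => j _; rewrite mulr0.
    exists (fun=> 0), (fun=> 0); split; first by move=> t; apply: dhomog0.
    by rewrite big1 ?add0r ?subrr; [case: sB|move=> i _; rewrite scale0r].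
  move=> a p q [v [<- [c [h [hh hB]]]]] [v' [<- [c' [h' [hh' hB']]]]].
  exists (fun t => a *: v t + v' t); split; first by rewrite dotDZr.
  exists (fun i => a * c i + c' i), (fun t => a *: h t + h' t); split.
    by move=> t; apply: dhomogD => //; apply: dhomogZ.
  have := sB.2 a _ _ hB hB'; congr B1; rewrite !pvDZ.
  have -> : \sum_i (a * c i + c' i) *: pv (eV i) =
      a *: \sum_i c i *: pv (eV i) + \sum_i c' i *: pv (eV i).
    rewrite scaler_sumr -big_split; apply: eq_bigr => i _ /=.
    by rewrite scalerDl scalerA.
  rewrite scalerBr scalerDr addrACA; congr (_ + _).
  by rewrite -opprD addrACA.
have Pdeg h : (forall t, h t \is s.-homog) -> P h.
  move=> hh; exists (fun=> 0), h; split=> //.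
  by rewrite big1 ?add0r ?subrr; [case: sB|move=> i _; rewrite scale0r].
have : Z (dot (@Xv k) u').
  apply: (inI_inN hu) => //.
  - move=> i lt_i; exists (eV i); split; first by case: (heV lt_i).
    exists (fun j => (j == Ordinal lt_i)%:R), (fun=> 0); split.
      by move=> t; apply: dhomog0.
    rewrite (bigD1 (Ordinal lt_i)) //= eqxx scale1r big1 ?addr0; last first.
      by move=> j /negbTE->; rewrite scale0r.
    have -> : pv (fun=> 0) = 0 by apply/ffunP => t; rewrite !ffunE rmorph0.
    by rewrite addr0 subrr; case: sB.
  - move=> l lt_l; exists (unitv i0 (bk 1 l (s.-1 - l))).
    rewrite dot_unitv X0_bk; split=> //; apply: Pdeg => t.
    by apply: unitv_homog; apply: bk_homog; lia.
  - move=> j; exists (unitv j (Qs s)); rewrite dot_unitv; split=> //; apply: Pdeg => t.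
    by apply: unitv_homog; apply: Qs_homog.
  - move=> j h hh; exists (unitv j h); rewrite dot_unitv; split=> //.
    exists (fun=> 0), (fun=> 0); split; first by move=> t; apply: dhomog0.
    have -> : pv (unitv j h) = 0.
      by apply/ffunP => t; rewrite !ffunE; apply/pi_eqI0; rewrite /unitv; case: ifP => // _;
        case: inI_subspace.
    have -> : pv (fun=> 0) = 0 by apply/ffunP => t; rewrite !ffunE rmorph0.
    by rewrite addr0 sub0r big1 ?oppr0; [case: sB|move=> i _; rewrite scale0r].
move=> [v [/P_ext + /[dup] _]] => h /h {h} [c [h [hh hB]]].
(* Pairing with [dV i] isolates c i: u is in the radical, and h contributes nothing since x h_0 + y
   h_1 + z h_2 has degree s + 1. *)
have c0 i : c i = 0.
  have ZdV : Z2 (pv (dV i)) by apply/Z2_pv; case: (hdV i).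
  have := prg_B1 hB ZdV; rewrite prgBl hN // sub0r => /eqP; rewrite oppr_eq0.
  rewrite -[\sum_i _]scale1r prgDl mul1r prg_suml prg_pv dV_pair.
  have -> : cf i (s - i) (dot (@Xv k) h) = 0.
    have hd : dot (@Xv k) h \is (s.+1).-homog.
      by apply: rpred_sum => t _; apply: (@dhomogM _ _ _ 1) => //; apply: X_homog.
    apply: cf_deg => m hm; apply: (dhomog_nemf_coeff hd).
    apply/eqP => e; have em : mdeg m = s.+1 := e.
    by have := ltn_ord i; lia.
  rewrite addr0 (bigD1 i) //= big1 ?addr0 => [|j /negbTE ne].
    by have := prg_ef (lshift mm i) (lshift mm i); rewrite /e1 /f1 !fam_catl eqxx => ->;
      rewrite mulr1 => /eqP.
  by have := prg_ef (lshift mm j) (lshift mm i); rewrite /e1 /f1 !fam_catl eq_lshift ne => ->;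
    rewrite mulr0.
exists h; split=> //; move: hB; rewrite big1 ?add0r // => i _.
by rewrite c0 scale0r.
Qed.

Lemma dot_B1 v : B1 (pv v) ->
  exists h, (forall t, inI (h t)) /\ dot (@Xv k) v = dot (@Xv k) h.
Proof.
move=> [w]; have [w' ->] := pv_surj w => /ffunP e.
exists (fun t => v t - crs (@Xv k) w' t); split=> [t|].
  by apply: pi_eqIr; have := e t; rewrite crsq_pv ffunE.
by rewrite !dotE /crs !nxE; ring.
Qed.

Lemma socle_dot (u w : V3) : Z1 u -> Z2 w -> socle (dot u w).
Proof.
move=> hu /ffunP hw.
have h0 := hw i0; have h1 := hw i1; have h2 := hw i2.
rewrite !ffunE /crs !nxE in h0 h1 h2.
(* With X = (x, y, z), this is the vector identity u × (X × w) = X (u · w) - w (u · X). *)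
have E j : xq j * dot u w = w j * dotq u + (u (nx j) * crsq w (nx (nx j)) - u (nx (nx j)) * crsq w (nx j)).
  by move: j {h0 h1 h2}; apply: forall_I3; rewrite !nxE !ffunE /dotq !dotE /crs !nxE; ring.
by move=> j; rewrite E hu !hw !ffunE !mulr0 subrr addr0.
Qed.

Lemma dot_ome u (w : V3) : cyc1 u -> (forall t, low s.-1 (u t)) -> Z2 w ->
  dot (pv u) w = prg (pv u) w *: ome.
Proof.
move=> hu lu; have [w' ->] := pv_surj w => hw.
rewrite {1}(@socleE (dot (pv u) (pv w'))); last by apply: socle_dot => //; apply/Z1_pv.
rewrite [HA _](_ : _ = 0) ?scale0r ?addr0 // dot_pv HA_pi.
by apply: Hs_pair => //; apply/Z2_pv.
Qed.

Lemma is_basis_mod_cast (V : lmodType k) (Z B : V -> Prop) a b (eab : a = b) (v : 'I_b -> V) :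
  is_basis_mod Z B v -> is_basis_mod Z B (fun i => v (cast_ord eab i)).
Proof.
case: b / eab v => v [h1 h2 h3]; split.
- by move=> i.
- move=> c hc; apply: h2; move: hc; congr B; apply: eq_bigr => i _.
  by rewrite cast_ord_id.
- move=> z /h3[c hc]; exists c; move: hc; congr (B (_ - _)); apply: eq_bigr => i _.
  by rewrite cast_ord_id.
Qed.

(** * Minimal generators of I from a basis of T_1 *)

Section Generators.
Variables (m : nat) (E : 'I_m -> 'I_3 -> R).
Hypothesis hE : is_basis_mod (@Z1 k I) (@B1 k I) (fun i => pv (E i)).
Hypothesis E_homog : forall i, exists d, forall t, E i t \is d.-homog.

Let g i := dot (@Xv k) (E i).

Lemma gen_inI i : inI (g i).
Proof. by case: hE => h _ _; apply/Z1_pv. Qed.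

Definition inJ p := exists c : 'I_m -> R, p = \sum_i c i * g i.

Lemma inJ_lin a p q : inJ p -> inJ q -> inJ (a * p + q).
Proof.
move=> [c ->] [c' ->]; exists (fun i => a * c i + c' i).
rewrite mulr_sumr -big_split; apply: eq_bigr => i _ /=.
by rewrite mulrDl mulrA.
Qed.

Lemma inJ0 : inJ 0.
Proof. by exists (fun=> 0); rewrite big1 // => i _; rewrite mul0r. Qed.

Lemma inJ_sub : subspace inJ.
Proof. by split; [exact: inJ0|move=> c p q hp hq; rewrite -mul_mpolyC; apply: inJ_lin]. Qed.

Lemma inJ_g i : inJ (g i).
Proof.
exists (fun j => (j == i)%:R); rewrite (bigD1 i) //= eqxx mul1r big1 ?addr0 //.
by move=> j /negbTE->; rewrite mul0r.
Qed.

Lemma g_homog i : exists d, g i \is d.+1.-homog.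
Proof.
have [d hd] := E_homog i; exists d.
by apply: rpred_sum => t _; apply: (@dhomogM _ _ _ 1) => //; apply: X_homog.
Qed.

(** Graded Nakayama: a form in I is a k-combination of the g i modulo (x, y, z) I. Taking
    homogeneous components makes the coefficients of the variables forms in I of smaller degree, to
    which induction applies. *)
Lemma inI_inJ d p : inI p -> p \is d.-homog -> inJ p.
Proof.
elim: d p => [|d IHd] p hp hd.
  have -> : p = 0; last exact: inJ0.
  apply/mpolyP => m0; rewrite mcoeff0.
  have [lt_m|le_m] := ltnP (mdeg m0) s; first exact: inI_low hp _ lt_m.
  apply: (dhomog_nemf_coeff hd); apply/eqP => e; have em : mdeg m0 = 0%N := e.
  by lia.
have [u [hu eu]] := lift_homog hd.
have Zu : Z1 (pv u) by apply/Z1_pv; rewrite /cyc1 eu.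
case: hE => _ _ /(_ _ Zu)[c].
have -> : pv u - \sum_i c i *: pv (E i) = pv (fun t => -1 *: (\sum_i c i *: E i t) + u t).
  by rewrite pvDZ pv_sum scaleN1r addrC.
move/dot_B1 => [h [hh]]; rewrite dotDZr eu scaleN1r.
have -> : dot (@Xv k) (fun t => \sum_i c i *: E i t) = \sum_i c i *: g i.
  rewrite /dot; under eq_bigr do rewrite mulr_sumr.
  rewrite exchange_big; apply: eq_bigr => i _ /=.
  by rewrite scaler_sumr; apply: eq_bigr => t _; rewrite scalerAr.
rewrite addrC => /(congr1 (fun q => q + \sum_i c i *: g i)); rewrite subrK => ep.
rewrite -(pihomog_dE hd) ep pihomogD.
apply: (subspaceD inJ_sub).
  rewrite /dot raddf_sum; apply: (subspace_sum _ inJ_sub) => t _ /=.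
  rewrite pihomog_X -[_ * _]addr0; apply: inJ_lin inJ0.
  by apply: IHd; [apply: inI_homog|apply: pihomogP].
rewrite raddf_sum; apply: (subspace_sum _ inJ_sub) => i _ /=.
rewrite linearZ /=; apply: (subspaceZ _ inJ_sub).
have [e he] := g_homog i; have [ee|ne] := eqVneq e.+1 d.+1.
  by rewrite -ee (pihomog_dE he); apply: inJ_g.
by rewrite (pihomog_ne0 _ he) //; apply: inJ0.
Qed.

Lemma gen_generated : generated_by I g.
Proof.
move=> p; split=> [/hI hp|[c ->]]; last first.
  by apply: rpred_sum => i _; apply: idealMr; apply/hI/gen_inI.
change (inJ p); rewrite (@pihomog_partitionE _ _ mdeg (msize p) p) //.
apply: (subspace_sum _ inJ_sub) => d _.
by apply: inI_inJ (pihomogP _ _ _); apply: inI_homog.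
Qed.

(** Any generators span I / (x, y, z) I, where the classes of the g i are independent; only the
    constant terms of the coefficients matter there. *)
Lemma gen_min (m' : nat) (g' : 'I_m' -> R) : generated_by I g' -> (m <= m')%N.
Proof.
move=> hg'.
have g'I j : inI (g' j).
  apply/hI/hg'; exists (fun i => (i == j)%:R); rewrite (bigD1 j) //= eqxx mul1r.
  by rewrite big1 ?addr0 // => i /negbTE->; rewrite mul0r.
have [u hu] : exists u : 'I_m' -> 'I_3 -> R, forall j, g' j = dot (@Xv k) (u j).
  apply: (@choice_fam _ _ (fun j v => g' j = dot (@Xv k) v)) => j.
  have [u eu] := aug_decomp (g' j); exists u.
  by rewrite {1}eu (inI_low (g'I j)) ?mpolyC0 ?add0r // mdeg0.
case: hE => _ ind _; apply: (indep_leq (@B1_sub k I) ind (w := fun j => pv (u j))) => i.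
have /hI/hg'[c ec] := gen_inI i.
have [a ha] : exists a : 'I_m' -> 'I_3 -> R,
    forall j, c j = ((c j)@_0%MM)%:MP + dot (@Xv k) (a j).
  apply: (@choice_fam _ _ (fun j v => c j = ((c j)@_0%MM)%:MP + dot (@Xv k) v)) => j.
  exact: aug_decomp.
exists (fun j => (c j)@_0%MM).
have -> : pv (E i) - \sum_j (c j)@_0%MM *: pv (u j) =
    pv (fun t => -1 *: (\sum_j (c j)@_0%MM *: u j t) + E i t).
  by rewrite pvDZ pv_sum scaleN1r addrC.
apply: (@bnd_pv _ (fun t => \sum_j a j t * g' j)).
  by move=> t; apply: (subspace_sum _ inI_subspace) => j _; apply: inI_mul.
rewrite dotDZr scaleN1r -[dot _ (E i)]/(g i) ec.
have -> : dot (@Xv k) (fun t => \sum_j (c j)@_0%MM *: u j t) = \sum_j (c j)@_0%MM *: g' j.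
  rewrite /dot; under eq_bigr do rewrite mulr_sumr.
  rewrite exchange_big; apply: eq_bigr => j _ /=.
  by rewrite hu scaler_sumr; apply: eq_bigr => t _; rewrite scalerAr.
rewrite addrC -sumrB /dot; under [RHS]eq_bigr do rewrite mulr_sumr.
rewrite [RHS]exchange_big; apply: eq_bigr => j _ /=.
rewrite {1}ha mulrDl mul_mpolyC addrC addKr /dot mulr_suml.
by apply: eq_bigr => t _; rewrite mulrA.
Qed.

End Generators.

(** The dual families [e1] and [f1] are completed to bases of T_1 and T_2 by bases of the radicals
    modulo boundaries, whose elements pair to 0 with everything. *)
Lemma tor_class_of_pairing : tor_class_G I (s + mm).
Proof.
have [n hn] := A_fin; have h3 := dim_ffun3 hn.
have sB1 := @B1_sub k I; have sB2 := @B2_sub k I.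
have [d1 [n1 hn1]] := dim_mod_exists_fin h3 N1_sub sB1 B1_N1.
have [h hh] : exists h : 'I_d1 -> 'I_3 -> R,
    forall i, (forall t, h i t \is s.-homog) /\ B1 (n1 i - pv (h i)).
  apply: (@choice_fam _ _ (fun i v => (forall t, v t \is s.-homog) /\ B1 (n1 i - pv v))) => i.
  by apply: N1_homog; case: hn1.
have N1h i : N1 (pv (h i)).
  have -> : pv (h i) = n1 i - (n1 i - pv (h i)) by rewrite opprB addrC subrK.
  apply: (subspaceB N1_sub); first by case: hn1.
  by apply: B1_N1; case: (hh i).
have hb1 : is_basis_mod N1 (@B1 k I) (fun i => pv (h i)).
  by apply: (is_basis_mod_congr sB1 N1h _ hn1) => i; case: (hh i).
pose m := (s + mm + d1)%N.
pose E : 'I_m -> 'I_3 -> R := fam_cat e1 h.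
have EZ i : Z1 (pv (E i)).
  rewrite /E; apply: (fam_cat_all (P := fun u => Z1 (pv u))) => j; first exact/Z1_pv/e1_cyc.
  by case: (N1h j).
have hE : is_basis_mod (@Z1 k I) (@B1 k I) (fun i => pv (E i)).
  have hc := is_basis_mod_cat (@Z1_sub k I) N1_sub (fun u (hu : N1 u) => hu.1) B1_N1 basis_N1 hb1.
  apply: (is_basis_mod_congr sB1 EZ _ hc) => i.
  rewrite /E /fam_cat; case: (split i) => j; rewrite subrr; exact: sB1.1.
have E_homog i : exists2 d, (s.-1 <= d)%N & forall t, E i t \is d.-homog.
  rewrite -(splitK i); case: (split i) => j /=; rewrite /E ?fam_catl ?fam_catr; last first.
    by exists s; [lia|case: (hh j)].
  rewrite -(splitK j); case: (split j) => j' /=; rewrite /e1 ?fam_catl ?fam_catr.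
    by exists s.-1 => //; case: (heV (ltn_ord j')).
  by exists s; [lia|apply: eWl_homog].
have [d2 [n2 hn2]] := dim_mod_exists_fin h3 N2_sub sB2 B2_N2.
have hF := is_basis_mod_cat (@Z2_sub k I) N2_sub (fun u (hu : N2 u) => hu.1) B2_N2 basis_N2 hn2.
(* The Euler characteristic fixes the length of the basis of T_2 just obtained; it is reindexed by
   ['I_(m + 1)], the type being 2. *)
have e2 : (m + 1)%N = (s + mm + d2)%N.
  rewrite addn1; apply: (dim_mod_uniq sB2 _ (ex_intro _ _ hF)).
  apply: (euler_T2 _ hn has_dim_socle (ex_intro _ _ hE)).
  by move=> p /hI/inI_low hp; apply: hp; rewrite mdeg0.
pose F0 := fam_cat (fun i => pv (f1 i)) n2.
pose f (j : 'I_(m + 1)) := F0 (cast_ord e2 j).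
have hf : is_basis_mod (@Z2 k I) (@B2 k I) f := is_basis_mod_cast e2 hF.
have prgE i j : prg (pv (E i)) (f j) =
    ((i == j :> nat) && (i < s + mm)%N)%:R.
  have [hfZ _ _] := hf; have Zj := hfZ j; move: Zj; rewrite /f.
  have ej : nat_of_ord (cast_ord e2 j) = j by [].
  rewrite -ej; move: (cast_ord e2 j) => {ej}j'.
  rewrite -(splitK i) -(splitK j').
  case: (split i) => a; case: (split j') => b /=; rewrite /E /F0 ?fam_catl ?fam_catr => Zj.
  - by rewrite prg_ef ltn_ord andbT.
  - case: hn2 => /(_ b)[_ ->] _ _; rewrite ltn_eqF //.
    by have := ltn_ord a; lia.
  - case: (N1h a) => _ -> //; rewrite ltnNge leq_addr andbF //.
  - by case: (N1h a) => _ -> //; rewrite ltnNge leq_addr andbF.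
have gE : forall i : 'I_2, (fun i : 'I_2 => if (i == ord0) (+) true then gam else ome) i =
    if (i == ord0) (+) true then gam else ome by [].
have low_E i t : low s.-1 (E i t).
  by have [d le_d hd] := E_homog i; apply: low_le le_d _; apply: low_homog.
split.
- lia.
- move=> p /hI/inI_low hp mon; rewrite mcoeff_msupp => nz.
  by rewrite leqNgt; apply: contra nz => lt_m; rewrite hp //; lia.
exists m, 1%N, (fun i => K1 (pv (E i))), (fun j => K2 (f j)),
  (fun i => K3 (if (i == ord0) (+) true then gam else ome)).
split.
- split; last exact: has_dim_socle.
  have E_homog' i : exists d, forall t, E i t \is d.-homog.
    by have [d _ hd] := E_homog i; exists d.
  split; first by exists (fun i => dot (@Xv k) (E i)); apply: gen_generated.
  by move=> m' g' hg'; apply: (gen_min hE hg').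
- exact: leq_addr.
- split; [exact: tor_basis1 hE|exact: tor_basis2 hf|].
  exact: tor_basis3 (socv_basis gE).
- move=> i j; rewrite /tor_eq subr0 mul_K1K1; apply/bnd2P.
  have [d le_d hd] := E_homog i; have [d' le_d' hd'] := E_homog j.
  have [a ha] : exists a, forall t, inI (crs (E i) (E j) t - 'X_t * a).
    (* Both degrees are at least s - 1, and 2(s-1) > s because s >= 3. *)
    apply: (@cyc2_bnd _ (d + d')); first by lia.
      move=> t; apply: dhomogD; first by apply: dhomogM.
      by rewrite dhomogN; apply: dhomogM.
    by apply: crs_cyc2; apply/Z1_pv.
  exists (\pi_A a); apply/ffunP => t; rewrite !ffunE /crs !ffunE -!rmorphM -rmorphB.
  by apply: pi_eqI; apply: ha.
move=> i j /=.
have -> : (if (i == j :> nat) && (i < s + mm)%N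
     then K3 (if (ord0 == ord0 :> 'I_2) (+) true then gam else ome) else 0) =
    K3 (dot (pv (E i)) (f j)).
  rewrite dot_ome; [|exact/Z1_pv|exact: low_E|by case: hf].
  rewrite prgE; case: ifP => _; rewrite ?scale1r // scale0r.
  by apply/ffunP => S; rewrite !ffunE; case: ifP.
by rewrite /tor_eq mul_K1K2 mul_K2K1 subrr; split; apply/bnd3P.
Qed.

End Pairing.

Lemma tor_class_I : tor_class_G I (s + mm).
Proof.
have [eV heV] := liftV_exists.
have [dV hdV] := choice_fam (fun i : 'I_s => dualV (ltn_ord i)).
have [dW hdW] := choice_fam (fun l : 'I_mm => dualW (ltn_ord l)).
exact: (@tor_class_of_pairing eV dV dW).
Qed.

End Ring.
End Cycles.
End Compressed.

Theorem corollary8p8 (k : fieldType) (s r : nat)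
    (hs : (3 <= s)%N) (hsr : (s <= r)%N) (hrs : (r <= 2 * s - 1)%N) :
  exists I : idealr {mpoly k[3]},
    [/\ homogeneous_ideal I,
        socle_iso I [:: s; (2 * s - 1)%N],
        artinian {ideal_quot I},
        compressed I (2 * s - 1)%N
      & tor_class_G I r].
Proof.
pose mm := (r - s)%N; pose beta : k := if (mm.+1 < s)%N then 0 else 1.
have s_gt0 : (0 < s)%N by apply: leq_trans hs.
have lt_mm : (mm < s)%N by rewrite /mm; lia.
have hcase : (mm.+1 < s)%N /\ beta = 0 \/ mm.+1 = s /\ beta = 1.
  rewrite /beta; case: ltnP => h; [by left|right; split=> //].
  by apply/eqP; rewrite eqn_leq h lt_mm.
have sI := inI_subspace s mm beta.
have [I hI] : exists I : idealr {mpoly k[3]}, forall p, p \in I <-> inI s mm beta p.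
  apply: idealr_of_prop; [by apply: inI_not1|by case: sI|move=> a p q hp hq].
  by apply: (subspaceD sI) => //; apply: inI_mul.
have er : r = (s + mm)%N by rewrite /mm; lia.
exists I; split.
- exact: homogeneous_I hI.
- exact: socle_iso_I hI.
- exact: artinian_I hI.
- exact: compressed_I hI.
- by rewrite er; apply: tor_class_I hI.
Qed.
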